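(* Let $\mathfrak C$ be a pic (an intersection-closed p-clean collection of submanifolds) in a manifold with corners $M$. Any intersection order on $\mathfrak C$ is permissible for resolution and the resulting resolution is canonically diffeomorphic to the resolution $[M;\mathfrak C]$ obtained from a size order, i.e. all intersection orders are equivalent for resolution.
   Context: Manifolds with corners have embedded boundary hypersurfaces. Adapted coordinates near a point consist of boundary defining functions $x_1,\dots,x_r\ge0$ of the boundary hypersurfaces through the point and further functions $y_l$, giving a diffeomorphism of a neighbourhood onto $[0,\epsilon)^r\times(-\epsilon,\epsilon)^{n-r}$. A p-submanifold is a closed subset which near each of its points is given, in some adapted coordinates, by the vanishing of some of the $x_i$ and some of the $y_l$. Submanifolds are allowed to have a finite number of connected components, all of the same dimension. A finite collection of p-submanifolds is p-clean if near each point of the union there are adapted coordinates $x_j,y_l$ in which each submanifold of the collection containing that point is defined by the vanishing of a subset of the $x_j$ and some linear functions of the $y_l$. A pic is a p-clean collection $\mathfrak C$ such that for $C_1,C_2\in\mathfrak C$ either $C_1\cap C_2=\emptyset$ or $C_1\cap C_2\in\mathfrak C$ (in the sense that each component of the intersection is an element). A size order is a total order on the collection in which the dimension is weakly increasing. An intersection order on a pic is a total order such that for any two elements $F<G$ with non-empty intersection, $F\cap G\le G$ in the order. Blow-up: for a p-submanifold $C\subset M$, $[M;C]$ is the (real, spherical) blow-up of $M$ along $C$, which as a set is the disjoint union of $M\setminus C$ and the inward-pointing spherical normal bundle of $C$; $\beta:[M;C]\to M$ is the blow-down map. A closed subset $Q\subset M$ is liftable under the blow-up of $C$ if either $Q\subset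 C$ or $Q\setminus C$ is dense in $Q$; its lift is $\beta^{-1}(Q)$ in the first case and the closure of $\beta^{-1}(Q\setminus C)$ in the second. An order of a p-clean collection is permissible for resolution if, blowing up successively the (lifts of the) elements in that order, at each step the next element is liftable through each preceding blow-up and its final lift is a p-submanifold. The manifold resulting from blowing up all elements is the resolution. Two permissible orders are equivalent if the identity on the complement of the union of the centres extends to a diffeomorphism of the resolutions. Any size order on a pic is permissible and all size orders are equivalent.
   Formalization: It is assumed in addition that each element F of the pic is liftable under every other element G (F lies in G or F∖G is dense in F), automatic for connected elements; without it {0}, {0,1} in the real line, ordered with {0} first, is a counterexample. *)

(* Defs.v *)
From HB Require Import structures.
From mathcomp Require Import all_boot all_order all_algebra.
From mathcomp Require Import all_classical all_reals all_analysis.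

Set Implicit Arguments.
Unset Strict Implicit.
Unset Printing Implicit Defensive.

Import Order.TTheory GRing.Theory Num.Theory numFieldNormedType.Exports.

Local Open Scope classical_set_scope.
Local Open Scope ring_scope.

Section Smooth.
Variables (R : realType) (V W : normedModType R).

(* All iterated directional derivatives up to order k exist and are continuous
   on U (meant for U open). *)
Fixpoint Ck_on (k : nat) (U : set V) (f : V -> W) : Prop :=
  match k with
  | 0 => forall x, U x -> {for x, continuous f}
  | k'.+1 => (forall x v, U x -> derivable f x v) /\
             (forall v, Ck_on k' U (fun x => 'D_v f x))
  end.

Definition smooth_on (U : set V) (f : V -> W) : Prop :=
  forall k, Ck_on k U f.

End Smooth.

(* A chart with corners on X: crd is only meaningful on dom, and takes values in
   the corner {z | z_i >= 0 for i in bdry} of R^n. The coordinates x_j are the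
   z_i with i in bdry, and the y_l are the others. *)
Record chart (R : realType) (n : nat) (X : Type) : Type := Chart {
  dom : set X;
  crd : X -> 'rV[R]_n;
  bdry : {set 'I_n} }.

(* A set with a family of charts; the axioms of a manifold with corners are
   stated separately, in manifold_with_corners. *)
Record charted_space (R : realType) (n : nat) : Type := ChartedSpace {
  pt :> Type;
  atlas : set (chart R n pt) }.

HB.instance Definition _ (R : realType) (n : nat) (M : charted_space R n) :=
  gen_eqMixin (pt M).
HB.instance Definition _ (R : realType) (n : nat) (M : charted_space R n) :=
  gen_choiceMixin (pt M).

Section AtlasTopology.
Variables (R : realType) (n : nat) (M : charted_space R n).

(* The topology of the atlas: U is open iff, in every chart of the atlas, it is
   relatively open. *)
Definition atlas_open (U : set M) : Prop :=
  forall c p, atlas c -> dom c p -> U p ->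
    exists2 e : R, 0 < e &
      forall q, dom c q -> ball (crd c p) e (crd c q) -> U q.

Let atlas_openT : atlas_open setT.
Proof. by move=> c p _ _ _; exists 1. Qed.

Let atlas_openI : setI_closed atlas_open.
Proof.
move=> A B oA oB c p cM cp [Ap Bp].
have [e e0 eA] := oA c p cM cp Ap; have [d d0 dB] := oB c p cM cp Bp.
exists (Num.min e d); first by rewrite lt_min e0 d0.
move=> q cq pq; split; [apply: eA => //|apply: dB => //].
- by apply: le_ball pq; rewrite ge_min lexx.
- by apply: le_ball pq; rewrite ge_min lexx orbT.
Qed.

Let atlas_open_bigU (I : Type) (f : I -> set M) :
  (forall i, atlas_open (f i)) -> atlas_open (\bigcup_i f i).
Proof.
move=> of_ c p cM cp [i _ fip]; have [e e0 ef] := of_ i c p cM cp fip.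
by exists e => // q cq pq; exists i => //; exact: ef.
Qed.

HB.instance Definition _ :=
  isOpenTopological.Build (pt M) atlas_openT atlas_openI atlas_open_bigU.

End AtlasTopology.

Section Represents.
Variables (R : realType) (n : nat).

(* F is a smooth map, on a neighbourhood in R^n of the coordinates of p, which
   gives h in the coordinates c and d near p. As the coordinates c range over a
   corner, this is smoothness up to the boundary, by local smooth extension. *)
Definition represents (X Y : Type) (c : chart R n X) (d : chart R n Y)
    (h : X -> Y) (p : X) (F : 'rV[R]_n -> 'rV[R]_n) : Prop :=
  exists U : set 'rV[R]_n, [/\ open U, U (crd c p), smooth_on U F &
    forall q, dom c q -> U (crd c q) ->
      dom d (h q) /\ crd d (h q) = F (crd c q)].

Definition compatible (X : Type) (c d : chart R n X) : Prop :=
  forall p, dom c p -> dom d p -> exists F, represents c d id p F.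

Definition corner (B : {set 'I_n}) : set 'rV[R]_n :=
  [set z | forall i, i \in B -> 0 <= z 0 i].

(* crd c is a bijection of dom c onto a relatively open subset of the corner. *)
Definition proper_chart (X : Type) (c : chart R n X) : Prop :=
  [/\ forall p q, dom c p -> dom c q -> crd c p = crd c q -> p = q,
      forall p, dom c p -> corner (bdry c) (crd c p) &
      forall p, dom c p -> exists2 e : R, 0 < e &
        forall z, ball (crd c p) e z -> corner (bdry c) z ->
          exists2 q, dom c q & crd c q = z].

(* The maximal atlas. *)
Definition mchart (M : charted_space R n) (c : chart R n M) : Prop :=
  proper_chart c /\
  forall d, atlas d -> compatible c d /\ compatible d c.

Definition smooth_map (M N : charted_space R n) (h : M -> N) : Prop :=
  forall c d p, mchart c -> mchart d -> dom c p -> dom d (h p) ->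
    exists F, represents c d h p F.

Definition diffeomorphism (M N : charted_space R n) (h : M -> N) : Prop :=
  exists g : N -> M, [/\ cancel h g, cancel g h, smooth_map h & smooth_map g].

End Represents.

Section Manifold.
Variables (R : realType) (n : nat) (M : charted_space R n).
Implicit Types (p q : M) (c d : chart R n M) (C Q : set M).

Definition adapted p c : Prop :=
  [/\ mchart c, dom c p, crd c p = 0 &
    exists2 e : R, 0 < e &
      crd c @` dom c = [set z | corner (bdry c) z /\ forall i, `|z 0 i| < e]].

Definition vanishing c (I : {set 'I_n}) C : Prop :=
  forall q, dom c q -> (C q <-> forall i, i \in I -> crd c q 0 i = 0).

Definition component (A K : set M) : Prop :=
  exists2 x, A x & K = connected_component A x.

(* The empty set is a p-submanifold, of every dimension. *)
Definition p_submanifold_dim (k : nat) C : Prop :=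
  [/\ closed C,
      finite_set [set K | component C K] &
      forall p, C p -> exists c (I : {set 'I_n}),
        [/\ adapted p c, vanishing c I C & (#|I| + k = n)%N]].

Definition p_submanifold C : Prop := exists k, p_submanifold_dim k C.

Definition codim1_boundary : set M :=
  [set p | exists c, [/\ mchart c, dom c p &
     #|[set i in bdry c | crd c p 0 i == 0]| = 1%N]].

Definition boundary_hypersurface (H : set M) : Prop :=
  exists2 K, component codim1_boundary K & H = closure K.

(* The last clause says that the boundary hypersurfaces are embedded: two local
   faces {x_i = 0}, {x_j = 0} at a point never belong to the same one. *)
Definition manifold_with_corners : Prop :=
  [/\ forall c, atlas c -> mchart c,
      forall p, exists2 c, atlas c & dom c p,
      hausdorff_space (pt M),
      @second_countable (pt M) &
      forall H, boundary_hypersurface H -> p_submanifold H].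

(* A tangent vector at p is the family of its components in the charts around p
   (with the value 0 for the other charts). *)
Definition tangent p (v : chart R n M -> 'rV[R]_n) : Prop :=
  (forall c, ~ (mchart c /\ dom c p) -> v c = 0) /\
  (forall c d F, mchart c -> mchart d -> dom c p -> dom d p ->
     represents c d id p F -> v d = 'D_(v c) F (crd c p)).

Definition inward p (v : chart R n M -> 'rV[R]_n) : Prop :=
  tangent p v /\
  forall c i, mchart c -> dom c p -> i \in bdry c -> crd c p 0 i = 0 ->
    0 <= v c 0 i.

(* v lies in the tangent space at p of the p-submanifold C. *)
Definition tangent_to C p (v : chart R n M -> 'rV[R]_n) : Prop :=
  tangent p v /\
  exists c (I : {set 'I_n}), [/\ mchart c, dom c p, vanishing c I C &
    forall i, i \in I -> v c 0 i = 0].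

(* The elements of the fibre at p of the inward-pointing spherical normal bundle
   of C, i.e. the open rays of T_p M / T_p C with an inward-pointing
   representative, as subsets of T_p M. *)
Definition normal_ray C p (S : set (chart R n M -> 'rV[R]_n)) : Prop :=
  exists v, [/\ inward p v, ~ tangent_to C p v &
    S = [set w | tangent p w /\ exists2 a : R, 0 < a &
           tangent_to C p (fun c => w c - a *: v c)]].

End Manifold.

Section BlowUp.
Variables (R : realType) (n : nat) (M : charted_space R n) (C : set M).

Definition blowup_pt : Type :=
  ({p : M | ~ C p} +
   {pS : M * set (chart R n M -> 'rV[R]_n) |
      C pS.1 /\ normal_ray C pS.1 pS.2})%type.

Definition blowdown_pt (x : blowup_pt) : M :=
  match x with inl p => proj1_sig p | inr pS => (proj1_sig pS).1 end.

Definition complement_chart (e : chart R n blowup_pt) : Prop :=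
  exists c : chart R n M, [/\ atlas c, bdry e = bdry c,
    forall x, dom e x <-> dom c (blowdown_pt x) /\ ~ C (blowdown_pt x) &
    forall x, dom e x -> crd e x = crd c (blowdown_pt x)].

(* Projective coordinates: if C is {z_k = 0, k in I} in the chart c, i is in I
   and s = 1 or -1, they are t = s z_i, u_j = z_j / t for j in I distinct from i,
   and z_j for j outside I, on the region where s z_i > 0. They extend to the
   normal rays [v] with s v_i > 0 by t = 0, u_j = v_j / (s v_i). The coordinate t
   has index i and is a boundary coordinate. *)
Definition projective_chart (e : chart R n blowup_pt) : Prop :=
  exists (c : chart R n M) (I : {set 'I_n}) (i : 'I_n) (s : R),
    [/\ mchart c /\ vanishing c I C,
        i \in I /\ (s = 1 \/ s = -1),
        bdry e = i |: bdry c,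
        forall x, dom e x <-> dom c (blowdown_pt x) /\
          match x with
          | inl p => 0 < s * crd c (proj1_sig p) 0 i
          | inr pS => forall v, (proj1_sig pS).2 v -> 0 < s * v c 0 i
          end &
        forall x, dom e x ->
          match x with
          | inl p => let z := crd c (proj1_sig p) in
              crd e x = \row_j (if j == i then s * z 0 i
                                else if j \in I then z 0 j / (s * z 0 i)
                                else z 0 j)
          | inr pS => forall v, (proj1_sig pS).2 v ->
              crd e x = \row_j (if j == i then 0
                                else if j \in I then v c 0 j / (s * v c 0 i)
                                else crd c (proj1_sig pS).1 0 j)
          end].

Definition blowup : charted_space R n :=
  ChartedSpace [set e | complement_chart e \/ projective_chart e].

Definition blowdown (x : blowup) : M := blowdown_pt x.

Definition liftable (Q : set M) : Prop :=
  closed Q /\ (Q `<=` C \/ Q `<=` closure (Q `\` C)).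

Definition lift (Q : set M) : set blowup :=
  if `[< Q `<=` C >] then blowdown @^-1` Q
  else closure (blowdown @^-1` (Q `\` C)).

End BlowUp.

Arguments blowdown {R n M} C x.
Arguments lift {R n M} C Q.

Section Resolution.
Variables (R : realType) (n : nat) (M : charted_space R n).

(* N is the current stage, b : N -> M the blow-down map so far, and L maps a
   subset of M to its lift to N. *)
Fixpoint resolution_from (N : charted_space R n) (b : N -> M) (L : set M -> set N)
    (s : seq (set M)) : {N' : charted_space R n & N' -> M} :=
  match s with
  | [::] => existT (fun N' : charted_space R n => N' -> M) N b
  | C :: t => resolution_from (fun x => b (blowdown (L C) x))
                              (fun Q => lift (L C) (L Q)) t
  end.

Fixpoint permissible_from (N : charted_space R n) (L : set M -> set N)
    (s : seq (set M)) : Prop :=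
  match s with
  | [::] => True
  | C :: t => [/\ p_submanifold (L C),
                  forall Q, Q \in t -> liftable (L C) (L Q) &
                  permissible_from (fun Q => lift (L C) (L Q)) t]
  end.

Definition resolution (s : seq (set M)) : charted_space R n :=
  projT1 (resolution_from (fun x : M => x) (fun Q => Q) s).

Definition resolution_blowdown (s : seq (set M)) : resolution s -> M :=
  projT2 (resolution_from (fun x : M => x) (fun Q => Q) s).

Definition permissible (s : seq (set M)) : Prop :=
  permissible_from (fun Q : set M => Q) s.

(* Over the complement of the centres the blow-down maps are bijective, so the
   last clause says that h extends the identity of that complement. *)
Definition equivalent_orders (s t : seq (set M)) : Prop :=
  [/\ permissible s, permissible t &
    exists h : resolution s -> resolution t, diffeomorphism h /\
      forall x, (forall C, C \in s -> ~ C (resolution_blowdown x)) ->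
        resolution_blowdown (h x) = resolution_blowdown x].

End Resolution.

Section Pic.
Variables (R : realType) (n : nat) (M : charted_space R n).
Implicit Types (CC : set (set M)) (F G C E : set M) (s : seq (set M)).

(* The columns of A are linear functions of the coordinates y_l. *)
Definition p_clean CC : Prop :=
  [/\ finite_set CC,
      forall C, CC C -> p_submanifold C &
      forall p, (\bigcup_(C in CC) C) p -> exists2 c, adapted p c &
        forall C, CC C -> C p ->
          exists (J : {set 'I_n}) (m : nat) (A : 'M[R]_(n, m)),
            [/\ J \subset bdry c,
                forall i k, i \in bdry c -> A i k = 0 &
                forall q, dom c q ->
                  (C q <-> (forall j, j \in J -> crd c q 0 j = 0) /\
                           crd c q *m A = 0)]].

Definition pic CC : Prop :=
  p_clean CC /\
  forall F G, CC F -> CC G ->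
    [\/ F `&` G = set0, CC (F `&` G) |
        forall K, component (F `&` G) K -> CC K].

(* A connected F is automatically liftable under every other element of a
   p-clean collection. This is a genuine condition only on disconnected
   elements: {0} and {0, 1} form a pic in the real line, but {0, 1} is not
   liftable under {0}. *)
Definition mutually_liftable CC : Prop :=
  forall F G, CC F -> CC G -> F <> G -> liftable G F.

(* Total orders on a finite collection are enumerations s, in increasing order,
   without repetition. *)
Definition total_order_on CC s : Prop := uniq s /\ CC = [set` s].

Definition precedes s F G : Prop :=
  [/\ F \in s, G \in s & (index F s < index G s)%N].

Definition size_order CC s : Prop :=
  total_order_on CC s /\
  forall F G, precedes s F G -> exists k l : nat,
    [/\ p_submanifold_dim k F, p_submanifold_dim l G & (k <= l)%N].

(* F `&` G <= G means that F `&` G, or each of its components, is an element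
   equal to or preceding G. *)
Definition intersection_order CC s : Prop :=
  total_order_on CC s /\
  forall F G, precedes s F G -> F `&` G !=set0 ->
    forall E, CC E -> E = F `&` G \/ component (F `&` G) E ->
      E = G \/ precedes s E G.

End Pic.

(* Main.v *)
(* In suitable adapted coordinates the elements of a pic are linear subspaces
   compatible with the boundary. This, and closure under intersection, persist
   when an element C minimal for inclusion is blown up: any other element
   meeting C contains it, hence lifts to a linear subspace in projective
   coordinates. So every enumeration compatible with inclusion is permissible.

   Blow-ups with centres C and X commute when C is contained in X or when they
   are transversal: the composites of the projective charts coincide, and the
   chart maps glue because the blow-down maps are injective over a dense set.

   In an intersection order choose C minimal for inclusion and write the order
   as s1, C, s2. After blowing up C the order s1, s2 is again an intersection
   order of a pic, so inductively it is equivalent to an order compatible with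
   inclusion, and it remains to move C back across s1 one element at a time: at
   each point C is contained in the elements of s1 until the smallest of them
   has been blown up, and is transversal to the lifts of the others from then
   on. *)
From HB Require Import structures.
From mathcomp Require Import all_boot all_order all_algebra.
From mathcomp Require Import all_classical all_reals all_analysis.
From mathcomp Require Import ring lra zify.
Require Import Defs.
Set Implicit Arguments.
Unset Strict Implicit.
Unset Printing Implicit Defensive.

Import Order.TTheory GRing.Theory Num.Theory numFieldNormedType.Exports.

Local Open Scope classical_set_scope.
Local Open Scope ring_scope.


(** * Calculus *)


(** A pic speaks of whole intersections or of their components, but the lift of a connected set may
    be disconnected: after a blow-up only germs of intersections stay under control. So the
    induction runs on a [family] of labelled closed sets, with two conditions on an enumeration.
    [ordered] is compatibility with inclusion; [closing] says that near each point an intersection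
    is an element not later than both. Size orders and intersection orders are both [closing], so
    each is compared with one auxiliary inclusion order and never with the other kind directly.

    In the induction the block s1 before C is first put in inclusion order: only then is each
    element that C crosses minimal among the remaining ones, as the commutation requires. Afterwards
    s1 gets its own order back by induction on the length.

    Two costs come from the definitions. Transition maps between projective charts are smooth by a
    division that needs Hadamard's lemma. And a p-submanifold has finitely many components, which
    must be proved again for every lift and for the intersections of the moving centre with the
    other elements. *)

Section Calculus.
Variable R : realType.

Lemma is_derive_line (V W : normedModType R) (f : V -> W) (x v : V) (t : R) :
  derivable f (x + t *: v) v ->
  is_derive t 1 (fun t => f (x + t *: v)) ('D_v f (x + t *: v)).
Proof.
have E : (fun h : R => h^-1 *: (((fun t => f (x + t *: v)) \o shift t) (h *: 1) -
    f (x + t *: v))) =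
    (fun h => h^-1 *: ((f \o shift (x + t *: v)) (h *: v) - f (x + t *: v))).
  apply/funext => h /=; congr (_ *: (f _ - _)).
  by rewrite [h *: 1]mulr1 scalerDl addrCA.
by move=> dv; split; rewrite /derivable /derive E.
Qed.

Lemma deriveZdir (V W : normedModType R) (f : V -> W) (x v : V) (c : R) :
  derivable f x v -> is_derive x (c *: v) f (c *: 'D_v f x).
Proof.
move=> dv; have [->|c0] := eqVneq c 0; first by rewrite !scale0r; exact: is_derive0.
have H : (fun h : R => h^-1 *: ((f \o shift x) (h *: (c *: v)) - f x)) @ 0^' -->
    c *: 'D_v f x.
  have -> : (fun h : R => h^-1 *: ((f \o shift x) (h *: (c *: v)) - f x)) =
      (fun h => c *: ((fun k : R => k^-1 *: ((f \o shift x) (k *: v) - f x)) (c * h))).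
    apply/funext => h /=; rewrite !scalerA (mulrC h) invfM mulrA divff// mul1r.
    by [].
  apply: (@cvgZl_tmp).
  apply: (@cvg_comp _ _ _ ( *%R c) (fun k : R => k^-1 *: ((f \o shift x) (k *: v) - f x)) _ _ _ _ dv).
  move=> A; rewrite /= /dnbhs /within /= => /nbhs_ballP[e /= e0 eA].
  apply/nbhs_ballP; exists (e / `|c|) => /=; first by rewrite divr_gt0// normr_gt0.
  move=> h; rewrite /ball /= sub0r normrN => he h0.
  apply: eA; last by rewrite mulf_neq0.
  by rewrite /ball /= sub0r normrN normrM mulrC -ltr_pdivlMr // normr_gt0.
by split; [apply/cvg_ex; exists (c *: 'D_v f x)|exact: cvg_lim].
Qed.

Lemma differentiable_eps (V W : normedModType R) (f : V -> W) (x : V)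
    (L : {linear V -> W}) : continuous L ->
  (forall e, 0 < e -> \forall h \near (0 : V), `|f (h + x) - f x - L h| <= e * `|h|) ->
  differentiable f x.
Proof.
move=> cL H; apply/diffP => /=.
(* The differential is picked by [get] among the linear maps with this property, so exhibiting one
   of them is enough. *)
apply: (@getPex _ (fun (df : {linear V -> W}) => continuous df /\
  forall y, f y = f (lim (nbhs x)) + df (y - lim (nbhs x))
                  +o_(y \near x) (y - lim (nbhs x)))).
exists L; split => //; rewrite lim_id //.
rewrite /=.
suff E : (f = (fun y => f x + L (y - x)) +o_x (center x))%R.
  by move=> y; rewrite {1}E.
apply/eqaddoP => e e0; rewrite [\forall x \near _, _ <= _](near_shift 0) /=.
apply: filterS (H _ e0) => h /=.
rewrite subr0 addrK; congr (`|_| <= _).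
have -> : (f - (fun y : V => f x + L (y - x))) (h + x) =
  f (h + x) - (f x + L (h + x - x)) by [].
by rewrite addrK opprD addrA.
Qed.


Lemma coord_le_norm m n (v : 'M[R]_(m, n)) i j : `|v i j| <= `|v|.
Proof.
rewrite [leRHS]/Num.Def.normr/= mx_normrE.
exact: (le_bigmax _ (fun k : 'I_m * 'I_n => `|v k.1 k.2|) (i, j)).
Qed.

Lemma norm_le_coord m n (v : 'M[R]_(m, n)) e : 0 <= e ->
  (forall i j, `|v i j| <= e) -> `|v| <= e.
Proof.
move=> e0 H; rewrite [leLHS]/Num.Def.normr/= mx_normrE.
by apply: bigmax_le => // -[i j] _; exact: H.
Qed.

Lemma norm_lt_coord m n (v : 'M[R]_(m, n)) e : 0 < e ->
  (forall i j, `|v i j| < e) -> `|v| < e.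
Proof.
move=> e0 H; rewrite [ltLHS]/Num.Def.normr/= mx_normrE.
by apply: bigmax_lt => // -[i j] _; exact: H.
Qed.

Lemma ball_rowP n (x y : 'rV[R]_n) e : 0 < e ->
  ball x e y <-> forall i, `|x 0 i - y 0 i| < e.
Proof.
move=> e0; rewrite -ball_normE /=; split=> [H i|H].
  by apply: le_lt_trans H; have := coord_le_norm (x - y) 0 i; rewrite !mxE.
by apply: norm_lt_coord => // i j; rewrite ord1 !mxE.
Qed.

Lemma Ck_eq (V W : normedModType R) k (U : set V) (f g : V -> W) : open U ->
  (forall x, U x -> f x = g x) -> Ck_on k U f -> Ck_on k U g.
Proof.
move=> oU; have nU x : U x -> nbhs x U by move=> Ux; apply: open_nbhs_nbhs.
elim: k f g => [|k IH] f g fg /=.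
  move=> cf x Ux; have cfx : f @ x --> f x := cf x Ux.
  change (g @ x --> g x); rewrite -fg//.
  apply: cvg_trans cfx; apply: near_eq_cvg.
  by apply: filterS (nU _ Ux) => y; exact: fg.
have nfg x : U x -> {near x, f =1 g} by move=> /nU; apply: filterS.
move=> [df cf]; split=> [x v Ux|v].
  by apply: near_eq_derivable (nfg _ Ux) _; exact: df.
by apply: IH (cf v) => x Ux; exact/near_eq_derive/nfg.
Qed.

Section RealValued.
Variable n : nat.
Implicit Types (f g : 'rV[R]_n -> R) (U : set 'rV[R]_n) (x v : 'rV[R]_n).

Local Notation dlt j := (delta_mx 0 j : 'rV[R]_n).

Lemma near_forall_ord (T : topologicalType) m (x : T) (P : 'I_m -> set T) :
  (forall j, \forall y \near x, P j y) -> \forall y \near x, forall j, P j y.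
Proof.
have Fx : Filter (nbhs x) by exact: nbhs_filter.
exact: (@filter_forall _ _ P _ Fx).
Qed.

Lemma sum_coord_continuous (a : 'I_n -> R) :
  continuous (fun h : 'rV[R]_n => \sum_j h 0 j * a j).
Proof.
apply: continuous_big => [|j _]; first exact: add_continuous.
move=> y; have Fy : Filter (nbhs y) := nbhs_filter y.
apply: (@cvgMr_tmp _ _ _ Fy (fun h : 'rV[R]_n => h 0 j) (y 0 j) (a j)).
exact: (@coord_continuous R 1 n 0 j y).
Qed.

(** The increment is telescoped along a path that changes one coordinate at a time. On each piece
    the mean value theorem gives a partial derivative close to the one at x. *)
Lemma C1_differentiable f U x : open U -> U x ->
  (forall x v, U x -> derivable f x v) ->
  (forall v, {for x, continuous (fun x => 'D_v f x)}) ->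
  differentiable f x.
Proof.
move=> oU Ux dU cU.
pose L0 (h : 'rV[R]_n) : R := \sum_j h 0 j * 'D_(dlt j) f x.
have linL : linear L0.
  move=> a u v; rewrite /L0 scaler_sumr -big_split /=; apply: eq_bigr => j _.
  by rewrite !mxE mulrDl -mulrA.
pose Lm := GRing.isLinear.Build _ _ _ _ L0 linL.
pose L : {linear 'rV[R]_n -> R} := HB.pack L0 Lm.
have cL : continuous L.
  exact: sum_coord_continuous.
apply: (differentiable_eps cL) => e e0.
(* There are n pieces, each with error at most e' times the norm of h; the successor keeps the
   denominator nonzero. *)
pose e' := e / n.+1%:R.
have e'0 : 0 < e' by rewrite divr_gt0.
have : \forall h \near (0 : 'rV[R]_n), U (x + h) /\
    forall j, `|'D_(dlt j) f (x + h) - 'D_(dlt j) f x| < e'.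
  apply: filterI.
    have : \forall y \near x, U y by apply: open_nbhs_nbhs.
    rewrite (near_shift 0) /=; apply: filterS => h /=.
    by rewrite subr0 addrC.
  apply: (@near_forall_ord _ n _
    (fun j h => `|'D_(dlt j) f (x + h) - 'D_(dlt j) f x| < e')) => j.
  have /cvgrPdist_lt/(_ _ e'0) := cU (dlt j).
  move=> /nbhs_ballP[d /= d0 dH]; apply/nbhs_ballP; exists d => //= h.
  rewrite -ball_normE /= sub0r normrN => hd; rewrite distrC; apply: dH.
  by rewrite -ball_normE /= opprD addrA subrr sub0r normrN.
move=> /nbhs_ballP[d /= d0 dH]; apply/nbhs_ballP; exists d => //= h.
rewrite -ball_normE /= sub0r normrN => hd.
pose hk (k : nat) : 'rV[R]_n := \row_j (if (j < k)%N then h 0 j else 0).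
have hkS (k : 'I_n) : hk k.+1 = hk k + h 0 k *: dlt k.
  apply/rowP => j; rewrite !mxE eqxx /= ltnS leq_eqVlt.
  have [->|jk] := eqVneq j k; first by rewrite eqxx ltnn mulr1 add0r.
  rewrite (inj_eq val_inj) (negPf jk).
  by rewrite /= mulr0 addr0.
have hk_le k : `|hk k| <= `|h|.
  apply: norm_le_coord => // i j; rewrite ord1 !mxE.
  by case: ifP => _; rewrite ?normr0//; exact: coord_le_norm.
have hk0 : hk 0%N = 0 by apply/rowP => j; rewrite !mxE.
have hkn : hk n = h by apply/rowP => j; rewrite !mxE ltn_ord.
have step (k : 'I_n) : `|f (x + hk k.+1) - f (x + hk k) -
    h 0 k * 'D_(dlt k) f x| <= e' * `|h|.
  pose w := h 0 k *: dlt k.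
  have in_d (t : R) : t \in `[0, 1] -> `|hk k + t *: w| <= `|h|.
    rewrite in_itv /= => /andP[t0 t1].
    apply: norm_le_coord => // i j; rewrite ord1 !mxE eqxx /=.
    have [->|jk] := eqVneq j k.
      rewrite ltnn add0r mulr1 normrM ger0_norm//.
      by apply: le_trans (coord_le_norm h 0 k); rewrite ler_piMl.
    by rewrite !mulr0 addr0; case: ifP => _; rewrite ?normr0//; exact: coord_le_norm.
  have dH' (t : R) : t \in `[0, 1] -> U (x + (hk k + t *: w)) /\
     forall j, `|'D_(dlt j) f (x + (hk k + t *: w)) - 'D_(dlt j) f x| < e'.
    move=> t01; apply: dH; rewrite -ball_normE /= sub0r normrN.
    by apply: le_lt_trans hd; exact: in_d.
  pose psi (t : R) := f (x + hk k + t *: w).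
  have dpsi (t : R) : t \in `[0, 1] ->
      is_derive t 1 psi (h 0 k * 'D_(dlt k) f (x + hk k + t *: w)).
    move=> t01; have [Ut _] := dH' t t01; rewrite addrA in Ut.
    have [D1 D2] := deriveZdir (h 0 k) (dU _ (dlt k) Ut).
    by rewrite -[_ * _]D2; exact: is_derive_line.
  pose psi' (t : R) := h 0 k * 'D_(dlt k) f (x + hk k + t *: w).
  have psi1 (t : R) : t \in `]0, 1[ -> is_derive t 1 psi (psi' t).
    by move=> t01; apply: dpsi; apply: subset_itv_oo_cc t01.
  have psi2 : {within `[0, 1], continuous psi}.
    by apply: derivable_within_continuous => t /dpsi[].
  have [c c01] := MVT_segment ler01 psi1 psi2.
  rewrite /psi /psi' scale1r scale0r addr0 subr0 mulr1 -addrA -hkS => ->.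
  rewrite -mulrBr normrM mulrC ler_pM//; last exact: coord_le_norm.
  by have [_ /(_ k)] := dH' c c01; rewrite addrA => /ltW.
have tel : f (h + x) - f x - L h = \sum_(k < n) (f (x + hk k.+1) - f (x + hk k) -
    h 0 k * 'D_(dlt k) f x).
  rewrite sumrB; congr (_ - _).
  rewrite -(big_mkord xpredT (fun k => f (x + hk k.+1) - f (x + hk k))).
  by rewrite (telescope_sumr (fun k => f (x + hk k)))// hkn hk0 addr0 [h + x]addrC.
rewrite tel; apply: le_trans (ler_norm_sum _ _ _) _.
apply: (@le_trans _ _ (\sum_(k < n) e' * `|h|)); first exact: ler_sum.
rewrite sumr_const card_ord -mulr_natr mulrAC ler_wpM2r//.
by rewrite /e' mulrAC ler_pdivrMr// ler_wpM2l ?(ltW e0)// ler_nat.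
Qed.

Lemma Ck_coord_differentiable k f U x : open U -> U x ->
  Ck_on k.+1 U f -> differentiable f x.
Proof.
move=> oU; elim: k f x => [|k IH] f x Ux [df cf].
  by apply: (C1_differentiable oU Ux df) => v; exact: cf.
apply: (C1_differentiable oU Ux df) => v.
exact/differentiable_continuous/IH.
Qed.

(** [Ck_on k.+1] does not ask for continuity of the function itself; it comes from
    differentiability, through [C1_differentiable]. *)
Lemma CkW k f U : open U -> Ck_on k.+1 U f -> Ck_on k U f.
Proof.
move=> oU; elim: k f => [|k IH] f H.
  by move=> x Ux; apply: differentiable_continuous; exact: Ck_coord_differentiable H.
by case: H => df cf; split => // v; exact: IH.
Qed.

Lemma Ck_cst k U (a : R) : open U -> Ck_on k U (cst a : 'rV[R]_n -> R).
Proof.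
move=> oU; elim: k a => [|k IH] a; first by move=> x _; exact: cst_continuous.
split=> [x v _|v]; first exact: derivable_cst.
by apply: (Ck_eq oU _ (IH 0)) => x _; rewrite derive_cst.
Qed.

Lemma CkD k f g U : open U -> Ck_on k U f -> Ck_on k U g ->
  Ck_on k U (fun x => f x + g x).
Proof.
move=> oU; elim: k f g => [|k IH] f g.
  by move=> cf cg x Ux; apply: continuousD; [exact: cf|exact: cg].
move=> [df cf] [dg cg]; split=> [x v Ux|v]; first exact: derivableD (df _ _ Ux) (dg _ _ Ux).
apply: (Ck_eq oU _ (IH _ _ (cf v) (cg v))) => x Ux.
by rewrite (deriveD (df _ _ Ux) (dg _ _ Ux)).
Qed.

Lemma CkM k f g U : open U -> Ck_on k U f -> Ck_on k U g ->
  Ck_on k U (fun x => f x * g x).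
Proof.
move=> oU; elim: k f g => [|k IH] f g.
  by move=> cf cg x Ux; apply: continuousM; [exact: cf|exact: cg].
move=> Cf Cg; have Cf' := CkW oU Cf; have Cg' := CkW oU Cg.
case: Cf Cg => df cf [dg cg]; split=> [x v Ux|v].
  exact: derivableM (df _ _ Ux) (dg _ _ Ux).
apply: (Ck_eq oU _ (CkD oU (IH _ _ Cf' (cg v)) (IH _ _ Cg' (cf v)))) => x Ux.
by rewrite (deriveM (df _ _ Ux) (dg _ _ Ux)).
Qed.

Lemma Ck_sum k (I : Type) (r : seq I) (P : pred I) (F : I -> 'rV[R]_n -> R) U :
  open U -> (forall i, P i -> Ck_on k U (F i)) ->
  Ck_on k U (fun x => \sum_(i <- r | P i) F i x).
Proof.
move=> oU H; elim: r => [|i r IH].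
  by apply: (Ck_eq oU _ (Ck_cst k 0 oU)) => x _; rewrite big_nil.
have [Pi|nPi] := boolP (P i).
  by apply: (Ck_eq oU _ (CkD oU (H i Pi) IH)) => x _; rewrite big_cons Pi.
by apply: (Ck_eq oU _ IH) => x _; rewrite big_cons (negPf nPi).
Qed.

Lemma CkV k f U : open U -> (forall x, U x -> f x != 0) -> Ck_on k U f ->
  Ck_on k U (fun x => (f x)^-1).
Proof.
move=> oU f0; elim: k f f0 => [|k IH] f f0.
  by move=> cf x Ux; apply: continuousV; [exact: f0|exact: cf].
move=> Cf; have Cf' := IH _ f0 (CkW oU Cf).
case: Cf => df cf; split=> [x v Ux|v]; first exact: derivableV (f0 _ Ux) (df _ _ Ux).
apply: (Ck_eq oU _ (CkM oU (CkM oU (Ck_cst k (-1) oU) (CkM oU Cf' Cf')) (cf v))) => x Ux.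
by rewrite (deriveV (f0 _ Ux) (df _ _ Ux)) /= expr2 invfM mulN1r.
Qed.

Lemma Ck_coord k U j : open U -> Ck_on k U (fun x : 'rV[R]_n => x 0 j).
Proof.
move=> oU; case: k => [|k]; first by move=> x _; exact: coord_continuous.
have D (x v : 'rV[R]_n) : is_derive x v (fun x : 'rV[R]_n => x 0 j) (v 0 j).
  have [d1 d2] := is_derive_id x v.
  have d1' := (derivable_mxP _ _ _).1 d1 0 j.
  split => //; have := derive_mx d1; rewrite d2 => /matrixP/(_ 0 j).
  by rewrite mxE.
split=> [x v _|v]; first by case: (D x v).
by apply: (Ck_eq oU _ (Ck_cst k (v 0 j) oU)) => x _; rewrite (derive_val (is_derive:=D x v)).
Qed.

End RealValued.

Lemma Ck_rowP n m k (U : set 'rV[R]_n) (F : 'rV[R]_n -> 'rV[R]_m) : open U ->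
  Ck_on k U F <-> forall j, Ck_on k U (fun x => F x 0 j).
Proof.
move=> oU; elim: k F => [|k IH] F /=.
  split=> [cF j x Ux|cF x Ux].
    by apply: (@continuous_comp _ _ _ F (fun M : 'rV[R]_m => M 0 j));
      [exact: cF|exact: coord_continuous].
  change (F @ x --> F x); apply/(@cvgrPdist_lt _ _ _ (nbhs x)) => e e0.
  have : \forall y \near x, forall j, `|F x 0 j - F y 0 j| < e.
    apply: near_forall_ord => j.
    by have /cvgrPdist_lt/(_ _ e0) := cF j x Ux.
  apply: filterS => y H; apply: norm_lt_coord => // i j.
  by rewrite ord1 !mxE.
split=> [[dF cF] j|H].
  split=> [x v Ux|v]; first by have /derivable_mxP := dF x v Ux; exact.
  have /IH/(_ j) := cF v; apply: Ck_eq => // x Ux.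
  by rewrite derive_mx ?mxE//; exact: dF.
have dF x v : U x -> derivable F x v.
  by move=> Ux; apply/derivable_mxP => i j; rewrite ord1; apply: (H j).1.
split=> [x v Ux|v]; first exact: dF.
apply/IH => j; apply: Ck_eq ((H j).2 v) => // x Ux.
by rewrite derive_mx ?mxE//; exact: dF.
Qed.

Lemma derive_row_comp n m (f : 'rV[R]_m -> R) (g : 'rV[R]_n -> 'rV[R]_m) x v :
  differentiable f (g x) -> differentiable g x ->
  'D_v (f \o g) x = \sum_j ('D_v g x) 0 j * 'D_('e_j) f (g x).
Proof.
move=> df dg; have dfg := differentiable_comp dg df.
rewrite (deriveE _ dfg) diff_comp//= -(deriveE _ dg).
rewrite {1}(row_sum_delta ('D_v g x)) linear_sum; apply: eq_bigr => j _.
by rewrite linearZ /= (deriveE _ df).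
Qed.

Lemma row_differentiable n m (g : 'rV[R]_n -> 'rV[R]_m) x :
  (forall j, differentiable (fun y => g y 0 j) x) -> differentiable g x.
Proof.
move=> H; have -> : g = (fun y => \sum_j (g y 0 j *: ('e_j : 'rV[R]_m))).
  by apply/funext => y; rewrite {1}(row_sum_delta (g y)).
have E : (fun y => \sum_j (g y 0 j *: ('e_j : 'rV[R]_m))) =
   \sum_j (fun y => g y 0 j *: ('e_j : 'rV[R]_m)).
  by apply/funext => y; rewrite fct_sumE.
by rewrite E; apply: differentiable_sum => j; apply: differentiableZl.
Qed.

Lemma Ck_row_differentiable n m k (g : 'rV[R]_n -> 'rV[R]_m) U x : open U -> U x ->
  Ck_on k.+1 U g -> differentiable g x.
Proof.
move=> oU Ux /(Ck_rowP _ _ oU) H; apply: row_differentiable => j.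
exact: Ck_coord_differentiable (H j).
Qed.

(** By the chain rule a derivative of the composite is a sum of products to which the induction
    hypothesis applies. *)
Lemma Ck_comp n m k (f : 'rV[R]_m -> R) (g : 'rV[R]_n -> 'rV[R]_m) U V :
  open U -> open V -> (forall x, U x -> V (g x)) ->
  Ck_on k V f -> Ck_on k U g -> Ck_on k U (f \o g).
Proof.
move=> oU oV UV; elim: k f => [|k IH] f.
  by move=> cf cg x Ux; apply: continuous_comp; [exact: cg|exact/cf/UV].
move=> Cf Cg.
have Cg' : Ck_on k U g.
  by apply/Ck_rowP => // j; apply: CkW => //; exact: (Ck_rowP _ _ oU).1 Cg j.
have df x : V x -> differentiable f x by move=> Vx; exact: Ck_coord_differentiable Cf.
have dg x : U x -> differentiable g x by move=> Ux; exact: Ck_row_differentiable Cg.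
split=> [x v Ux|v].
  by apply: diff_derivable; apply: differentiable_comp; [exact: dg|exact/df/UV].
have : Ck_on k U (fun x => \sum_j ('D_v g x) 0 j * 'D_('e_j) f (g x)).
  apply: Ck_sum => // j _; apply: CkM => //.
    by move: j; apply/Ck_rowP => //; case: Cg => _; apply.
  by apply: (IH (fun y => 'D_('e_j) f y)) => //; case: Cf => _; apply.
apply: Ck_eq => // x Ux; rewrite derive_row_comp//; [exact/df/UV|exact: dg].
Qed.

(** * Hadamard's lemma: dividing by the coordinates that vanish on a centre *)

Section Hadamard.
Variables (n : nat) (I : {set 'I_n}) (z0 : 'rV[R]_n) (e : R).
Hypotheses (z0I : forall i, i \in I -> z0 0 i = 0) (e0 : 0 < e).
Implicit Types (f : 'rV[R]_n -> R).

Let U : set 'rV[R]_n := ball z0 e.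
(** With half the radius, the closed box around [z0] is compact inside [U], which bounds derivatives
    uniformly. *)
Let U2 : set 'rV[R]_n := ball z0 (e / 2).
Let mu := @lebesgue_measure R.
Let I01 : set R := [set` `[0, 1] : interval R].

(** As t goes from 1 to 0 this retracts onto the subspace where the coordinates in I vanish. *)
Definition contract (t : R) (z : 'rV[R]_n) : 'rV[R]_n :=
  \row_j (if j \in I then t * z 0 j else z 0 j).

Definition part (z : 'rV[R]_n) : 'rV[R]_n := \row_j (if j \in I then z 0 j else 0).

Lemma contract_line t z : contract t z = contract 0 z + t *: part z.
Proof. by apply/rowP => j; rewrite !mxE; case: ifP; rewrite ?mul0r ?mulr0 ?add0r ?addr0. Qed.

Lemma contractD t h z v : contract t (z + h *: v) = contract t z + h *: contract t v.
Proof. by apply/rowP => j; rewrite !mxE; case: ifP; rewrite ?mulrDr ?mulrA 1?(mulrC t h). Qed.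

Lemma contract_id t (z : 'rV[R]_n) : (forall i, i \in I -> z 0 i = 0) -> contract t z = z.
Proof. by move=> zI; apply/rowP => j; rewrite !mxE; case: ifP => // /zI ->; rewrite mulr0. Qed.

Lemma contract_ball r t z : 0 < r -> 0 <= t <= 1 -> ball z0 r z -> ball z0 r (contract t z).
Proof.
move=> r0 /andP[t0 t1] /(ball_rowP _ _ r0) H; apply/ball_rowP => // j.
rewrite !mxE; case: ifPn => [jI|_]; last exact: H.
apply: le_lt_trans (H j); rewrite (z0I jI) !sub0r !normrN normrM ger0_norm//.
by rewrite ler_piMl.
Qed.

Let oU : open U. Proof. exact: ball_open. Qed.
Let oU2 : open U2. Proof. by apply: ball_open; rewrite divr_gt0. Qed.
Let U2U z : U2 z -> U z.
Proof. by apply: le_ball; rewrite ler_pdivrMr// ler_pMr// ler1n. Qed.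

Let bounded f : (forall z, U z -> {for z, continuous f}) ->
  exists M, 0 <= M /\ forall z, U2 z -> `|f z| <= M.
Proof.
move=> cf.
pose K := [set z : 'rV[R]_n | forall i, [set` `[z0 0 i - e / 2, z0 0 i + e / 2]] (z ord0 i)].
have cK : compact K.
  apply: (@rV_compact _ _ (fun i => `[z0 0 i - e / 2, z0 0 i + e / 2]%classic)) => i.
  exact: segment_compact.
have KU z : K z -> U z.
  move=> Kz; apply/ball_rowP => // i.
  have : z0 0 i - e / 2 <= z 0 i <= z0 0 i + e / 2 by have := Kz i; rewrite /= in_itv.
  by have := e0; rewrite ltr_norml => ? /andP[? ?]; apply/andP; split; lra.
have cnf : {within K, continuous (fun z => `|f z|)}.
  apply: continuous_in_subspaceT => z /set_mem /KU Uz.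
  by apply: continuous_comp; [exact: cf|exact: norm_continuous].
  have K0 : K z0.
    have e2 : 0 <= e / 2 by rewrite divr_ge0// ltW.
    by move=> i; rewrite /= in_itv /= lerBlDr lerDl e2.
have [c _ cM] := EVT_max_rV (ex_intro _ _ K0) cK cnf.
exists `|f c|; split => // z /ball_rowP H; apply: cM; apply/mem_set => i.
have : `|z0 0 i - z 0 i| < e / 2 by apply: H; rewrite divr_gt0.
rewrite ltr_norml => /andP[? ?].
by change (z0 0 i - e / 2 <= z 0 i <= z0 0 i + e / 2); apply/andP; split; lra.
Qed.

(** Differentiating in a direction of index in I brings out one more factor t. The weight t ^+ a
    makes the class of these integrals stable under differentiation. *)
Definition Gint (a : nat) f (z : 'rV[R]_n) : R :=
  \int[mu]_(t in I01) (t ^+ a * f (contract t z)).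

Let I01P t : I01 t -> 0 <= t <= 1.
Proof. by rewrite /I01 /= in_itv. Qed.

Let derive_line f z t : smooth_on U f -> U z -> I01 t ->
  is_derive t 1 (fun t => f (contract t z)) ('D_(part z) f (contract t z)).
Proof.
move=> sf Uz tI.
have Uc : U (contract t z) by apply: contract_ball => //; apply: I01P.
have E : (fun t => f (contract t z)) = (fun t => f (contract 0 z + t *: part z)).
  by apply/funext => s; rewrite contract_line.
rewrite E (contract_line t z); apply: is_derive_line.
by rewrite -(contract_line t z); case: (sf 1%N) => + _; apply.
Qed.

Let mI01 : measurable (I01 : set (measurableTypeR R)). Proof. exact: measurable_itv. Qed.

Let integ a f z : smooth_on U f -> U z ->
  mu.-integrable I01 (EFin \o (fun t => t ^+ a * f (contract t z))).
Proof.
move=> sf Uz; apply: continuous_compact_integrable; first exact: segment_compact.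
apply: derivable_within_continuous => t tI; apply: derivableM.
  exact: exprn_derivable.
by case: (derive_line sf Uz tI).
Qed.

Let smoothD f v : smooth_on U f -> smooth_on U (fun z => 'D_v f z).
Proof. by move=> sf k; case: (sf k.+1) => _; apply. Qed.

Let smooth_diff f z : smooth_on U f -> U z -> differentiable f z.
Proof. by move=> sf Uz; exact: Ck_coord_differentiable (sf 1%N). Qed.

Let derive_coord f z v : smooth_on U f -> U z ->
  'D_v f z = \sum_j v 0 j * 'D_('e_j) f z.
Proof.
move=> sf Uz; have df := smooth_diff sf Uz.
rewrite (deriveE _ df) {1}(row_sum_delta v) linear_sum; apply: eq_bigr => j _.
by rewrite linearZ /= (deriveE _ df).
Qed.

Let smooth_bounded f : smooth_on U f ->
  exists M : 'I_n -> R, forall m, 0 <= M m /\ forall z, U2 z -> `|'D_('e_m) f z| <= M m.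
Proof.
move=> sf.
have H m : exists M, 0 <= M /\ forall z, U2 z -> `|'D_('e_m) f z| <= M.
  by apply: bounded => z Uz; apply/differentiable_continuous/smooth_diff => //; exact: smoothD.
by exists (fun m => sval (cid (H m))) => m; case: cid.
Qed.

Let lipschitz f : smooth_on U f -> exists2 L, 0 <= L &
  forall z z', U2 z -> U2 z' -> `|f z' - f z| <= L * `|z' - z|.
Proof.
move=> sf; have [M HM] := smooth_bounded sf.
exists (\sum_m M m); first by apply: sumr_ge0 => m _; case: (HM m).
move=> z z' Uz Uz'; pose w := z' - z.
have Uw (t : R) : t \in `[0, 1] -> U2 (z + t *: w).
  rewrite in_itv /= => /andP[t0 t1]; apply/ball_rowP => [|i]; first by rewrite divr_gt0.
  have e2 : 0 < e / 2 by rewrite divr_gt0.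
  have -> : z0 0 i - (z + t *: w) 0 i = (1 - t) * (z0 0 i - z 0 i) + t * (z0 0 i - z' 0 i).
    by rewrite !mxE; ring.
  have /(_ i) := (ball_rowP _ _ e2).1 Uz; have /(_ i) := (ball_rowP _ _ e2).1 Uz'.
  rewrite !ltr_norml => /andP[a1 a2] /andP[b1 b2].
  have [->|t1'] := eqVneq t 1; first by rewrite subrr mul0r add0r mul1r a1 a2.
  have {}t1 : 0 < 1 - t by rewrite subr_gt0 lt_neqAle t1' t1.
  by apply/andP; split; nra.
have D (t : R) : t \in `[0, 1] -> is_derive t 1 (fun t => f (z + t *: w)) ('D_w f (z + t *: w)).
  move=> tI; apply: is_derive_line.
  by case: (sf 1%N) => + _; apply; apply: U2U; exact: Uw.
have D1 (t : R) : t \in `]0, 1[ -> is_derive t 1 (fun t => f (z + t *: w)) ('D_w f (z + t *: w)).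
  by move=> t01; apply: D; apply: subset_itv_oo_cc t01.
have D2 : {within `[0, 1], continuous (fun t => f (z + t *: w))}.
  by apply: derivable_within_continuous => t /D[].
have [c c01] := MVT_segment ler01 D1 D2.
rewrite scale1r scale0r addr0 subr0 mulr1 /w subrKC => ->.
rewrite derive_coord//; last by apply: U2U; apply: Uw.
apply: le_trans (ler_norm_sum _ _ _) _; rewrite mulr_suml; apply: ler_sum => m _.
rewrite normrM mulrC ler_pM//; last exact: coord_le_norm.
by apply: (HM m).2; exact: Uw.
Qed.

Let norm_contract t z : 0 <= t <= 1 -> `|contract t z| <= `|z|.
Proof.
move=> /andP[t0 t1]; apply: norm_le_coord => // i j; rewrite ord1 !mxE.
apply: le_trans (coord_le_norm z 0 j); case: ifP => // _.
by rewrite normrM ger0_norm// ler_piMl.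
Qed.

Let integral_const (c : R) : \int[mu]_(t in I01) c = c.
Proof.
rewrite Rintegral_cst// [X in fine X](_ : _ = 1%:E) ?mulr1//.
by apply: etrans (lebesgue_measure_itv _) _; rewrite /= lte01 oppr0 addr0.
Qed.

Let Gint_lip a f : smooth_on U f -> exists2 L, 0 <= L &
  forall z z', U2 z -> U2 z' -> `|Gint a f z' - Gint a f z| <= L * `|z' - z|.
Proof.
move=> sf; have [L L0 lip] := lipschitz sf; exists L => // z z' Uz Uz'.
have i1 := integ a sf (U2U Uz); have i2 := integ a sf (U2U Uz').
rewrite /Gint -RintegralB//.
have i3 : mu.-integrable I01 (EFin \o (fun t => t ^+ a * f (contract t z') - t ^+ a * f (contract t z))).
  by apply: integrableB i2 i1.
apply: le_trans (le_normr_Rintegral _ i3) _ => //.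
rewrite -[leRHS]integral_const; apply: le_Rintegral => //.
- exact: (integrable_norm i3).
- by apply: continuous_compact_integrable;
    [exact: segment_compact|apply: continuous_subspaceT => ?; exact: cst_continuous].
move=> t tI; have t01 := I01P tI; have /andP[t0 t1] := t01.
rewrite -mulrBr normrM ger0_norm ?exprn_ge0//.
apply: (@le_trans _ _ `|f (contract t z') - f (contract t z)|).
  by rewrite ler_piMl// exprn_ile1.
have e2 : 0 < e / 2 by rewrite divr_gt0.
apply: le_trans (lip _ _ _ _) _; [exact: contract_ball|exact: contract_ball|].
rewrite ler_wpM2l//.
have -> : contract t z' - contract t z = contract t (z' - z); last exact: norm_contract.
by apply/rowP => j; rewrite !mxE; case: ifP => // _; rewrite mulrBr.
Qed.

Let integral_sum (r : seq 'I_n) (h : 'I_n -> R -> R) :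
  (forall m, mu.-integrable I01 (EFin \o h m)) ->
  mu.-integrable I01 (EFin \o (fun t => \sum_(m <- r) h m t)) /\
  \int[mu]_(t in I01) (\sum_(m <- r) h m t) = \sum_(m <- r) \int[mu]_(t in I01) h m t.
Proof.
move=> H; elim: r => [|m r [IH1 IH2]].
  split; last by rewrite big_nil -[RHS]integral_const; apply: eq_Rintegral => t _; rewrite big_nil.
  have -> : (fun t => \sum_(m <- [::]) h m t) = cst 0 by apply/funext => t; rewrite big_nil.
  exact: integrable0.
have E : (fun t => \sum_(m <- m :: r) h m t) = (fun t => h m t + \sum_(m <- r) h m t).
  by apply/funext => t; rewrite big_cons.
rewrite E big_cons; split; last by rewrite RintegralD// IH2.
exact: (integrableD mI01 (H m) IH1).
Qed.

(** Differentiation under the integral sign along the line z + h v; the exponent rises by one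
    exactly for the indices in I. *)
Let Gint_derive a f z v : smooth_on U f -> U2 z ->
  is_derive z v (Gint a f) (\sum_m v 0 m * Gint (a + (m \in I)) (fun z => 'D_('e_m) f z) z).
Proof.
move=> sf Uz; have [M HM] := smooth_bounded sf.
have /nbhs_ballP[r /= r0 rU] : nbhs z U2 by apply: open_nbhs_nbhs.
pose d := r / (`|v| + 1).
have v1 : 0 < `|v| + 1 by rewrite ltr_wpDl.
have d0 : 0 < d by rewrite divr_gt0.
have dU (h : R) : h \in `]- d, d[ -> U2 (z + h *: v).
  rewrite in_itv /= => /andP[h1 h2]; apply: rU; rewrite -ball_normE /= opprD addrA subrr.
  rewrite sub0r normrN normrZ.
  have : `|h| < d by rewrite ltr_norml h1 h2.
  rewrite /d ltr_pdivlMr// mulrDr mulr1; apply: le_lt_trans.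
  by rewrite lerDl.
(* The library theorem differentiates in a real parameter: h is that parameter, and the derivative
   is taken at 0. *)
pose F2 (h : R) (t : R) := t ^+ a * f (contract t (z + h *: v)).
have e2 : 0 < e / 2 by rewrite divr_gt0.
have dF2 (h t : R) : h \in `]- d, d[ -> I01 t ->
    is_derive h 1 (F2 ^~ t) (t ^+ a * 'D_(contract t v) f (contract t (z + h *: v))).
  move=> hd tI.
  have Uc : U (contract t (z + h *: v)).
    by apply: U2U; apply: contract_ball (dU _ hd) => //; exact: I01P.
  have E : F2 ^~ t = (fun h => t ^+ a *: f (contract t z + h *: contract t v)).
    by apply/funext => s; rewrite /F2 contractD.
  rewrite E contractD; apply: is_deriveZ; apply: is_derive_line.
  by rewrite -contractD; case: (sf 1%N) => + _; apply.
have d1F2 (h t : R) : h \in `]- d, d[ -> I01 t ->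
    partial1of2 F2 h t = t ^+ a * 'D_(contract t v) f (contract t (z + h *: v)).
  by move=> hd tI; rewrite partial1of2E; apply: (@derive_val _ _ _ _ _ _ _ (dF2 _ _ hd tI)).
have a0 : [set` `]- d, d[ : interval R] 0 by rewrite /= in_itv /= oppr_lt0 d0.
(* A constant dominates: the entries of [contract t v] are at most those of v, and the partial
   derivatives are bounded on [U2]. *)
pose G (t : R) := \sum_m `|v 0 m| * M m.
have G0 t : 0 <= G t by apply: sumr_ge0 => m _; rewrite mulr_ge0//; case: (HM m).
have iG : mu.-integrable I01 (EFin \o G).
  by apply: continuous_compact_integrable;
    [exact: segment_compact|apply: continuous_subspaceT => ?; exact: cst_continuous].
have ub h t : [set` `]- d, d[ : interval R] h -> I01 t -> `|partial1of2 F2 h t| <= G t.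
  move=> hd tI; rewrite d1F2//; have t01 := I01P tI; have /andP[t0 t1] := t01.
  have Uc : U2 (contract t (z + h *: v)) by apply/contract_ball => //; exact: dU.
  rewrite normrM ger0_norm ?exprn_ge0//.
  apply: (@le_trans _ _ `|'D_(contract t v) f (contract t (z + h *: v))|).
    by rewrite ler_piMl// exprn_ile1.
  rewrite derive_coord//; last exact: U2U.
  apply: le_trans (ler_norm_sum _ _ _) _; apply: ler_sum => m _.
  rewrite normrM ler_pM//; last by apply: (HM m).2.
  by rewrite !mxE; case: ifP => // _; rewrite normrM (ger0_norm t0) ler_piMl.
have ii x : [set` `]- d, d[ : interval R] x -> mu.-integrable I01 (EFin \o F2 x).
  by move=> xd; apply: integ => //; apply: U2U; exact: dU.
have dd x y : [set` `]- d, d[ : interval R] x -> I01 y -> derivable (F2 ^~ y) x 1.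
  by move=> xd yI; case: (dF2 _ _ xd yI).
have := cvg_differentiation_under_integral mI01 a0 ii dd G0 iG ub.
have -> : (fun h => h^-1 *: (\int[mu]_(y in I01) F2 (h + 0) y - \int[mu]_(y in I01) F2 0 y)) =
   (fun h => h^-1 *: ((Gint a f \o shift z) (h *: v) - Gint a f z)).
  apply/funext => h; congr (_ *: (_ - _)).
    by apply: eq_Rintegral => t _; rewrite /F2 addr0 addrC.
  by apply: eq_Rintegral => t _; rewrite /F2 scale0r addr0.
have -> : \int[mu]_(y in I01) partial1of2 F2 0 y =
   \sum_m v 0 m * Gint (a + (m \in I)) (fun z => 'D_('e_m) f z) z.
  pose hm m t := v 0 m * (t ^+ (a + (m \in I)) * 'D_('e_m) f (contract t z)).
  have im m : mu.-integrable I01 (EFin \o (fun t => t ^+ (a + (m \in I)) * 'D_('e_m) f (contract t z))).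
    by apply: (integ _ (smoothD _ sf)); exact: U2U.
  have ihm m : mu.-integrable I01 (EFin \o hm m).
    exact: (integrableZl mI01 (v 0 m) (im m)).
  rewrite (@eq_Rintegral _ _ _ mu _ (fun t => \sum_m hm m t)); last first.
    move=> t /set_mem tI; rewrite d1F2// scale0r addr0 derive_coord//; last first.
      by apply/U2U/contract_ball => //; exact: I01P.
    rewrite mulr_sumr; apply: eq_bigr => m _; rewrite /hm !mxE.
    by case: ifP => _; rewrite ?addn0 ?addn1 ?exprSr; ring.
  rewrite (integral_sum _ ihm).2; apply: eq_bigr => m _.
  by rewrite /hm RintegralZl.
by move=> C; split; [apply/cvg_ex; eexists; exact: C|apply: cvg_lim].
Qed.

Lemma Gint_smooth a f : smooth_on U f -> smooth_on U2 (Gint a f).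
Proof.
move=> sf k; elim: k a f sf => [|k IH] a f sf.
  have [L L0 lip] := Gint_lip a sf => z Uz.
  apply/(@cvgrPdist_lt _ _ _ (nbhs z)) => d d0.
  apply/nbhs_ballP.
  have /nbhs_ballP[r /= r0 rU] : nbhs z U2 by apply: open_nbhs_nbhs.
  exists (Num.min r (d / (L + 1))) => /=.
    by rewrite lt_min r0 divr_gt0// ltr_wpDl.
  move=> y; rewrite -ball_normE /= lt_min => /andP[yr yd].
  rewrite distrC; apply: le_lt_trans (lip z y Uz _) _.
    by apply: rU; rewrite -ball_normE.
  move: yd; rewrite ltr_pdivlMr ?ltr_wpDl// distrC mulrDr mulr1 => yd.
  by apply: le_lt_trans yd; rewrite mulrC lerDl.
split=> [z v Uz|v]; first by have [] := Gint_derive a v sf Uz.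
have : Ck_on k U2 (fun z => \sum_m v 0 m * Gint (a + (m \in I)) (fun z => 'D_('e_m) f z) z).
  apply: Ck_sum => // m _; apply: CkM => //; first exact: Ck_cst.
  by apply: IH; exact: smoothD.
apply: Ck_eq => // z Uz; by have [_ ->] := Gint_derive a v sf Uz.
Qed.

(** The derivative of t -> f (contract t z) is integrated from 0 to 1. The last clause gives the
    quotients on the centre, where they must agree with the action of the derivative on normal
    rays. *)
Lemma hadamard f : smooth_on U f -> exists g : 'I_n -> 'rV[R]_n -> R,
  [/\ forall k, smooth_on U2 (g k),
      forall z, U2 z -> f z = f (contract 0 z) + \sum_(k in I) z 0 k * g k z &
      forall k (z : 'rV[R]_n), (forall i, i \in I -> z 0 i = 0) -> g k z = 'D_('e_k) f z].
Proof.
move=> sf; exists (fun k => Gint 0 (fun z => 'D_('e_k) f z)); split.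
- by move=> k; apply: Gint_smooth; exact: smoothD.
- move=> z U2z; have Uz := U2U U2z.
  pose psi t := f (contract t z).
  pose hk k t := (part z) 0 k * (t ^+ 0 * 'D_('e_k) f (contract t z)).
  have ik k : mu.-integrable I01 (EFin \o (fun t => t ^+ 0 * 'D_('e_k) f (contract t z))).
    exact: (integ _ (smoothD _ sf)).
  have ihk k : mu.-integrable I01 (EFin \o hk k).
    exact: (integrableZl mI01 (part z 0 k) (ik k)).
  have dpsi t : I01 t -> is_derive t 1 psi (\sum_k hk k t).
    move=> tI; have := derive_line sf Uz tI; rewrite derive_coord//; last first.
      by apply: contract_ball => //; exact: I01P.
    congr (is_derive _ _ _ _); apply: eq_bigr => k _; by rewrite /hk expr0 mul1r.
  have cpsi t : I01 t -> {for t, continuous psi}.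
    by move=> /dpsi[d _]; apply: differentiable_continuous; apply/derivable1_diffP.
  have I0 : I01 0 by rewrite /I01 /= in_itv /= lexx ler01.
  have I1 : I01 1 by rewrite /I01 /= in_itv /= lexx ler01.
  have FT : (\int[mu]_(t in I01) (\sum_k hk k t)%:E = (psi 1)%:E - (psi 0)%:E)%E.
    apply: continuous_FTC2 => //.
    - apply: derivable_within_continuous => t tI.
      have E : (fun t => \sum_k hk k t) = \sum_k hk k.
        by apply/funext => s; rewrite fct_sumE.
      rewrite E; apply: derivable_sum => k; apply: derivableZ; apply: derivableM.
        exact: exprn_derivable.
      by case: (derive_line (smoothD 'e_k sf) Uz tI).
    - split.
      + by move=> t t01; case: (dpsi t) => //; apply: subset_itv_oo_cc t01.
      + by apply: cvg_at_right_filter; apply: cpsi.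
      + by apply: cvg_at_left_filter; apply: cpsi.
    - move=> t t01; rewrite derive1E.
      by have [_ ->] := dpsi t (subset_itv_oo_cc t01).
  have {}FT : \sum_k \int[mu]_(t in I01) hk k t = psi 1 - psi 0.
    by rewrite -(integral_sum _ ihk).2 /Rintegral FT.
  have {FT} -> : f z = psi 0 + \sum_k \int[mu]_(t in I01) hk k t.
    rewrite FT subrKC /psi; congr f.
    by apply/rowP => j; rewrite !mxE mul1r if_same.
  congr (_ + _); rewrite [RHS]big_mkcond /=; apply: eq_bigr => k _.
  rewrite /hk RintegralZl// /part mxE; case: ifP => _; last by rewrite mul0r.
  by [].
- move=> k z zI; rewrite /Gint -[RHS]integral_const; apply: eq_Rintegral => t _.
  by rewrite expr0 mul1r contract_id.
Qed.

End Hadamard.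
End Calculus.

(** * Charts and manifolds with corners *)


Section SmoothMaps.
Variable R : realType.

Lemma smooth_rowP n m (U : set 'rV[R]_n) (F : 'rV[R]_n -> 'rV[R]_m) : open U ->
  smooth_on U F <-> forall j, smooth_on U (fun x => F x 0 j).
Proof.
move=> oU; split=> [sF j k|sF k]; last by apply/Ck_rowP => // j; exact: sF.
exact: ((Ck_rowP k F oU).1 (sF k) j).
Qed.

Lemma smooth_sub (V W : normedModType R) (U U' : set V) (F : V -> W) :
  U' `<=` U -> smooth_on U F -> smooth_on U' F.
Proof.
move=> UU' sF k; move: (sF k); elim: k F {sF} => [|k IH] F /=.
  by move=> H x /UU'; exact: H.
move=> [dF cF]; split=> [x v /UU'|v]; first exact: dF.
by apply: IH; exact: cF.
Qed.

Lemma smooth_eq (V W : normedModType R) (U : set V) (f g : V -> W) : open U ->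
  (forall x, U x -> f x = g x) -> smooth_on U f -> smooth_on U g.
Proof. by move=> oU fg sf k; apply: Ck_eq (sf k). Qed.

Lemma smooth_comp_real n m (f : 'rV[R]_m -> R) (g : 'rV[R]_n -> 'rV[R]_m) U V :
  open U -> open V -> (forall x, U x -> V (g x)) ->
  smooth_on V f -> smooth_on U g -> smooth_on U (f \o g).
Proof. by move=> oU oV UV sf sg k; apply: (Ck_comp oU oV UV (sf k) (sg k)). Qed.

Lemma smooth_comp n m l (f : 'rV[R]_m -> 'rV[R]_l) (g : 'rV[R]_n -> 'rV[R]_m) U V :
  open U -> open V -> (forall x, U x -> V (g x)) ->
  smooth_on V f -> smooth_on U g -> smooth_on U (f \o g).
Proof.
move=> oU oV UV sf sg; apply/smooth_rowP => // j.
apply: (smooth_comp_real (f := fun y => f y 0 j) oU oV) => //.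
by move: j; apply/smooth_rowP.
Qed.

Lemma smooth_coord n j (U : set 'rV[R]_n) : open U ->
  smooth_on U (fun z : 'rV[R]_n => z 0 j).
Proof. by move=> oU k; exact: Ck_coord. Qed.

Lemma smooth_id n (U : set 'rV[R]_n) : open U -> smooth_on U (@id 'rV[R]_n).
Proof. by move=> oU; apply/smooth_rowP => // j; exact: smooth_coord. Qed.

Lemma smooth_cst n (U : set 'rV[R]_n) (a : R) : open U ->
  smooth_on U (fun _ : 'rV[R]_n => a).
Proof. by move=> oU k; exact: Ck_cst. Qed.

Lemma smoothD n (U : set 'rV[R]_n) (f g : 'rV[R]_n -> R) : open U ->
  smooth_on U f -> smooth_on U g -> smooth_on U (fun z => f z + g z).
Proof. by move=> oU sf sg k; exact: CkD. Qed.

Lemma smoothM n (U : set 'rV[R]_n) (f g : 'rV[R]_n -> R) : open U ->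
  smooth_on U f -> smooth_on U g -> smooth_on U (fun z => f z * g z).
Proof. by move=> oU sf sg k; exact: CkM. Qed.

Lemma smoothV n (U : set 'rV[R]_n) (f : 'rV[R]_n -> R) : open U ->
  (forall z, U z -> f z != 0) -> smooth_on U f -> smooth_on U (fun z => (f z)^-1).
Proof. by move=> oU f0 sf k; exact: CkV. Qed.

Lemma smooth_sum n (U : set 'rV[R]_n) (I : Type) (r : seq I) (P : pred I)
    (f : I -> 'rV[R]_n -> R) : open U ->
  (forall i, P i -> smooth_on U (f i)) ->
  smooth_on U (fun z => \sum_(i <- r | P i) f i z).
Proof. by move=> oU sf k; apply: Ck_sum => // i Pi; exact: sf. Qed.

Lemma smooth_affine n m (U : set 'rV[R]_n) (z0 : 'rV[R]_n) (T : 'M[R]_(n, m))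
    (b : 'rV[R]_m) : open U -> smooth_on U (fun z => (z - z0) *m T + b).
Proof.
move=> oU; apply/smooth_rowP => // j.
apply: (smooth_eq (f := (fun z : 'rV[R]_n => \sum_k (z 0 k + - z0 0 k) * T k j + b 0 j))) => //.
  by move=> z _; rewrite !mxE; congr (_ + _); apply: eq_bigr => k _; rewrite !mxE.
apply: smoothD => //; last exact: smooth_cst.
apply: smooth_sum => // k _; apply: smoothM => //; last exact: smooth_cst.
by apply: smoothD => //; [exact: smooth_coord|exact: smooth_cst].
Qed.

Lemma smooth_differentiable n m (U : set 'rV[R]_n) (F : 'rV[R]_n -> 'rV[R]_m) z :
  open U -> U z -> smooth_on U F -> differentiable F z.
Proof. by move=> oU Uz sF; exact: Ck_row_differentiable (sF 1%N). Qed.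

Lemma smooth_continuous n m (U : set 'rV[R]_n) (F : 'rV[R]_n -> 'rV[R]_m) z :
  open U -> U z -> smooth_on U F -> {for z, continuous F}.
Proof. by move=> oU Uz sF; exact: (sF 0%N). Qed.

Lemma open_preimage_on (V W : topologicalType) (U : set V) (A : set W) (F : V -> W) :
  open U -> open A -> (forall z, U z -> {for z, continuous F}) ->
  open (U `&` F @^-1` A).
Proof.
move=> oU oA cF; rewrite openE => z [Uz Az]; apply: filterI; first exact: open_nbhs_nbhs.
by apply: cF => //; exact: open_nbhs_nbhs.
Qed.

Lemma ball_nbhs n (z : 'rV[R]_n) (A : set 'rV[R]_n) : nbhs z A <->
  exists2 e : R, 0 < e & ball z e `<=` A.
Proof. by split=> /nbhs_ballP. Qed.

End SmoothMaps.

(** * Derivatives at a point of a corner *)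

Section CornerDerivative.
Variables (R : realType) (n : nat) (B : {set 'I_n}).
Implicit Types (f g : 'rV[R]_n -> R) (z a v : 'rV[R]_n).

Lemma derive_ge0 f z a : differentiable f z ->
  (exists2 d : R, 0 < d & forall t : R, 0 < t -> t < d -> f z <= f (z + t *: a)) ->
  0 <= 'D_a f z.
Proof.
move=> df [d d0 H]; rewrite leNgt; apply/negP => D0.
have cv : (fun h : R => h^-1 *: ((f \o shift z) (h *: a) - f z)) @ 0^' --> 'D_a f z.
  exact: diff_derivable.
have e0 : 0 < - 'D_a f z by rewrite oppr_gt0.
have /cvgrPdist_lt/(_ _ e0) := cv.
move=> /nbhs_ballP[r /= r0 rH].
pose t := Num.min d r / 2.
have m0 : 0 < Num.min d r by rewrite lt_min d0 r0.
have t0 : 0 < t by rewrite divr_gt0.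
have tm : t < Num.min d r by rewrite /t ltr_pdivrMr// ltr_pMr// ltr1n.
move: tm; rewrite lt_min => /andP[td tr].
have /rH : ball (0 : R) r t by rewrite /ball /= sub0r normrN gtr0_norm.
move=> /(_ (lt0r_neq0 t0)) /=; rewrite ltr_norml => /andP[+ _].
have x0 : 0 <= t^-1 *: (f (t *: a + z) - f z).
  apply: mulr_ge0; first by rewrite invr_ge0 ltW.
  by rewrite subr_ge0 addrC; exact: H.
by rewrite opprK ltrDl oppr_gt0 ltNge x0.
Qed.

Definition inward_dir z a := forall i, i \in B -> z 0 i = 0 -> 0 <= a 0 i.

Lemma inward_corner z a (U : set 'rV[R]_n) : corner B z -> inward_dir z a -> nbhs z U ->
  exists2 d : R, 0 < d & forall t : R, 0 < t -> t < d ->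
    corner B (z + t *: a) /\ U (z + t *: a).
Proof.
move=> zB aB /ball_nbhs[r r0 rU].
have a1 : 0 < `|a| + 1 by rewrite ltr_wpDl.
have : nbhs (0 : R) [set t : R | forall i : 'I_n, 0 < z 0 i -> 0 < z 0 i + t * a 0 i].
  apply: (@near_forall_ord R n 0 (fun i (t : R) => 0 < z 0 i -> 0 < z 0 i + t * a 0 i)) => i.
  have [zi|] := ltP 0 (z 0 i); last by move=> _; apply: filterE.
  have : {for 0, continuous (fun t : R => z 0 i + t * a 0 i)}.
    by apply: continuousD; [exact: cst_continuous|apply: mulrr_continuous].
  move=> /(_ [set x | 0 < x]) H.
  suff : nbhs (0 : R) [set t : R | 0 < z 0 i + t * a 0 i] by apply: filterS => t.
  by apply: H; apply: open_nbhs_nbhs; rewrite mul0r addr0; split => //; exact: open_gt.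
move=> /nbhs_ballP[d /= d0 dH].
exists (Num.min d (r / (`|a| + 1))); first by rewrite lt_min d0 divr_gt0.
move=> t t0; rewrite lt_min => /andP[td tr]; split.
  move=> i iB; rewrite !mxE; have := zB i iB; rewrite le_eqVlt => /predU1P[E|zi].
    by rewrite -E add0r; apply: mulr_ge0; [exact: ltW|apply: aB].
  by apply/ltW/dH => //; rewrite /ball /= sub0r normrN gtr0_norm.
apply: rU; rewrite -ball_normE /= opprD addrA subrr sub0r normrN normrZ gtr0_norm//.
move: tr; rewrite ltr_pdivlMr// mulrDr mulr1; apply: le_lt_trans.
by rewrite lerDl ltW.
Qed.

(** Only inward directions can be tested inside the corner, but every direction along the subspace
    is a difference of two inward ones. *)
Lemma corner_derive0 (I : {set 'I_n}) z f (U : set 'rV[R]_n) : corner B z ->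
  (forall i, i \in I -> z 0 i = 0) -> differentiable f z -> nbhs z U ->
  (forall y : 'rV[R]_n, corner B y -> (forall i, i \in I -> y 0 i = 0) -> U y -> f y = 0) ->
  forall v, (forall i, i \in I -> v 0 i = 0) -> 'D_v f z = 0.
Proof.
move=> zB zI df nU H v vI.
have f0 : f z = 0 by apply: H => //; exact: nbhs_singleton.
have key a : inward_dir z a -> (forall i, i \in I -> a 0 i = 0) -> 'D_a f z = 0.
  move=> az aI; have [d d0 dH] := inward_corner zB az nU.
  have {}dH (t : R) : 0 < t -> t < d -> f (z + t *: a) = 0.
    move=> t0 td; have [cz Uz] := dH t t0 td; apply: H => // i iI.
    by rewrite !mxE zI// aI// mulr0 addr0.
  apply/eqP; rewrite eq_le; apply/andP; split; last first.
    by apply: derive_ge0 => //; exists d => // t t0 td; rewrite dH// f0.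
  rewrite -oppr_ge0 -deriveN; last exact: diff_derivable.
  apply: derive_ge0; first exact: differentiableN.
  by exists d => // t t0 td; rewrite -[leLHS]/(- f z) -[leRHS]/(- f _) dH// f0.
(* Its entries are at least those of -v in absolute value, so both b and v + b are inward. *)
pose b : 'rV[R]_n := \row_j (if j \in I then 0 else `|v|).
have bI i : i \in I -> b 0 i = 0 by move=> iI; rewrite mxE iI.
have D1 : 'D_(v + b) f z = 0.
  apply: key => [i _ _|i iI]; last by rewrite mxE vI// bI// addr0.
  rewrite !mxE; case: ifPn => iI; first by rewrite vI// addr0.
  by have := coord_le_norm v 0 i; rewrite ler_norml => /andP[]; rewrite -subr_ge0 opprK.
have D2 : 'D_b f z = 0.
  by apply: key => // i _ _; rewrite mxE; case: ifP.
move: D1 D2; rewrite !(deriveE _ df) linearD /= => + D2.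
by rewrite D2 addr0.
Qed.

Lemma corner_derive_eq z f g (U : set 'rV[R]_n) : corner B z ->
  differentiable f z -> differentiable g z -> nbhs z U ->
  (forall y : 'rV[R]_n, corner B y -> U y -> f y = g y) ->
  forall v, 'D_v f z = 'D_v g z.
Proof.
move=> zB df dg nU H v; apply/eqP; rewrite -subr_eq0 -deriveB; try exact: diff_derivable.
apply/eqP; apply: (@corner_derive0 finset.set0 _ _ U) => //; try by move=> i; rewrite inE.
  exact: differentiableB.
by move=> y yB _ Uy; rewrite -[LHS]/(f y - g y) H// subrr.
Qed.

End CornerDerivative.

Section Represents.
Variables (R : realType) (n : nat).
Implicit Types (X Y Z : Type) (F G : 'rV[R]_n -> 'rV[R]_n).

Lemma represents_comp X Y Z (c : chart R n X) (d : chart R n Y) (e : chart R n Z)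
    (h : X -> Y) (k : Y -> Z) p F G : dom c p ->
  represents c d h p F -> represents d e k (h p) G -> represents c e (k \o h) p (G \o F).
Proof.
move=> cp [U [oU Up sF HF]] [V [oV Vp sG HG]].
have [dhp Fp] := HF p cp Up.
have oW : open (U `&` F @^-1` V).
  by apply: open_preimage_on => // z Uz; exact: smooth_continuous sF.
exists (U `&` F @^-1` V); split=> //.
- by split => //=; rewrite -Fp.
- apply: (smooth_comp oW oV) => // [z []//|].
  by apply: smooth_sub sF => z [].
- move=> q cq [Uq Vq]; have [dhq Fq] := HF q cq Uq.
  by have := HG (h q) dhq; rewrite Fq; apply.
Qed.

Lemma represents_id X (c : chart R n X) p : represents c c id p id.
Proof. by exists setT; split => //; [exact: openT|apply: smooth_id; exact: openT]. Qed.

Lemma represents_value X Y (c : chart R n X) (d : chart R n Y) h p F :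
  dom c p -> represents c d h p F -> dom d (h p) /\ crd d (h p) = F (crd c p).
Proof. by move=> cp [U [_ Up _ H]]; exact: H. Qed.

Lemma represents_cont X Y (c : chart R n X) (d : chart R n Y) h p F e :
  dom c p -> represents c d h p F -> 0 < e -> exists2 r : R, 0 < r &
  forall q, dom c q -> ball (crd c p) r (crd c q) ->
    dom d (h q) /\ ball (crd d (h p)) e (crd d (h q)).
Proof.
move=> cp rF e0; have [dhp Fp] := represents_value cp rF.
case: rF => U [oU Up sF H].
have : nbhs (crd c p) (U `&` F @^-1` ball (F (crd c p)) e).
  apply: filterI; first exact: open_nbhs_nbhs.
  by apply: (smooth_continuous oU Up sF); exact: nbhsx_ballx.
move=> /ball_nbhs[r r0 rH]; exists r => // q cq /rH[Uq Fq].
by have [dhq Eq] := H q cq Uq; rewrite Eq Fp.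
Qed.

End Represents.

Section Good.
Variables (R : realType) (n : nat).

(** The axioms on charts alone; separation is added in [nice]. Both are proved again for each
    blow-up, so that a resolution can be continued. *)
Definition good (N : charted_space R n) : Prop :=
  (forall c : chart R n N, atlas c -> mchart c) /\
  (forall p : N, exists2 c, atlas c & dom c p).

Variable N : charted_space R n.
Hypothesis gN : good N.
Implicit Types (p q : N) (c d : chart R n N) (A : set N).

(** Charts of the maximal atlas are compared with atlas charts only; an atlas chart around p links
    two of them. *)
Lemma mchart_compat c d : mchart c -> mchart d -> compatible c d.
Proof.
move=> [_ mc] [_ md] p cp dp; case: gN => ga gc.
have [a aa ap] := gc p.
have [F rF] := (mc a aa).1 p cp ap.
have [G rG] := (md a aa).2 p ap dp.
by exists (G \o F); exact: represents_comp rF rG.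
Qed.

Lemma mchart_cover p : exists2 c, mchart c & dom c p.
Proof. by case: gN => ga gc; have [c ac cp] := gc p; exists c => //; exact: ga. Qed.

Lemma nbhs_chart p c A : mchart c -> dom c p -> nbhs p A <->
  exists2 e : R, 0 < e & forall q, dom c q -> ball (crd c p) e (crd c q) -> A q.
Proof.
move=> mc cp; case: (gN) => ga gc; split.
  rewrite nbhsE => -[B [oB Bp] BA]; have [a aa ap] := gc p.
  have [e e0 eB] : exists2 e : R, 0 < e & forall q, dom a q -> ball (crd a p) e (crd a q) -> B q.
    exact: oB.
  have [F rF] := mchart_compat mc (ga _ aa) cp ap.
  have [r r0 H] := represents_cont cp rF e0; exists r => // q cq /(H q cq)[aq aqe].
  by apply: BA; exact: eB.
move=> [e e0 eA].
(* The candidate open set: the points of the domain around which some coordinate ball lies over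
   A. *)
pose O := [set q | dom c q /\ exists2 e : R, 0 < e &
  forall q', dom c q' -> ball (crd c q) e (crd c q') -> A q'].
suff oO : open O.
  rewrite nbhsE; exists O; first by split => //; split => //; exists e.
  by move=> q [cq [r r0 rA]]; apply: rA => //; exact: ballxx.
move=> d q ad dq [cq [r r0 rA]].
have [F rF] := mchart_compat (ga _ ad) mc dq cq.
have r2 : 0 < r / 2 by rewrite divr_gt0.
have [t t0 H] := represents_cont dq rF r2.
exists t => // q' dq' /(H q' dq')[cq' rq']; split => //.
exists (r / 2) => // q'' cq'' B; apply: rA => //.
by rewrite (splitr r); apply: ball_triangle rq' B.
Qed.

Lemma open_dom c : mchart c -> open (dom c).
Proof.
move=> mc; rewrite openE => p cp; apply/(nbhs_chart _ mc cp).
by exists 1.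
Qed.

Lemma closure_chart p c A : mchart c -> dom c p -> closure A p <->
  forall e : R, 0 < e -> exists q, [/\ dom c q, ball (crd c p) e (crd c q) & A q].
Proof.
move=> mc cp; split=> [clA e e0|H B].
  have /clA[q [Aq [cq eq]]] : nbhs p [set q | dom c q /\ ball (crd c p) e (crd c q)].
    by apply/(nbhs_chart _ mc cp); exists e.
  by exists q.
by move=> /(nbhs_chart _ mc cp)[e e0 eB]; have [q [cq eq Aq]] := H e e0; exists q; split=> //; exact: eB.
Qed.

(* The chart c' is the restriction of c to the open set O of coordinates,
   followed by the change of coordinates phi with inverse psi. *)
Lemma mchart_change c c' (O : set 'rV[R]_n) (phi psi : 'rV[R]_n -> 'rV[R]_n) :
  mchart c -> proper_chart c' -> open O ->
  smooth_on setT phi -> smooth_on setT psi ->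
  (forall q, dom c' q <-> dom c q /\ O (crd c q)) ->
  (forall q, dom c' q -> crd c' q = phi (crd c q) /\ crd c q = psi (crd c' q)) ->
  mchart c'.
Proof.
move=> mc pc' oO sphi spsi Hdom Hcrd.
have r1 q : dom c' q -> represents c' c id q psi.
  move=> c'q; exists setT; split => //; first exact: openT.
  by move=> q' c'q' _; split; [exact: ((Hdom q').1 c'q').1|exact: (Hcrd q' c'q').2].
have r2 q : dom c' q -> represents c c' id q phi.
  move=> c'q; exists O; split => //; first exact: ((Hdom q).1 c'q).2.
    exact: smooth_sub sphi.
  move=> q' cq' Oq'; have c'q' : dom c' q' by apply/Hdom.
  by split => //; exact: (Hcrd q' c'q').1.
split=> // d ad; case: gN => ga _; split => q.
  move=> c'q dq; have cq := ((Hdom q).1 c'q).1.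
  have [F rF] := mchart_compat mc (ga _ ad) cq dq.
  by exists (F \o psi); exact: represents_comp (r1 q c'q) rF.
move=> dq c'q; have cq := ((Hdom q).1 c'q).1.
have [F rF] := mchart_compat (ga _ ad) mc dq cq.
by exists (phi \o F); exact: represents_comp rF (r2 q c'q).
Qed.

Definition face c p : {set 'I_n} := [set i in bdry c | crd c p 0 i == 0].

(** A boundary coordinate that is positive at p stays positive nearby, so only the coordinates in
    [face c p] constrain the image. *)
Lemma corner_near c p : proper_chart c -> dom c p -> exists2 e : R, 0 < e &
  forall z, ball (crd c p) e z -> corner (face c p) z ->
    exists2 q, dom c q & crd c q = z.
Proof.
move=> [_ pc2 pc3] cp; have [e e0 eH] := pc3 p cp.
pose z0 := crd c p; have z0c := pc2 p cp.
have : nbhs z0 [set z : 'rV[R]_n | forall i, 0 < z0 0 i -> 0 < z 0 i].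
  apply: (@near_forall_ord _ n z0 (fun i z => 0 < z0 0 i -> 0 < z 0 i)) => i.
  have [zi|zi] := ltP 0 (z0 0 i); last first.
    by apply: filterE.
  have := @coord_continuous R 1 n 0 i z0; move/(_ [set x | 0 < x]) => H.
  suff : nbhs z0 [set z : 'rV[R]_n | 0 < z 0 i] by apply: filterS => z.
  apply: H; apply: open_nbhs_nbhs; split => //; exact: open_gt.
move=> /ball_nbhs[r r0 rH]; exists (Num.min e r); first by rewrite lt_min e0 r0.
move=> z zb zc; apply: eH; first by apply: le_ball zb; rewrite ge_min lexx.
move=> i iB; have := z0c i iB; rewrite le_eqVlt => /predU1P[E|zi].
  by apply: zc; rewrite inE iB /= -/z0 -E.
apply/ltW; apply: rH zi; by apply: le_ball zb; rewrite ge_min lexx orbT.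
Qed.

(** The coordinates are recentred at p and changed by T. Since T fixes the boundary coordinates that
    vanish at p, the corner is preserved; the other boundary coordinates become ordinary ones. *)
Lemma adapted_chart c p (T : 'M[R]_n) A : mchart c -> dom c p -> T \in unitmx ->
  (forall i (z : 'rV[R]_n), i \in face c p -> (z *m T) 0 i = z 0 i) -> nbhs p A ->
  exists c', [/\ adapted p c', dom c' `<=` dom c `&` A, bdry c' = face c p &
    forall q, dom c' q -> crd c' q = (crd c q - crd c p) *m T].
Proof.
move=> mc cp uT HT nA; case: (mc) => pc _; pose z0 := crd c p.
have HT' i (z : 'rV[R]_n) : i \in face c p -> (z *m invmx T) 0 i = z 0 i.
  by move=> iB; rewrite -(HT _ (z *m invmx T) iB) mulmxKV.
have [e1 e10 H1] := corner_near pc cp.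
have /(nbhs_chart _ mc cp)[e2 e20 H2] := nA.
pose phi (z : 'rV[R]_n) := (z - z0) *m T + 0.
pose psi (z : 'rV[R]_n) := (z - 0) *m invmx T + z0.
have sphi : smooth_on setT phi by apply: smooth_affine; exact: openT.
have spsi : smooth_on setT psi by apply: smooth_affine; exact: openT.
have phiK : cancel phi psi.
  by move=> z; rewrite /phi /psi subr0 addr0 mulmxK// subrK.
have psiK : cancel psi phi.
  by move=> z; rewrite /phi /psi subr0 addr0 addrK mulmxKV.
have : nbhs (0 : 'rV[R]_n) (psi @^-1` ball z0 (Num.min e1 e2)).
  have cpsi : {for 0, continuous psi} by apply: smooth_continuous spsi => //; exact: openT.
  have -> : z0 = psi 0 by rewrite /psi subr0 mul0mx add0r.
  by apply: cpsi; apply: nbhsx_ballx; rewrite lt_min e10 e20.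
move=> /ball_nbhs[e e0 eH].
have {}eH (w : 'rV[R]_n) : (forall i, `|w 0 i| < e) -> ball z0 (Num.min e1 e2) (psi w).
  by move=> wi; apply: eH; apply/ball_rowP => // i; rewrite mxE sub0r normrN.
(* Cutting down to a cube around 0 in the new coordinates gives exactly the image that [adapted]
   asks for. *)
pose O := phi @^-1` ball 0 e.
have oO : open O.
  have -> : O = setT `&` phi @^-1` ball 0 e by rewrite setTI.
  apply: open_preimage_on; [exact: openT|exact: ball_open|move=> z _].
  by apply: smooth_continuous sphi => //; exact: openT.
have OP z : O z <-> forall i, `|phi z 0 i| < e.
  rewrite /O /=; split=> [/(ball_rowP _ _ e0) H i|H].
    by have := H i; rewrite mxE sub0r normrN.
  by apply/ball_rowP => // i; rewrite mxE sub0r normrN.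
pose c' := Chart [set q | dom c q /\ O (crd c q)] (fun q => phi (crd c q)) (face c p).
have psib q : dom c' q -> ball z0 (Num.min e1 e2) (crd c q).
  by move=> [cq /OP Oq]; rewrite -(phiK (crd c q)); exact: eH.
have c'crd q : dom c' q -> crd c q = psi (crd c' q).
  by move=> _; rewrite /= phiK.
have im z : corner (face c p) z -> (forall i, `|z 0 i| < e) ->
    exists2 q, dom c' q & crd c' q = z.
  move=> zc ze; have B := eH z ze.
  have B1 : ball z0 e1 (psi z) by apply: le_ball B; rewrite ge_min lexx.
  have [|q cq E] := H1 (psi z) B1.
    move=> i iB; rewrite /psi subr0 mxE HT'// addr_ge0//; first exact: zc.
    by move: iB; rewrite inE => /andP[iB _]; case: pc => _ + _; apply.
  exists q; last by rewrite /= E psiK.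
  by split => //; apply/OP => i; rewrite E psiK.
have cor q : dom c' q -> corner (face c p) (crd c' q).
  move=> [cq _] i iB; rewrite /= /phi addr0 HT// !mxE; move: iB.
  by rewrite inE => /andP[iB /eqP ->]; rewrite subr0; case: pc => _ + _; apply.
have pc' : proper_chart c'.
  split.
  - move=> q q' [cq _] [cq' _] /= /(can_inj phiK); case: pc => + _ _; exact.
  - exact: cor.
  - move=> q [cq /OP Oq].
    have : nbhs (phi (crd c q)) (ball (0 : 'rV[R]_n) e).
      apply: open_nbhs_nbhs; split; first exact: ball_open.
      by apply/ball_rowP => // i; rewrite mxE sub0r normrN.
    move=> /ball_nbhs[r r0 rH]; exists r => // z /rH /(ball_rowP _ _ e0) ze zc.
    by apply: im => // i; have := ze i; rewrite mxE sub0r normrN.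
have phi0 : phi z0 = 0 by rewrite /phi subrr mul0mx addr0.
exists c'; split => //.
- split.
  + apply: (mchart_change mc pc' oO sphi spsi) => // q c'q; split=> //.
    exact: c'crd.
  + by split => //; apply/OP => i; rewrite phi0 mxE normr0.
  + by rewrite /= phi0.
  + exists e => //; apply/seteqP; split=> [_ [q c'q <-]|z [zc ze]].
      by split; [exact: cor|case: c'q => _ /OP].
    by have [q c'q <-] := im z zc ze; exists q.
- move=> q c'q; split; first by case: c'q.
  apply: H2; first by case: c'q.
  by apply: le_ball (psib q c'q); rewrite ge_min lexx orbT.
- by move=> q _; rewrite /= /phi addr0.
Qed.

Lemma adapted_shift c p A : mchart c -> dom c p -> nbhs p A ->
  exists c', [/\ adapted p c', dom c' `<=` dom c `&` A, bdry c' = face c p &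
    forall q, dom c' q -> crd c' q = crd c q - crd c p].
Proof.
move=> mc cp nA.
have [||c' [H1 H2 H3 H4]] := @adapted_chart c p 1%:M A mc cp _ _ nA.
- exact: unitmx1.
- by move=> i z _; rewrite mulmx1.
- by exists c'; split => // q /H4 ->; rewrite mulmx1.
Qed.

End Good.

(** * Tangent vectors and normal rays *)


Section Tangent.
Variables (R : realType) (n : nat) (N : charted_space R n).
Hypothesis gN : good N.
Implicit Types (p q : N) (c d : chart R n N) (C : set N) (F G : 'rV[R]_n -> 'rV[R]_n).
Implicit Types (v w : chart R n N -> 'rV[R]_n) (I : {set 'I_n}).

Lemma mchart_corner c p : mchart c -> dom c p -> corner (bdry c) (crd c p).
Proof. by case=> -[_ + _] _; apply. Qed.

Lemma mchart_inj c p q : mchart c -> dom c p -> dom c q -> crd c p = crd c q -> p = q.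
Proof. by case=> -[+ _ _] _; apply. Qed.

Lemma represents_differentiable X Y (c : chart R n X) (d : chart R n Y) h (p : X) F :
  represents c d h p F -> differentiable F (crd c p).
Proof. by move=> [U [oU Up sF _]]; exact: smooth_differentiable sF. Qed.

Lemma coord_differentiable m (F : 'rV[R]_n -> 'rV[R]_m) z j :
  differentiable F z -> differentiable (fun y => F y 0 j) z.
Proof.
move=> dF; apply: (@differentiable_comp _ _ _ _ F (fun M : 'rV[R]_m => M 0 j)) => //.
exact: differentiable_coord.
Qed.

Lemma derive_coordE m (F : 'rV[R]_n -> 'rV[R]_m) z u j : differentiable F z ->
  'D_u (fun y => F y 0 j) z = ('D_u F z) 0 j.
Proof. by move=> dF; rewrite derive_mx ?mxE//; exact: diff_derivable. Qed.

(* Near the coordinates of p, every point of the corner is the image of a point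
   on which the local representative can be evaluated. *)
Lemma represents_corner Y c (d : chart R n Y) h p F : mchart c -> dom c p ->
  represents c d h p F -> exists2 U : set 'rV[R]_n, nbhs (crd c p) U &
  forall z, corner (bdry c) z -> U z ->
    exists q, [/\ dom c q, crd c q = z, dom d (h q) & crd d (h q) = F z].
Proof.
move=> mc cp [U [oU Up sF H]]; case: (mc) => -[_ _ pc3] _.
have [e e0 eH] := pc3 p cp.
exists (U `&` ball (crd c p) e).
  by apply: filterI; [exact: open_nbhs_nbhs|exact: nbhsx_ballx].
move=> z zc [Uz bz]; have [q cq E] := eH z bz zc.
by have [|dq Fq] := H q cq; [rewrite E|exists q; rewrite -E].
Qed.

(** A local representative is determined on the corner only, but this already fixes its derivative
    at corner points. *)
Lemma represents_derive_unique Y c (d : chart R n Y) h p F G u : mchart c -> dom c p ->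
  represents c d h p F -> represents c d h p G -> 'D_u F (crd c p) = 'D_u G (crd c p).
Proof.
move=> mc cp rF rG; have dF := represents_differentiable rF.
have dG := represents_differentiable rG.
have [U nU HU] := represents_corner mc cp rF.
have [U' nU' HU'] := represents_corner mc cp rG.
apply/rowP => j; rewrite -!derive_coordE//.
apply: (@corner_derive_eq _ _ (bdry c) _ _ _ (U `&` U')) => //.
- exact: mchart_corner.
- exact: coord_differentiable.
- exact: coord_differentiable.
- exact: filterI.
move=> y yc [Uy U'y]; have [q [cq E _ <-]] := HU y yc Uy.
have [q' [cq' E' _ <-]] := HU' y yc U'y.
by rewrite (mchart_inj mc cq cq')// E E'.
Qed.

Lemma derive_comp_rows m k (F : 'rV[R]_m -> 'rV[R]_k) (G : 'rV[R]_n -> 'rV[R]_m) z u :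
  differentiable G z -> differentiable F (G z) ->
  'D_u (F \o G) z = 'D_('D_u G z) F (G z).
Proof.
move=> dG dF; have dFG := differentiable_comp dG dF.
by rewrite (deriveE _ dFG) diff_comp//= -(deriveE _ dG) (deriveE _ dF).
Qed.

(** The components in the other charts are forced: they come from [a] by differentiating chosen
    transition maps, and the chain rule makes them consistent. *)
Lemma tangent_exists c p (a : 'rV[R]_n) : mchart c -> dom c p ->
  exists2 v, tangent p v & v c = a.
Proof.
move=> mc cp.
have /choice[T rT] d : exists F, mchart d -> dom d p -> represents c d id p F.
  have [[md dp]|nd] := pselect (mchart d /\ dom d p); last by exists id => md dp; case: nd.
  by have [F rF] := mchart_compat gN mc md cp dp; exists F.
pose v d := if `[< mchart d /\ dom d p >] then 'D_a (T d) (crd c p) else 0.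
have vE d : mchart d -> dom d p -> v d = 'D_a (T d) (crd c p).
  by move=> md dp; rewrite /v; case: asboolP => // -[].
exists v.
  split=> [d nd|d e F md me dp ep rF]; first by rewrite /v; case: asboolP.
  rewrite !vE//.
  have rd := rT d md dp; have re := rT e me ep.
  have [_ E] := represents_value cp rd.
  rewrite (represents_derive_unique _ mc cp re (represents_comp cp rd rF)).
  have dd := represents_differentiable rd; have dF := represents_differentiable rF.
  by rewrite derive_comp_rows -?E.
rewrite vE// (represents_derive_unique _ mc cp (rT c mc cp) (represents_id _ _)).
exact: derive_id.
Qed.

Lemma tangent_lin p v w k : tangent p v -> tangent p w -> tangent p (fun c => v c + k *: w c).
Proof.
move=> [v1 v2] [w1 w2]; split=> [c nc|c d F mc md cp dp rF].
  by rewrite v1// w1// scaler0 addr0.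
have dF := represents_differentiable rF.
rewrite (v2 _ _ _ mc md cp dp rF) (w2 _ _ _ mc md cp dp rF).
by rewrite !(deriveE _ dF) linearD linearZ.
Qed.

(* The transition map kills the coordinates of index in J to first order along
   the directions tangent to C. *)
Lemma transition_derive0 C c I d (J : {set 'I_n}) p F : mchart c -> dom c p -> C p ->
  vanishing c I C -> vanishing d J C -> represents c d id p F ->
  forall u : 'rV[R]_n, (forall i, i \in I -> u 0 i = 0) ->
  forall j, j \in J -> ('D_u F (crd c p)) 0 j = 0.
Proof.
move=> mc cp Cp vc vd rF u uI j jJ.
have dF := represents_differentiable rF.
have [U nU HU] := represents_corner mc cp rF.
rewrite -derive_coordE//.
apply: (@corner_derive0 _ _ (bdry c) I _ _ U) => //.
- exact: mchart_corner.
- by apply/vc.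
- exact: coord_differentiable.
move=> y yc yI Uy; have [q [cq E dq <-]] := HU y yc Uy.
by apply: (vd q dq).1 => //; apply/vc => // i iI; rewrite E yI.
Qed.

Lemma tangent_toP C c I p v : mchart c -> dom c p -> C p -> vanishing c I C ->
  tangent_to C p v <-> tangent p v /\ forall i, i \in I -> v c 0 i = 0.
Proof.
move=> mc cp Cp vc; split=> [[tv [d [J [md dp vd vJ]]]]|[tv vI]]; last first.
  by split => //; exists c, I.
split=> // i iI; have [F rF] := mchart_compat gN md mc dp cp.
rewrite (tv.2 _ _ _ md mc dp cp rF).
exact: (transition_derive0 md dp Cp vd vc rF).
Qed.

Lemma inwardP c p v : mchart c -> dom c p ->
  inward p v <-> tangent p v /\
    forall i, i \in bdry c -> crd c p 0 i = 0 -> 0 <= v c 0 i.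
Proof.
move=> mc cp; split=> [[tv H]|[tv H]]; first by split => // i; exact: H.
split=> // d i md dp iB di.
have [F rF] := mchart_compat gN mc md cp dp.
rewrite (tv.2 _ _ _ mc md cp dp rF).
have dF := represents_differentiable rF.
have [U nU HU] := represents_corner mc cp rF.
rewrite -derive_coordE//; apply: derive_ge0; first exact: coord_differentiable.
have [t t0 tH] := inward_corner (mchart_corner mc cp) H nU.
exists t => // s s0 st; have [sc Us] := tH s s0 st.
have [_ E] := represents_value cp rF.
have [q [cq Eq dq <-]] := HU _ sc Us.
rewrite -E di; exact: (mchart_corner md dq).
Qed.

Definition admissible c I (a : 'rV[R]_n) :=
  (exists2 i, i \in I & a 0 i != 0) /\
  (forall i, i \in I -> i \in bdry c -> 0 <= a 0 i).

Definition ray c I p (a : 'rV[R]_n) : set (chart R n N -> 'rV[R]_n) :=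
  [set w | tangent p w /\ exists2 k : R, 0 < k & forall i, i \in I -> w c 0 i = k * a 0 i].

(** From here on a normal ray is a coordinate vector, read on the indices in I and up to a positive
    factor. *)
Lemma normal_rayP C c I p S : mchart c -> dom c p -> C p -> vanishing c I C ->
  normal_ray C p S <-> exists2 a, admissible c I a & S = ray c I p a.
Proof.
move=> mc cp Cp vc.
have pI i : i \in I -> crd c p 0 i = 0 by move: i; apply/vc.
have SE v : tangent p v -> [set w | tangent p w /\ exists2 a : R, 0 < a &
    tangent_to C p (fun c => w c - a *: v c)] = ray c I p (v c).
  move=> tv; apply/seteqP; split=> w [tw [a a0 H]]; split=> //; exists a => //.
    move=> i iI; have /(tangent_toP _ mc cp Cp vc)[_ /(_ i iI)] := H.
    by rewrite !mxE => /eqP; rewrite subr_eq0 => /eqP.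
  apply/(tangent_toP _ mc cp Cp vc); split.
    have -> : (fun c => w c - a *: v c) = (fun c => w c + (- a) *: v c).
      by apply/funext => d; rewrite scaleNr.
    exact: tangent_lin.
  by move=> i iI; rewrite !mxE H// subrr.
split=> [[v [/(inwardP _ mc cp)[tv iv] ntv ->]]|[a [a1 a2] ->]].
  exists (v c); last exact: SE.
  split=> [|i iI iB]; last by apply: iv => //; exact: pI.
  apply: contrapT => H; apply: ntv; apply/(tangent_toP _ mc cp Cp vc).
  by split=> // i iI; apply/eqP/negPn/negP => vi; apply: H; exists i.
(* Extending by 0 outside I keeps the vector inward at the boundary indices that do not belong to
   the centre. *)
pose b : 'rV[R]_n := \row_i (if i \in I then a 0 i else 0).
have [v tv vb] := tangent_exists b mc cp.
exists v; split.
- apply/(inwardP _ mc cp); split=> // i iB pi; rewrite vb mxE.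
  by case: ifP => // iI; exact: a2.
- move=> /(tangent_toP _ mc cp Cp vc)[_ H]; case: a1 => i iI /negP; apply.
  by have := H i iI; rewrite vb mxE iI => ->.
- rewrite SE//; apply/seteqP; split=> w [tw [k k0 H]]; split=> //; exists k => // i iI;
  by rewrite H// vb mxE iI.
Qed.

Lemma ray_scale c I p (a b : 'rV[R]_n) (k : R) : 0 < k ->
  (forall i, i \in I -> b 0 i = k * a 0 i) -> ray c I p a = ray c I p b.
Proof.
move=> k0 H; apply/seteqP; split=> w [tw [l l0 Hw]]; split=> //.
  exists (l / k); first by rewrite divr_gt0.
  by move=> i iI; rewrite H// Hw// mulrA divfK// gt_eqF.
by exists (l * k); [rewrite mulr_gt0|move=> i iI; rewrite Hw// H// mulrA].
Qed.

Lemma ray_nonempty c I p a : mchart c -> dom c p -> ray c I p a !=set0.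
Proof.
move=> mc cp; have [v tv va] := tangent_exists a mc cp.
by exists v; split=> //; exists 1 => // i iI; rewrite va mul1r.
Qed.

End Tangent.

Section BlowupPoints.
Variables (R : realType) (n : nat) (N : charted_space R n).
Hypothesis gN : good N.
Variable C : set N.
Implicit Types (p q : N) (c d : chart R n N).
Implicit Types (v w : chart R n N -> 'rV[R]_n) (I : {set 'I_n}) (x y : blowup C).

(** Off the centre the coordinates of the point stand for a direction: the ratios used by a
    projective chart are the same, so one formula covers both kinds of points. *)
Definition direction c x : 'rV[R]_n :=
  match (x : blowup_pt C) with
  | inl p => crd c (proj1_sig p)
  | inr pS => xget (fun=> 0) (proj1_sig pS).2 c
  end.

Lemma direction_out c x : ~ C (blowdown C x) -> direction c x = crd c (blowdown C x).
Proof. by case: x => [p|[[p S] [Cp H]]]. Qed.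

Lemma blowdown_out p : ~ C p -> exists x : blowup C, blowdown C x = p.
Proof. by move=> nCp; exists (inl (exist _ p nCp)). Qed.

Lemma blowdown_inj x y : ~ C (blowdown C x) -> blowdown C x = blowdown C y -> x = y.
Proof.
case: x => [[p np]|[[p S] [Cp H]]]; case: y => [[q nq]|[[q S'] [Cq H']]] //=.
- by move=> _ E; subst q; congr (inl (exist _ _ _)); exact: Prop_irrelevance.
- by move=> nCp E; subst p.
Qed.

Lemma direction_in c I x : mchart c -> vanishing c I C -> dom c (blowdown C x) ->
  C (blowdown C x) -> admissible c I (direction c x) /\
  exists pS : {pS : N * set (chart R n N -> 'rV[R]_n) | C pS.1 /\ normal_ray C pS.1 pS.2},
    [/\ x = inr pS, (proj1_sig pS).1 = blowdown C x &
      (proj1_sig pS).2 = ray c I (blowdown C x) (direction c x)].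
Proof.
move=> mc vc; case: x => [[p np]//|[[p S] [Cp H]]] /= cp _.
have /(normal_rayP gN _ mc cp Cp vc)[a [[i iI ai] aB] SE] := H.
have {}SE : S = ray c I p a := SE.
rewrite /direction /=.
have [v [tv va]] := ray_nonempty gN I a mc cp.
have := @xgetPex _ (fun=> 0) S; rewrite {1}SE => /(_ (ex_intro _ v (conj tv va))).
set w := xget _ _ => Sw; have [tw [k k0 Hk]] : ray c I p a w by rewrite -SE.
split.
  split; first by exists i => //; rewrite Hk// mulf_neq0// gt_eqF.
  by move=> j jI jB; rewrite Hk// mulr_ge0 ?aB// ltW.
eexists; split; [by []|by []|rewrite /= {1}SE].
exact: ray_scale Hk.
Qed.

Lemma direction_change c I d (J : {set 'I_n}) x F : mchart c -> vanishing c I C ->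
  mchart d -> vanishing d J C ->
  dom c (blowdown C x) -> dom d (blowdown C x) -> C (blowdown C x) ->
  represents c d id (blowdown C x) F ->
  direction d x = 'D_(direction c x) F (crd c (blowdown C x)).
Proof.
move=> mc vc md vd; case: x => [[p np]//|[[p S] [Cp H]]] /= cp dp _ rF.
have /(normal_rayP gN _ mc cp Cp vc)[a [[i iI ai] aB] SE] := H.
have {}SE : S = ray c I p a := SE.
rewrite /direction /=.
have [v [tv va]] := ray_nonempty gN I a mc cp.
have := @xgetPex _ (fun=> 0) S; rewrite {1}SE => /(_ (ex_intro _ v (conj tv va))).
set w := xget _ _ => Sw; have [tw _] : ray c I p a w by rewrite -SE.
exact: (tw.2 _ _ _ mc md cp dp rF).
Qed.

Lemma direction_inj c I x y (k : R) : mchart c -> vanishing c I C ->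
  dom c (blowdown C x) -> C (blowdown C x) -> blowdown C x = blowdown C y -> 0 < k ->
  (forall i, i \in I -> direction c y 0 i = k * direction c x 0 i) -> x = y.
Proof.
move=> mc vc cx Cx xy k0 H.
have [_ [pS [xE E1 E2]]] := direction_in mc vc cx Cx.
have cy : dom c (blowdown C y) by rewrite -xy.
have Cy : C (blowdown C y) by rewrite -xy.
have [_ [pS' [yE E1' E2']]] := direction_in mc vc cy Cy.
have E : sval pS = sval pS'.
  rewrite (surjective_pairing (sval pS)) (surjective_pairing (sval pS')) E1 E2 E1' E2' -xy.
  by congr (_, _); exact: ray_scale k0 H.
rewrite xE yE; congr inr; move: E; clear; move: pS pS' => [a Ha] [b Hb] /= E.
by subst b; congr exist; exact: Prop_irrelevance.
Qed.

Lemma direction_exists c I p a : mchart c -> vanishing c I C -> dom c p -> C p ->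
  admissible c I a -> exists x : blowup C, blowdown C x = p /\
    exists2 k : R, 0 < k & forall i, i \in I -> direction c x 0 i = k * a 0 i.
Proof.
move=> mc vc cp Cp aa.
have HS : normal_ray C p (ray c I p a) by apply/(normal_rayP gN _ mc cp Cp vc); exists a.
exists (inr (exist _ (p, ray c I p a) (conj Cp HS))); split=> //.
rewrite /direction /=.
have [v tv] := ray_nonempty gN I a mc cp.
have := @xgetPex _ (fun=> 0) (ray c I p a) (ex_intro _ v tv).
by set w := xget _ _; move=> [tw].
Qed.

End BlowupPoints.

(** * Charts of a blow-up *)


Section BlowupCharts.
Variables (R : realType) (n : nat) (N : charted_space R n).
Hypothesis gN : good N.
Variable C : set N.
Implicit Types (p q : N) (c d : chart R n N) (I J : {set 'I_n}) (x y : blowup C).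
Implicit Types (i j k : 'I_n) (s : R) (z w : 'rV[R]_n).

Local Notation beta := (blowdown C).

(* The blow-down map in the projective coordinates w of [pchart]. *)
Definition blow I i s w : 'rV[R]_n :=
  \row_j (if j == i then s * w 0 i else if j \in I then w 0 j * w 0 i else w 0 j).

(* The normal ray at a point w of the front face: w has w_i = 0, so that slot is free for s. *)
Definition lift_dir i s w : 'rV[R]_n := \row_j (if j == i then s else w 0 j).

Definition pchart c I i s : chart R n (blowup C) :=
  Chart [set x | dom c (beta x) /\ 0 < s * direction c x 0 i]
    (fun x => \row_j (if j == i then s * crd c (beta x) 0 i
       else if j \in I then direction c x 0 j / (s * direction c x 0 i)
       else crd c (beta x) 0 j))
    (i |: bdry c).

Definition cchart c : chart R n (blowup C) :=
  Chart [set x | dom c (beta x) /\ ~ C (beta x)] (fun x => crd c (beta x)) (bdry c).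

Definition coords c I := mchart c /\ vanishing c I C.

Definition sign s := s = 1 \/ s = -1.

Lemma sign_sqr s : sign s -> s * s = 1.
Proof. by case=> ->; rewrite ?mulr1// mulrN1 opprK. Qed.

Lemma open_coord_gt (f : 'rV[R]_n -> R) (U : set 'rV[R]_n) : open U -> smooth_on U f ->
  open (U `&` [set w | 0 < f w]).
Proof.
move=> oU sf; apply: (@open_preimage_on 'rV[R]_n R U [set x : R | 0 < x] f) => //.
by move=> w Uw; exact: (sf 0%N).
Qed.

Lemma open_pos (f : 'rV[R]_n -> R) : smooth_on setT f -> open [set w | 0 < f w].
Proof. by move=> sf; rewrite -[X in open X]setTI; apply: open_coord_gt => //; exact: openT. Qed.

Let oT : open (setT : set 'rV[R]_n). Proof. exact: openT. Qed.

Lemma smooth_blow I i s (U : set 'rV[R]_n) : open U -> smooth_on U (blow I i s).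
Proof.
move=> oU; apply/smooth_rowP => // j.
apply: (smooth_eq (f := fun w => if j == i then s * w 0 i
  else if j \in I then w 0 j * w 0 i else w 0 j)) => // [w _|]; first by rewrite mxE.
case: (j == i); first by apply: smoothM => //; [exact: smooth_cst|exact: smooth_coord].
by case: (j \in I); [apply: smoothM => //|]; exact: smooth_coord.
Qed.

Section Pchart.
Variables (c : chart R n N) (I : {set 'I_n}) (i : 'I_n) (s : R).
Hypotheses (cI : coords c I) (iI : i \in I) (ss : sign s).
Let e := pchart c I i s.
Let mc : mchart c. Proof. by case: cI. Qed.
Let vc : vanishing c I C. Proof. by case: cI. Qed.

Lemma center_coord x j : dom c (beta x) -> C (beta x) -> j \in I -> crd c (beta x) 0 j = 0.
Proof. by move=> cx Cx; move: j; apply/vc. Qed.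

Lemma pchart_blow x : dom e x -> crd c (beta x) = blow I i s (crd e x).
Proof.
move=> [cx dx]; apply/rowP => j; rewrite !mxE eqxx.
have [->|ji] := eqVneq j i; first by rewrite mulrA sign_sqr// mul1r.
case: (boolP (j \in I)) => // jI.
have [Cx|nCx] := pselect (C (beta x)).
  by rewrite !center_coord// !mulr0.
by move: dx; rewrite direction_out// => dx; rewrite divfK// gt_eqF.
Qed.

Lemma pchart_dir x j : dom e x -> j \in I ->
  direction c x 0 j = (s * direction c x 0 i) * lift_dir i s (crd e x) 0 j.
Proof.
move=> [cx dx] jI; rewrite !mxE.
have [->|ji] := eqVneq j i; first by rewrite mulrAC sign_sqr// mul1r.
by rewrite jI mulrC divfK// gt_eqF.
Qed.

Lemma blowE w j : j \in I -> blow I i s w 0 j = w 0 i * lift_dir i s w 0 j.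
Proof. by move=> jI; rewrite !mxE jI; case: eqP => _; rewrite mulrC. Qed.

Lemma pchart_center x : dom e x -> C (beta x) <-> crd e x 0 i = 0.
Proof.
move=> ex; have [cx dx] := ex; split=> [Cx|w0].
  by rewrite !mxE eqxx center_coord// mulr0.
apply/vc => // j jI; by rewrite pchart_blow// blowE// w0 mul0r.
Qed.

Lemma pchart_pos x : dom e x -> ~ C (beta x) -> 0 < crd e x 0 i.
Proof. by move=> [cx dx] nC; rewrite !mxE eqxx; move: dx; rewrite direction_out. Qed.

Lemma pchart_corner x : dom e x -> corner (i |: bdry c) (crd e x).
Proof.
move=> ex j; have [cx dx] := ex.
have wi : 0 <= crd e x 0 i.
  have [/(pchart_center ex) ->//|nC] := pselect (C (beta x)).
  exact/ltW/pchart_pos.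
rewrite in_setU1 => /predU1P[->//|jB].
have [->//|ji] := eqVneq j i.
rewrite !mxE (negPf ji); case: ifP => jI; last exact: mchart_corner.
apply: divr_ge0; last exact: ltW.
have [Cx|nCx] := pselect (C (beta x)); last by rewrite direction_out//; exact: mchart_corner.
by have [[_ +] _] := direction_in gN mc vc cx Cx; apply.
Qed.

Lemma pchart_inj x y : dom e x -> dom e y -> crd e x = crd e y -> x = y.
Proof.
move=> ex ey E; have [[cx dx] [cy dy]] := (ex, ey).
have bxy : beta x = beta y by apply: (mchart_inj mc) => //; rewrite !pchart_blow// E.
have [Cx|nCx] := pselect (C (beta x)); last exact: blowdown_inj.
apply: (direction_inj (k := (s * direction c y 0 i) / (s * direction c x 0 i)) gN mc vc cx Cx bxy).
  exact: divr_gt0.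
move=> j jI; rewrite (pchart_dir ey jI) (pchart_dir ex jI) E mulrA.
by rewrite [X in X * _ = _](_ : _ = s * direction c y 0 i / (s * direction c x 0 i) *
  (s * direction c x 0 i)) // divfK// gt_eqF.
Qed.

(** A point with w_i > 0 comes from off the centre, one with w_i = 0 from the ray of direction
    [lift_dir i s w]. The condition on s makes this ray inward at the index i. *)
Lemma pchart_image w : s = 1 \/ i \notin bdry c -> corner (i |: bdry c) w ->
  (exists2 q, dom c q & crd c q = blow I i s w) -> exists2 x, dom e x & crd e x = w.
Proof.
move=> si wB [q cq qE].
have wi : 0 <= w 0 i by apply: wB; rewrite in_setU1 eqxx.
have [w0|w0] := eqVneq (w 0 i) 0.
  have Cq : C q by apply/vc => // j jI; rewrite qE blowE// w0 mul0r.
  have [|x [xq [k k0 xk]]] := @direction_exists _ _ _ gN C c I q (lift_dir i s w) mc vc cq Cq.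
    split; first by exists i => //; rewrite mxE eqxx; case: ss => ->; rewrite ?oner_eq0// oppr_eq0 oner_eq0.
    move=> j jI jB; rewrite mxE; case: eqP => [ji|_]; last by apply: wB; rewrite in_setU1 jB orbT.
    by case: si => [->//|]; rewrite -ji jB.
  have di : direction c x 0 i = k * s by rewrite xk// mxE eqxx.
  have sdi : s * direction c x 0 i = k by rewrite di mulrCA sign_sqr// mulr1.
  have cx : dom c (beta x) by rewrite xq.
  exists x; first by split; rewrite ?sdi.
  apply/rowP => j; rewrite !mxE sdi xq qE !mxE eqxx.
  have [->|ji] := eqVneq j i; first by rewrite w0 !mulr0.
  case: (boolP (j \in I)) => // jI.
  by rewrite xk// mxE (negPf ji) mulrC mulKf// gt_eqF.
have {}wi : 0 < w 0 i by rewrite lt_neqAle eq_sym w0.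
have sqi : s * crd c q 0 i = w 0 i by rewrite qE mxE eqxx mulrA sign_sqr// mul1r.
have nCq : ~ C q.
  by move=> Cq; move: sqi; rewrite (((vc cq).1 Cq) i iI) mulr0 => /esym/eqP; rewrite (negPf w0).
have [x xq] := blowdown_out nCq.
have nCx : ~ C (beta x) by rewrite xq.
exists x; first by split; rewrite ?direction_out// xq// sqi.
apply/rowP => j; rewrite !mxE direction_out// xq sqi.
have [->//|ji] := eqVneq j i.
rewrite qE !mxE (negPf ji); case: (boolP (j \in I)) => // jI.
by rewrite mulfK// gt_eqF.
Qed.

Lemma pchart_proper : proper_chart e.
Proof.
split; [exact: pchart_inj|exact: pchart_corner|move=> x ex].
(* For s = -1 and a boundary index i the chart is empty, because directions are nonnegative
   there. *)
have [sB|nsB] := pselect (s = 1 \/ i \notin bdry c); last first.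
  have [cx dx] := ex; exfalso; apply: nsB.
  case: ss => sE; [by left|right]; apply/negP => iB.
  move: dx; rewrite sE mulN1r oppr_gt0 ltNge; move/negP; apply.
  have [Cx|nCx] := pselect (C (beta x)); last by rewrite direction_out//; exact: mchart_corner.
  by have [[_ +] _] := direction_in gN mc vc cx Cx; apply.
have [cx _] := ex; case: mc => -[_ _ pc3] _.
have [r r0 rH] := pc3 _ cx.
have : nbhs (crd e x) (blow I i s @^-1` ball (crd c (beta x)) r).
  apply: (smooth_continuous oT _ (smooth_blow I i s oT)) => //.
  by rewrite pchart_blow//; exact: nbhsx_ballx.
move=> /ball_nbhs[t t0 tH]; exists t => // w wt wB.
apply: pchart_image => //.
apply: rH; first exact: tH.
have wi : 0 <= w 0 i by apply: wB; rewrite in_setU1 eqxx.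
have wj j : j \in bdry c -> 0 <= w 0 j by move=> jB; apply: wB; rewrite in_setU1 jB orbT.
move=> j jB; rewrite mxE; case: eqP => [ji|_]; last by case: ifP => _; rewrite ?mulr_ge0// wj.
by case: sB => [->|]; rewrite ?mul1r// -ji jB.
Qed.

Lemma represents_pchart_blowdown x : dom e x -> represents e c beta x (blow I i s).
Proof.
move=> ex; exists setT; split => //; first exact: smooth_blow.
by move=> y ey _; split; [case: ey|exact: pchart_blow].
Qed.

Lemma represents_pchart_cchart x : dom e x -> ~ C (beta x) ->
  represents e (cchart c) id x (blow I i s).
Proof.
move=> ex nC; have o1 : open [set w : 'rV[R]_n | 0 < w 0 i] by apply: open_pos; exact: smooth_coord.
exists [set w | 0 < w 0 i]; split => //; [exact: pchart_pos|exact: smooth_blow|].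
move=> y ey wy; split; last exact: pchart_blow.
split; first by case: ey.
by move=> /(pchart_center ey) E; move: wy; rewrite /= E ltxx.
Qed.

Definition unblow w : 'rV[R]_n :=
  \row_j (if j == i then s * w 0 i else if j \in I then w 0 j / (s * w 0 i) else w 0 j).

Lemma represents_cchart_pchart x : dom (cchart c) x -> dom e x ->
  represents (cchart c) e id x unblow.
Proof.
move=> [_ nC] [cx dx]; have o1 : open [set w : 'rV[R]_n | 0 < s * w 0 i].
  by apply: open_pos; apply: smoothM => //; [exact: smooth_cst|exact: smooth_coord].
exists [set w | 0 < s * w 0 i]; split => //.
- by move: dx; rewrite direction_out.
- apply/smooth_rowP => // j.
  apply: (smooth_eq (f := fun w => if j == i then s * w 0 i
    else if j \in I then w 0 j * (s * w 0 i)^-1 else w 0 j)) => // [w _|]; first by rewrite mxE.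
  have sm : smooth_on [set w : 'rV[R]_n | 0 < s * w 0 i] (fun w => s * w 0 i).
    by apply: smoothM => //; [exact: smooth_cst|exact: smooth_coord].
  case: (j == i) => //; case: (j \in I); last exact: smooth_coord.
  apply: smoothM => //; first exact: smooth_coord.
  by apply: smoothV => // w w0; rewrite gt_eqF.
move=> y [cy nCy] wy; split; first by split; rewrite ?direction_out.
by apply/rowP => j; rewrite !mxE direction_out.
Qed.

End Pchart.

Lemma represents_cchart c d x F : represents c d id (beta x) F ->
  represents (cchart c) (cchart d) id x F.
Proof.
move=> [U [oU Ux sF H]]; exists U; split => // y [cy nCy] Uy.
by have [dy E] := H _ cy Uy.
Qed.

Lemma represents_cchart_blowdown c x : dom (cchart c) x ->
  represents (cchart c) c beta x id.
Proof.
move=> _; exists setT; split => //; first exact: smooth_id.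
by move=> y [cy nCy] _.
Qed.

(** The transition map F downstairs preserves the centre, so by Hadamard its J-components are
    combinations of the coordinates z_l, l in I. After [blow] each z_l has the factor w_i; it
    cancels from the quotients of J-components, which are therefore smooth across the front face. *)
Lemma represents_pchart_pchart c I i s d J k t x : coords c I -> coords d J ->
  i \in I -> k \in J -> sign s -> sign t ->
  dom (pchart c I i s) x -> dom (pchart d J k t) x -> C (beta x) ->
  exists F, represents (pchart c I i s) (pchart d J k t) id x F.
Proof.
move=> cI dJ iI kJ hs ht ex fx Cx; set e := pchart c I i s; set f := pchart d J k t.
have [[mc vc] [md vd]] := (cI, dJ).
have [[cx dx] [cx' dx']] := (ex, fx).
have [F rF] := mchart_compat gN mc md cx cx'.
have [U1 nU1 HU1] := represents_corner mc cx rF.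
have [UF [oUF UFx sF HF]] := rF.
pose z0 := crd c (beta x).
have z0I j : j \in I -> z0 0 j = 0 by move=> jI; exact: (center_coord cI).
have : nbhs z0 (UF `&` U1) by apply: filterI => //; exact: open_nbhs_nbhs.
move=> /ball_nbhs[r r0 rU].
have r2 : 0 < r / 2 by rewrite divr_gt0.
have sFj j : smooth_on (ball z0 r) (fun z => F z 0 j).
  have : smooth_on (ball z0 r) F by apply: smooth_sub sF => z /rU[].
  by move/smooth_rowP; apply; exact: ball_open.
have /choice[g Hg] j := hadamard z0I r0 (sFj j).
(* The J-components of F with the common factor w_i removed. *)
pose h j w : R := \sum_(k in I) lift_dir i s w 0 k * g j k (blow I i s w).
have bH y : dom c (beta y) -> ball z0 (r / 2) (crd c (beta y)) ->
    dom d (beta y) /\ crd d (beta y) = F (crd c (beta y)).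
  move=> cy By; apply: HF => //.
  have /rU[] // : ball z0 r (crd c (beta y)).
  by apply: le_ball By; rewrite ler_pdivrMr// ler_pMr// ler1n.
have H1 y j : dom e y -> ball z0 (r / 2) (crd c (beta y)) -> j \in J ->
    crd d (beta y) 0 j = crd e y 0 i * h j (crd e y).
  move=> ey By jJ; have [cy _] := ey; have [dy ->] := bH y cy By.
  have [_ Hj _] := Hg j; rewrite (Hj _ By).
  (* The constant term of Hadamard's formula vanishes: the contracted point is in the corner and on
     the centre, where the J-components are 0. *)
  have B0 : ball z0 r (contract I 0 (crd c (beta y))).
    apply: le_ball (contract_ball z0I r2 _ By); last by rewrite lexx ler01.
    by rewrite ler_pdivrMr// ler_pMr// ler1n.
  have c0 : corner (bdry c) (contract I 0 (crd c (beta y))).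
    move=> l lB; rewrite mxE; case: ifP => _; first by rewrite mul0r.
    exact: mchart_corner.
  have [_ U10] := rU _ B0; have [q [cq qE dq <-]] := HU1 _ c0 U10.
  have Cq : C q by apply/vc => // l lI; rewrite qE mxE lI mul0r.
  rewrite ((vd q dq).1 Cq j jJ) add0r /h mulr_sumr; apply: eq_bigr => l lI.
  by rewrite (pchart_blow cI iI hs ey) (blowE i s _ lI) mulrA.
(* Off the centre the factor is w_i. On it, the factor is the size of the ray, and the last clause
   of [hadamard] identifies h with the derivative of F. *)
have H2 y : dom e y -> ball z0 (r / 2) (crd c (beta y)) -> exists2 l : R, 0 < l &
    forall j, j \in J -> direction d y 0 j = l * h j (crd e y).
  move=> ey By; have [cy sy] := ey; have [dy dyE] := bH y cy By.
  have [Cy|nCy] := pselect (C (beta y)); last first.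
    exists (crd e y 0 i); first exact: (pchart_pos ey).
    by move=> j jJ; rewrite direction_out// H1.
  exists (s * direction c y 0 i) => // j jJ.
  have rFy : represents c d id (beta y) F.
    exists UF; split => //.
    have /rU[] // : ball z0 r (crd c (beta y)).
    by apply: le_ball By; rewrite ler_pdivrMr// ler_pMr// ler1n.
  rewrite (direction_change gN mc vc md vd cy dy Cy rFy).
  have dF := represents_differentiable rFy.
  (* Only this normal part counts: the remainder [b] is tangent to the centre, and F keeps it
     tangent. *)
  pose a : 'rV[R]_n := part I (direction c y).
  pose b : 'rV[R]_n := direction c y - a.
  have dE : direction c y = a + b by rewrite subrKC.
  rewrite {1}dE (deriveE _ dF) linearD mxE -!(deriveE _ dF).
  have -> : ('D_b F (crd c (beta y))) 0 j = 0.
    apply: (transition_derive0 mc cy Cy vc vd rFy _ jJ) => l lI.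
    by rewrite !mxE lI subrr.
  rewrite addr0.
  have -> : ('D_a F (crd c (beta y))) 0 j = \sum_(l in I) a 0 l * ('D_('e_l) F (crd c (beta y))) 0 j.
    rewrite (deriveE _ dF) {1}(row_sum_delta a) linear_sum summxE [RHS]big_mkcond.
    apply: eq_bigr => l _; rewrite linearZ mxE -(deriveE _ dF).
    by case: ifPn => // lI; rewrite mxE (negPf lI) mul0r.
  rewrite /h mulr_sumr; apply: eq_bigr => l lI.
  rewrite mxE lI (pchart_dir hs ey lI) -mulrA; congr (_ * (_ * _)).
  have [_ _ Hj] := Hg j; rewrite -(pchart_blow cI iI hs ey) Hj.
    by rewrite derive_coordE.
  by move=> m mI; exact: (center_coord cI).
have w0B : ball z0 (r / 2) (blow I i s (crd e x)).
  by rewrite -(pchart_blow cI iI hs ex); apply: ballxx.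
pose W1 : set 'rV[R]_n := setT `&` (blow I i s) @^-1` ball z0 (r / 2).
have oW1 : open W1.
  apply: open_preimage_on; [exact: oT|exact: ball_open|move=> w _].
  by apply: (smooth_continuous oT _ (smooth_blow I i s oT)).
have sh j : smooth_on W1 (h j).
  apply: smooth_sum => // l lI; apply: smoothM => //.
    apply: (smooth_eq (f := fun w => if l == i then s else w 0 l)) => // [w _|]; first by rewrite mxE.
    by case: (l == i); [exact: smooth_cst|exact: smooth_coord].
  have [sg _ _] := Hg j.
  apply: (smooth_comp_real oW1 _ _ (sg l)); first exact: ball_open.
    by move=> w [].
  exact: smooth_blow.
have sth : smooth_on W1 (fun w => t * h k w) by apply: smoothM => //; exact: smooth_cst.
(* The quantity that is divided by is positive at x, and this is an open condition. *)
pose W := W1 `&` [set w | 0 < t * h k w].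
have oW : open W by exact: open_coord_gt.
have WW1 : W `<=` W1 by move=> w [].
exists (fun w => \row_j (if j == k then w 0 i * (t * h k w)
  else if j \in J then h j w / (t * h k w) else F (blow I i s w) 0 j)).
exists W; split => //.
- split; first by split.
  have [|l l0 lH] := H2 x ex; first by rewrite (pchart_blow cI iI hs ex).
  by move: dx'; rewrite lH// mulrCA pmulr_rgt0.
- apply/smooth_rowP => // j.
  apply: (smooth_eq (f := fun w => if j == k then w 0 i * (t * h k w)
    else if j \in J then h j w * (t * h k w)^-1 else F (blow I i s w) 0 j)) => //.
    by move=> w _; rewrite mxE.
  have sthW := smooth_sub WW1 sth.
  case: (j == k); first by apply: smoothM => //; exact: smooth_coord.
  case: (j \in J).
    apply: smoothM => //; first exact: smooth_sub (sh j).
    by apply: smoothV => // w [_ w0]; rewrite gt_eqF.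
  apply: (smooth_comp_real oW _ _ (sFj j)); first exact: ball_open.
    move=> w [[_ wB] _]; apply: le_ball wB; by rewrite ler_pdivrMr// ler_pMr// ler1n.
  exact: smooth_blow.
- move=> y ey [[_ yB] ty].
  rewrite /= -(pchart_blow cI iI hs ey) in yB.
  have [cy sy] := ey; have [dy dyE] := bH y cy yB.
  have [l l0 lH] := H2 y ey yB.
  have fy : dom f y by split => //; rewrite lH// mulrCA mulr_gt0.
  split=> //; apply/rowP => j; rewrite [LHS]mxE [RHS]mxE.
  case: (boolP (j == k)) => [/eqP jk|jk]; first by rewrite (H1 y k)// mulrCA.
  case: (boolP (j \in J)) => jJ; last by rewrite -(pchart_blow cI iI hs ey) dyE.
  rewrite !lH// mulrCA -mulf_div divff ?mul1r//; by rewrite gt_eqF.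
Qed.

Local Notation ray_pt := {pS : N * set (chart R n N -> 'rV[R]_n) | C pS.1 /\ normal_ray C pS.1 pS.2}.

Lemma ray_direction c I v (pS : ray_pt) : coords c I -> dom c (sval pS).1 -> (sval pS).2 v ->
  exists2 k : R, 0 < k & forall j, j \in I -> v c 0 j = k * direction c (inr pS : blowup C) 0 j.
Proof.
move=> [mc vc] cp Sv; have Cp : C (blowdown C (inr pS)) by case: (proj2_sig pS).
have [_ [pS' [[E] _ E2]]] := direction_in gN mc vc (x := inr pS) cp Cp.
have : ray c I (beta (inr pS)) (direction c (inr pS : blowup C)) v by rewrite -E2 -E.
by case.
Qed.

Lemma direction_mem c I (pS : ray_pt) : coords c I -> dom c (sval pS).1 ->
  exists2 v, (sval pS).2 v & direction c (inr pS : blowup C) = v c.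
Proof.
move=> [mc vc] cp; have [Cp H] := proj2_sig pS.
have /(normal_rayP gN _ mc cp Cp vc)[a _ SE] := H.
have [v vS] := ray_nonempty gN I a mc cp.
exists (xget (fun=> 0) (sval pS).2) => //.
by apply: (@xgetPex _ (fun=> 0) (sval pS).2); exists v; rewrite SE.
Qed.

Lemma projective_chart_eq (e : chart R n (blowup C)) : projective_chart e ->
  exists c I i s, [/\ coords c I, i \in I /\ sign s, dom e = dom (pchart c I i s),
    bdry e = bdry (pchart c I i s) &
    forall x, dom e x -> crd e x = crd (pchart c I i s) x].
Proof.
move=> [c [I [i [s [cI [iI ss] eB eD eC]]]]]; exists c, I, i, s.
have [mc vc] := cI.
have domE x : dom e x <-> dom (pchart c I i s) x.
  split=> [/eD[cx H]|[cx dx]].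
    split=> //; case: x cx H => [p|pS] //= cx H.
    have [v Sv E] := direction_mem cI cx.
by rewrite [xget _ _ _]E; exact: H.
  apply/eD; split=> //; case: x cx dx => [p|pS] //= cx dx v Sv.
  have [k k0 kH] := ray_direction cI cx Sv.
  by rewrite kH// mulrCA mulr_gt0.
split=> //.
- by apply/funext => x; apply/propext.
- move=> x ex; have := eC x ex; have [cx dx] := (domE x).1 ex.
  case: x ex cx dx => [p|pS] //= ex cx dx.
  have [v Sv vE] := direction_mem cI cx; move=> /(_ v Sv) ->.
  apply/rowP => j; rewrite !mxE -vE; case: (j == i) => //.
  have [Cp _] := proj2_sig pS.
  by rewrite (((vc _ cx).1 Cp) i iI) mulr0.
Qed.

Lemma pchart_projective c I i s : coords c I -> i \in I -> sign s ->
  projective_chart (pchart c I i s).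
Proof.
move=> cI iI ss; exists c, I, i, s; have [mc vc] := cI.
split=> // x.
  split=> [[cx dx]|[cx H]].
    split=> //; case: x cx dx => [p|pS] //= cx dx v Sv.
    have [k k0 kH] := ray_direction cI cx Sv.
    by rewrite kH// mulrCA mulr_gt0.
  split=> //; case: x cx H => [p|pS] //= cx H.
  have [v Sv E] := direction_mem cI cx.
by rewrite [xget _ _ _]E; exact: H.
move=> [cx dx]; case: x cx dx => [p|pS] //= cx dx v Sv.
have [k k0 kH] := ray_direction cI cx Sv.
have [Cp _] := proj2_sig pS.
apply/rowP => j; rewrite !mxE; case: (j == i).
  by rewrite (((vc _ cx).1 Cp) i iI) mulr0.
case: (boolP (j \in I)) => // jI; rewrite !kH//.
rewrite [in RHS]mulrCA -mulf_div divff ?mul1r//; by rewrite gt_eqF.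
Qed.

Lemma cchart_complement c : atlas c -> complement_chart (cchart c).
Proof. by move=> ac; exists c. Qed.

Lemma complement_chart_eq (e : chart R n (blowup C)) : complement_chart e ->
  exists c, [/\ mchart c, dom e = dom (cchart c), bdry e = bdry (cchart c) &
    forall x, dom e x -> crd e x = crd (cchart c) x].
Proof.
move=> [c [ac eB eD eC]]; exists c; split=> //; first by case: gN => + _; apply.
by apply/funext => x; apply/propext.
Qed.

Lemma represents_eql (X Y : Type) (e e' : chart R n X) (d d' : chart R n Y) h (x : X) F :
  dom e = dom e' -> (forall u, dom e u -> crd e u = crd e' u) ->
  dom d = dom d' -> (forall u, dom d u -> crd d u = crd d' u) -> dom e x ->
  represents e d h x F -> represents e' d' h x F.
Proof.
move=> eD eC dD dC ex [U [oU Ux sF H]]; exists U; split=> //; first by rewrite -eC.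
move=> y; rewrite -eD => ey; rewrite -eC// => Uy; have [dy E] := H y ey Uy.
by rewrite -dD -dC.
Qed.

(** Complement charts are allowed over every [mchart], not only over atlas charts, because gluing
    restricts charts. *)
Inductive bchart : chart R n (blowup C) -> Prop :=
| BC_compl c : mchart c -> bchart (cchart c)
| BC_proj c I i s : coords c I -> i \in I -> sign s -> bchart (pchart c I i s).

(** Off the centre every transition factors through complement charts; two projective charts that
    meet over the centre need the division argument. *)
Lemma bchart_compatible e f : bchart e -> bchart f -> compatible e f.
Proof.
have cc c d x : mchart c -> mchart d -> dom (cchart c) x -> dom (cchart d) x ->
    exists F, represents (cchart c) (cchart d) id x F.
  move=> mc md [cx nC] [dx _]; have [F rF] := mchart_compat gN mc md cx dx.
  by exists F; exact: represents_cchart.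
case=> [c mc|c I i s cI iI hs]; case=> [d md|d J k t dJ kJ ht] x ex fx.
- exact: cc.
- have [cx nC] := ex; have [dx sx] := fx; have [md _] := dJ.
  have [F rF] := cc c d x mc md ex (conj dx nC).
  exists (unblow J k t \o F); apply: (represents_comp (d := cchart d) (h := id) (k := id) ex rF).
  exact: represents_cchart_pchart.
- have [dx nC] := fx; have [cx sx] := ex; have [mc _] := cI.
  have [F rF] := cc c d x mc md (conj cx nC) fx.
  exists (F \o blow I i s); apply: (represents_comp (d := cchart c) (h := id) (k := id) ex _ rF).
  exact: represents_pchart_cchart.
have [Cx|nC] := pselect (C (beta x)); first exact: represents_pchart_pchart.
have [[cx sx] [dx tx]] := (ex, fx); have [[mc _] [md _]] := (cI, dJ).
have [F rF] := cc c d x mc md (conj cx nC) (conj dx nC).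
exists (unblow J k t \o (F \o blow I i s)).
apply: (represents_comp (d := cchart d) (h := id) (k := id) ex); last exact: represents_cchart_pchart.
apply: (represents_comp (d := cchart c) (h := id) (k := id) ex _ rF).
exact: represents_pchart_cchart.
Qed.

Hypothesis locC : closed C.

Lemma bchart_proper e : bchart e -> proper_chart e.
Proof.
case=> [c mc|c I i s cI iI hs]; last exact: pchart_proper.
split=> [x y [cx nC] [cy nCy] E|x [cx _]|x [cx nC]].
- by apply: blowdown_inj => //; exact: (mchart_inj mc).
- exact: (mchart_corner mc cx).
have [r r0 rH] : exists2 e : R, 0 < e & forall q, dom c q ->
    ball (crd c (beta x)) e (crd c q) -> ~ C q.
  apply/(nbhs_chart gN _ mc cx); apply: open_nbhs_nbhs; split=> //.
  exact: closed_openC.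
case: mc => -[_ _ pc3] _; have [t t0 tH] := pc3 _ cx.
exists (Num.min r t); first by rewrite lt_min r0.
move=> z zb zB; have [|q cq E] := tH z _ zB.
  by apply: le_ball zb; rewrite ge_min lexx orbT.
have nCq : ~ C q.
  by apply: rH => //; rewrite E; apply: le_ball zb; rewrite ge_min lexx.
have [y yq] := blowdown_out nCq.
by exists y; rewrite /= yq.
Qed.

Lemma atlas_bchart (e : chart R n (blowup C)) : atlas e -> exists f,
  [/\ bchart f, dom e = dom f, bdry e = bdry f & forall x, dom e x -> crd e x = crd f x].
Proof.
case=> [/complement_chart_eq[c [mc E1 E2 E3]]|/projective_chart_eq[c [I [i [s [cI [iI hs] E1 E2 E3]]]]]].
  by exists (cchart c); split=> //; constructor.
by exists (pchart c I i s); split=> //; constructor.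
Qed.

Lemma bchart_mchart e : bchart e -> mchart e.
Proof.
move=> be; split; first exact: bchart_proper.
move=> d /atlas_bchart[f [bf E1 E2 E3]].
have E3' x : dom f x -> crd f x = crd d x by rewrite -E1 => dx; rewrite E3.
split=> x ex fx.
  have fx' : dom f x by rewrite -E1.
  have [F rF] := bchart_compatible be bf ex fx'.
  by exists F; apply: represents_eql rF.
have fx' : dom f x by rewrite -E1.
have [F rF] := bchart_compatible bf be fx' fx.
by exists F; apply: represents_eql rF.
Qed.

End BlowupCharts.

(** * Gluing charts and the topology of a blow-up *)


Section ChartFacts.
Variables (R : realType) (n : nat).

Lemma mchart_eql (N : charted_space R n) (e f : chart R n N) : mchart f ->
  dom e = dom f -> bdry e = bdry f -> (forall x, dom e x -> crd e x = crd f x) ->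
  mchart e.
Proof.
case=> -[p1 p2 p3] cf E1 E2 E3.
have E3' x : dom f x -> crd f x = crd e x by rewrite -E1 => /E3.
split.
  split=> [x y|x|x]; rewrite !E1.
  - by move=> fx fy; rewrite -!E3'//; exact: p1.
  - by move=> fx; rewrite -E3' // E2; exact: p2.
  - move=> fx; have [r r0 rH] := p3 x fx; rewrite -E3'// E2; exists r => // z zr zB.
    by have [q fq <-] := rH z zr zB; exists q => //; rewrite -E3'.
move=> d ad; have [c1 c2] := cf d ad; split=> x.
  rewrite E1 => fx dx; have [F rF] := c1 x fx dx; exists F.
  exact: represents_eql rF.
move=> dx; rewrite E1 => fx; have [F rF] := c2 x dx fx; exists F.
exact: represents_eql rF.
Qed.

Lemma represents_continuous (M N : charted_space R n) (e : chart R n M) (c : chart R n N)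
    (h : M -> N) x F : good M -> good N -> mchart e -> mchart c -> dom e x ->
  represents e c h x F -> {for x, continuous h}.
Proof.
move=> gM gN me mc ex rF A; have [chx _] := represents_value ex rF.
move=> /(nbhs_chart gN _ mc chx)[r r0 rA].
have [t t0 tH] := represents_cont ex rF r0.
apply/(nbhs_chart gM _ me ex); exists t => // q eq /tH -/(_ eq)[cq Bq].
exact: rA.
Qed.

Lemma smooth_map_continuous (M N : charted_space R n) (h : M -> N) : good M -> good N ->
  smooth_map h -> continuous h.
Proof.
move=> gM gN sh x.
have [c mc cx] := mchart_cover gM x; have [d md dx] := mchart_cover gN (h x).
have [F rF] := sh c d x mc md cx dx.
exact: represents_continuous rF.
Qed.

Lemma smooth_map_comp (M N P : charted_space R n) (h : M -> N) (k : N -> P) : good N ->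
  smooth_map h -> smooth_map k -> smooth_map (k \o h).
Proof.
move=> gN sh sk c d x mc md cx dx; have [e me ex] := mchart_cover gN (h x).
have [F rF] := sh c e x mc me cx ex; have [G rG] := sk e d (h x) me md ex dx.
by exists (G \o F); exact: represents_comp rF rG.
Qed.

Lemma diffeomorphism_comp (M N P : charted_space R n) (h : M -> N) (k : N -> P) : good N ->
  diffeomorphism h -> diffeomorphism k -> diffeomorphism (k \o h).
Proof.
move=> gN [g [hg gh sh sg]] [l [kl lk sk sl]]; exists (g \o l); split.
- exact: can_comp.
- exact: can_comp.
- exact: smooth_map_comp.
- exact: smooth_map_comp.
Qed.

Lemma homeo_closure (S T : topologicalType) (h : S -> T) (g : T -> S) (A : set S) :
  cancel h g -> cancel g h -> continuous h -> continuous g ->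
  closure (h @` A) = h @` closure A.
Proof.
move=> hg gh ch cg; apply/seteqP; split=> [y cy|_ [x cx <-] B nB].
  exists (g y); last exact: gh.
  move=> B nB; have [_ [[x Ax <-] /=]] := cy _ (cg y B nB).
  by rewrite hg => Bx; exists x.
have [x' [Ax' Bx']] := cx _ (ch x B nB).
by exists (h x'); split=> //; exists x'.
Qed.

Lemma image_cancel (S T : Type) (h : S -> T) (g : T -> S) (A : set S) :
  cancel h g -> cancel g h -> h @` A = g @^-1` A.
Proof.
move=> hg gh; apply/seteqP; split=> [_ [x Ax <-]|y Ay]; first by rewrite /= hg.
by exists (g y).
Qed.

(** The second clause says that e is as large as c and phi allow. So the image of e is determined by
    c, phi and [bdry e], and two charts over c with the same phi and boundary indices can be
    identified. *)
Definition over X Y (e : chart R n X) (c : chart R n Y) (phi : 'rV[R]_n -> 'rV[R]_n)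
    (b : X -> Y) : Prop :=
  [/\ forall x, dom e x -> dom c (b x) /\ crd c (b x) = phi (crd e x),
      forall w, corner (bdry e) w -> (exists2 q, dom c q & crd c q = phi w) ->
        exists2 x, dom e x & crd e x = w &
      forall w, corner (bdry e) w -> corner (bdry c) (phi w)].

Lemma over_comp X Y Z (e' : chart R n X) (e : chart R n Y) (c : chart R n Z) phi' phi
    (b' : X -> Y) (b : Y -> Z) :
  over e' e phi' b' -> over e c phi b -> over e' c (phi \o phi') (b \o b').
Proof.
move=> [H1 H2 H3] [K1 K2 K3]; split=> [x e'x|w wB|w wB] /=.
- by have [ex xE] := H1 x e'x; have [cx cE] := K1 _ ex; rewrite cE xE.
- by move=> /(K2 _ (H3 _ wB)); exact: H2.
- exact/K3/H3.
Qed.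

Lemma over_ext X Y (e : chart R n X) (c : chart R n Y) phi phi' (b : X -> Y) :
  phi =1 phi' -> over e c phi b -> over e c phi' b.
Proof. by move=> /funext ->. Qed.

End ChartFacts.

Section Glue.
Variables (R : realType) (n : nat) (B : Type) (U : set B).

Section GlueFunction.
Variables (N1 N2 : charted_space R n).
Hypotheses (g1 : good N1) (g2 : good N2).
Variables (b1 : N1 -> B) (b2 : N2 -> B).

Definition matched (e1 : chart R n N1) (e2 : chart R n N2) : Prop :=
  [/\ mchart e1, mchart e2, bdry e1 = bdry e2,
      forall w, (exists2 x, dom e1 x & crd e1 x = w) <-> (exists2 y, dom e2 y & crd e2 y = w) &
      forall x y, dom e1 x -> dom e2 y -> crd e1 x = crd e2 y -> b1 x = b2 y].

Definition glued (x : N1) (y : N2) : Prop :=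
  exists e1 e2, [/\ matched e1 e2, dom e1 x, dom e2 y & crd e1 x = crd e2 y].

Lemma glued_base x y : glued x y -> b1 x = b2 y.
Proof. by move=> [e1 [e2 [[_ _ _ _ H] ex ey E]]]; exact: H. Qed.

(** Two distinct images of x would be separated by open sets. But near x there are points over U,
    and over U the images agree by injectivity. *)
Lemma glued_fun x y y' : hausdorff_space (pt N2) -> closure (b1 @^-1` U) x ->
  (forall y y', U (b2 y) -> b2 y = b2 y' -> y = y') ->
  glued x y -> glued x y' -> y = y'.
Proof.
move=> h2 dx inj2 [e1 [e2 [m ex ey E]]] [e1' [e2' [m' ex' ey' E']]].
have [m1 m2 _ mi mb] := m; have [m1' m2' _ mi' mb'] := m'.
have [//|yy'] := eqVneq y y'.
move: h2; rewrite open_hausdorff => /(_ y y' yy')[[V V'] /= [yV y'V'] [oV oV' VV']].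
have /(nbhs_chart g2 _ m2 ey)[r r0 rV] : nbhs y V by apply: open_nbhs_nbhs; split=> //; exact/set_mem.
have /(nbhs_chart g2 _ m2' ey')[r' r'0 rV'] : nbhs y' V' by apply: open_nbhs_nbhs; split=> //; exact/set_mem.
have n1 : nbhs x [set q | dom e1 q /\ ball (crd e1 x) r (crd e1 q)].
  by apply/(nbhs_chart g1 _ m1 ex); exists r.
have n1' : nbhs x [set q | dom e1' q /\ ball (crd e1' x) r' (crd e1' q)].
  by apply/(nbhs_chart g1 _ m1' ex'); exists r'.
have [q [Uq [[eq Bq] [eq' Bq']]]] := dx _ (filterI n1 n1').
have [|q2 e2q q2E] := (mi (crd e1 q)).1; first by exists q.
have [|q2' e2q' q2E'] := (mi' (crd e1' q)).1; first by exists q.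
have Vq : V q2 by apply: rV => //; rewrite -E q2E.
have Vq' : V' q2' by apply: rV' => //; rewrite -E' q2E'.
have bq := mb q q2 eq e2q (esym q2E); have bq' := mb' q q2' eq' e2q' (esym q2E').
have qq : q2 = q2' by apply: inj2; rewrite -bq.
have : (V `&` V') q2 by split=> //; rewrite qq.
by rewrite (eqP VV').
Qed.

(** In matched charts h is the identity of the coordinates. *)
Lemma glued_smooth (h : N1 -> N2) : (forall x, glued x (h x)) ->
  (forall x y y', glued x y -> glued x y' -> y = y') -> smooth_map h.
Proof.
move=> H Hf c d x mc md cx dx.
have [e1 [e2 [m ex ey E]]] := H x; have [m1 m2 _ mi mb] := m.
have [F rF] := mchart_compat g1 mc m1 cx ex.
have [G rG] := mchart_compat g2 m2 md ey dx.
exists (G \o (id \o F)); apply: (@represents_comp _ _ _ _ _ c e2 d h id) => //.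
apply: (@represents_comp _ _ _ _ _ c e1 e2 id h) => //.
exists setT; split => //; [exact: openT|by apply: smooth_id; exact: openT|].
move=> q eq _; have [|y e2y yE] := (mi (crd e1 q)).1; first by exists q.
have -> : h q = y by apply: (Hf q) => //; exists e1, e2.
by [].
Qed.

End GlueFunction.

Lemma matched_sym (N1 N2 : charted_space R n) (b1 : N1 -> B) (b2 : N2 -> B) e1 e2 :
  matched b1 b2 e1 e2 -> matched b2 b1 e2 e1.
Proof.
move=> [m1 m2 mB mi mb]; split=> // [w|x y ex ey E]; first by split=> /mi.
exact/esym/mb.
Qed.

Lemma glued_sym (N1 N2 : charted_space R n) (b1 : N1 -> B) (b2 : N2 -> B) x y :
  glued b1 b2 x y -> glued b2 b1 y x.
Proof. by move=> [e1 [e2 [m ex ey E]]]; exists e2, e1; split=> //; exact: matched_sym. Qed.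

Theorem glue (N1 N2 : charted_space R n) (b1 : N1 -> B) (b2 : N2 -> B) :
  good N1 -> good N2 -> hausdorff_space (pt N1) -> hausdorff_space (pt N2) ->
  (forall x, closure (b1 @^-1` U) x) -> (forall y, closure (b2 @^-1` U) y) ->
  (forall x x', U (b1 x) -> b1 x = b1 x' -> x = x') ->
  (forall y y', U (b2 y) -> b2 y = b2 y' -> y = y') ->
  (forall x, exists e1 e2, dom e1 x /\ matched b1 b2 e1 e2) ->
  (forall y, exists e1 e2, dom e2 y /\ matched b1 b2 e1 e2) ->
  exists h : N1 -> N2, diffeomorphism h /\ forall x, b2 (h x) = b1 x.
Proof.
move=> g1 g2 h1 h2 d1 d2 i1 i2 m1 m2.
have T1 x : exists y, glued b1 b2 x y.
  have [e1 [e2 [ex m]]] := m1 x; have [_ _ _ mi _] := m.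
  by have [|y ey yE] := (mi (crd e1 x)).1; [exists x|exists y; exists e1, e2].
have T2 y : exists x, glued b2 b1 y x.
  have [e1 [e2 [ex m]]] := m2 y; have [_ _ _ mi _] := m.
  have [|x x1 xE] := (mi (crd e2 y)).2; first by exists y.
  by exists x; apply: glued_sym; exists e1, e2.
have F1 x y y' : glued b1 b2 x y -> glued b1 b2 x y' -> y = y' by apply: glued_fun.
have F2 y x x' : glued b2 b1 y x -> glued b2 b1 y x' -> x = x' by apply: glued_fun.
have [h hH] := choice T1; have [g gH] := choice T2.
exists h; split; last by move=> x; rewrite (glued_base (hH x)).
exists g; split.
- by move=> x; apply: (F2 (h x)) => //; exact: glued_sym.
- by move=> y; apply: (F1 (g y)) => //; exact: glued_sym.
- exact: glued_smooth hH _.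
- exact: glued_smooth gH _.
Qed.

Lemma matched_over (N N1 N2 : charted_space R n) (b1 : N1 -> N) (b2 : N2 -> N) (f : N -> B)
    e1 e2 c phi : mchart e1 -> mchart e2 -> mchart c -> bdry e1 = bdry e2 ->
  over e1 c phi b1 -> over e2 c phi b2 -> matched (f \o b1) (f \o b2) e1 e2.
Proof.
move=> m1 m2 mc eB [H1 H2 _] [K1 K2 _]; split=> // [w|x y ex ey E].
  split=> -[x ex <-].
    apply: K2; first by rewrite -eB; exact: (mchart_corner m1).
    by have [cx xE] := H1 x ex; exists (b1 x).
  apply: H2; first by rewrite eB; exact: (mchart_corner m2).
  by have [cx xE] := K1 x ex; exists (b2 x).
have [cx xE] := H1 x ex; have [cy yE] := K1 y ey.
by rewrite /= (mchart_inj mc cx cy)// xE yE E.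
Qed.

End Glue.

(** * The blow-up as a space: its charts cover it and it is Hausdorff *)

Section Blowup.
Variables (R : realType) (n : nat) (N : charted_space R n).
Hypothesis gN : good N.
Variable C : set N.
Implicit Types (p q : N) (c d : chart R n N) (I J : {set 'I_n}) (x y : blowup C).

Local Notation beta := (blowdown C).

Definition locally_coords := forall p, C p -> exists c I, dom c p /\ coords C c I.

(* Normal rays point inwards, so for a boundary index i only s = 1 gives a nonempty chart. *)
Definition valid (c : chart R n N) (i : 'I_n) (s : R) := s = 1 \/ i \notin bdry c.

(** Some entry of the direction with index in I is nonzero, and s is its sign; at a boundary index
    that entry is nonnegative, so s = 1. *)
Lemma pchart_cover c I x : coords C c I -> dom c (beta x) ->
  exists i s, [/\ i \in I, sign s, valid c i s & dom (pchart C c I i s) x].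
Proof.
move=> [mc vc] cx.
have [[i iI di] dB] : (exists2 i, i \in I & direction c x 0 i != 0) /\
    forall i, i \in I -> i \in bdry c -> 0 <= direction c x 0 i.
  have [Cx|nCx] := pselect (C (beta x)).
    by have [[[i iI di] dB] _] := direction_in gN mc vc cx Cx; split=> //; exists i.
  rewrite direction_out//; split; last by move=> i _; exact: mchart_corner.
  apply: contrapT => H; apply: nCx; apply/vc => // i iI.
  by apply/eqP; apply: contrapT => /negP di; apply: H; exists i.
have [d0|d0] := ltP 0 (direction c x 0 i).
  by exists i, 1; split=> //; [by left|by left|split=> //; rewrite mul1r].
have {}d0 : direction c x 0 i < 0 by rewrite lt_neqAle di.
exists i, (-1); split=> //; [by right|right|split=> //; by rewrite mulN1r oppr_gt0].
by apply/negP => iB; move: d0; rewrite ltNge dB.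
Qed.

Hypotheses (clC : closed C) (lC : locally_coords).

Lemma blowup_good : good (blowup C).
Proof.
split=> [e /(atlas_bchart gN)[f [bf E1 E2 E3]]|x].
  exact: mchart_eql (bchart_mchart gN clC bf) E1 E2 E3.
have [Cx|nCx] := pselect (C (beta x)); last first.
  case: gN => _ /(_ (beta x))[c ac cx]; exists (cchart C c) => //.
  by left; exact: cchart_complement.
have [c [I [cx cI]]] := lC Cx.
have [i [s [iI ss _ ex]]] := pchart_cover cI cx.
by exists (pchart C c I i s) => //; right; exact: pchart_projective.
Qed.

Lemma cchart_mchart c : mchart c -> mchart (cchart C c).
Proof. by move=> mc; apply: bchart_mchart => //; constructor. Qed.

Lemma pchart_mchart c I i s : coords C c I -> i \in I -> sign s -> mchart (pchart C c I i s).
Proof. by move=> *; apply: bchart_mchart => //; constructor. Qed.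

Lemma blowdown_continuous : continuous beta.
Proof.
have gB := blowup_good => x.
have [Cx|nCx] := pselect (C (beta x)).
  have [c [I [cx cI]]] := lC Cx.
  have [i [s [iI ss _ ex]]] := pchart_cover cI cx.
  apply: (represents_continuous gB gN (pchart_mchart cI iI ss) (proj1 cI) ex).
  exact: represents_pchart_blowdown.
have [c mc cx] := mchart_cover gN (beta x).
have ex : dom (cchart C c) x by [].
exact: (represents_continuous gB gN (cchart_mchart mc) mc ex (represents_cchart_blowdown ex)).
Qed.

Lemma over_pchart c I i s : coords C c I -> i \in I -> sign s -> valid c i s ->
  over (pchart C c I i s) c (blow I i s) beta.
Proof.
move=> cI iI ss vs; split=> [x ex|w|w wB].
- by split; [case: ex|exact: pchart_blow].
- exact: pchart_image.
- move=> j jB; have wi : 0 <= w 0 i by apply: wB; rewrite in_setU1 eqxx.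
  have wj k : k \in bdry c -> 0 <= w 0 k by move=> kB; apply: wB; rewrite in_setU1 kB orbT.
  rewrite mxE; case: eqP => [ji|_]; last by case: ifP => _; rewrite ?mulr_ge0// wj.
  by case: vs => [->|]; rewrite ?mul1r// -ji jB.
Qed.

Lemma over_cchart c : (forall q, dom c q -> ~ C q) -> over (cchart C c) c id beta.
Proof.
move=> H; split=> // [x [cx _]//|w _ [q cq qE]].
have [x xq] := blowdown_out (H q cq).
by exists x; [split; rewrite xq//; exact: H|rewrite /= xq].
Qed.

(** A point of the front face is approached by giving its coordinate w_i small positive values. *)
Lemma dense_out x : closure (beta @^-1` (~` C)) x.
Proof.
have gB := blowup_good.
have [Cx|nCx] := pselect (C (beta x)); last exact: subset_closure.
have [c [I [cx cI]]] := lC Cx.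
have [i [s [iI ss vs ex]]] := pchart_cover cI cx.
have me := pchart_mchart cI iI ss.
apply/(closure_chart gB _ me ex) => e e0.
have [_ _ pc3] := proj1 me; have [r r0 rH] := pc3 x ex.
pose t := Num.min e r / 2.
have m0 : 0 < Num.min e r by rewrite lt_min e0.
have t0 : 0 < t by rewrite divr_gt0.
have tm : t < Num.min e r by rewrite /t ltr_pdivrMr// ltr_pMr// ltr1n.
pose w : 'rV[R]_n := \row_j (if j == i then t else crd (pchart C c I i s) x 0 j).
have wb : ball (crd (pchart C c I i s) x) (Num.min e r) w.
  apply/ball_rowP => // j; rewrite [w 0 j]mxE; have [->|_] := eqVneq j i.
    by rewrite ((pchart_center cI iI ss ex).1 Cx) sub0r normrN gtr0_norm.
  by rewrite subrr normr0.
have wb' : ball (crd (pchart C c I i s) x) r w by apply: le_ball wb; rewrite ge_min lexx orbT.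
have [|y ey yE] := rH w wb'.
  move=> j jB; rewrite mxE; case: eqP => [_|_]; first exact: ltW.
  exact: (mchart_corner me ex).
exists y; split=> //; first by rewrite yE; apply: le_ball wb; rewrite ge_min lexx.
move=> Cy; have := (pchart_center cI iI ss ey).1 Cy.
by rewrite yE mxE eqxx => tE; move: t0; rewrite tE ltxx.
Qed.

Lemma open_in_chart (M : charted_space R n) (e : chart R n M) (A : set 'rV[R]_n) : good M ->
  mchart e -> open A -> open [set x | dom e x /\ A (crd e x)].
Proof.
move=> gM me oA; rewrite openE => x [ex Ax]; apply/(nbhs_chart gM _ me ex).
have /ball_nbhs[r r0 rA] : nbhs (crd e x) A by apply: open_nbhs_nbhs.
by exists r => // q eq /rA.
Qed.

Lemma separated_in_chart (M : charted_space R n) (e : chart R n M) (x y : M) : good M ->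
  mchart e -> dom e x -> dom e y -> x <> y ->
  exists A B : set M, [/\ open A, open B, A x, B y & A `&` B = set0].
Proof.
move=> gM me ex ey xy.
have nE : crd e x != crd e y by apply/eqP => E; apply: xy; exact: (mchart_inj me).
have := @norm_hausdorff _ 'rV[R]_n.
rewrite open_hausdorff => /(_ _ _ nE)[[A B] /= [xA yB] [oA oB /eqP AB]].
exists [set q | dom e q /\ A (crd e q)], [set q | dom e q /\ B (crd e q)].
split; [exact: open_in_chart|exact: open_in_chart|by split=> //; exact/set_mem
       |by split=> //; exact/set_mem|].
apply/seteqP; split=> // q [[_ Aq] [_ Bq]].
by have : (A `&` B) (crd e q) by []; rewrite AB.
Qed.

(** Only two rays over one point need care. If the chart of one contains the other, they are
    separated in it; otherwise the signed entries s D_i and t D_j compare in opposite ways at x and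
    y. *)
Lemma blowup_hausdorff : hausdorff_space (pt N) -> hausdorff_space (pt (blowup C)).
Proof.
move=> hN; have gB := blowup_good; rewrite open_hausdorff => x y xy.
suff [A [B [oA oB Ax By AB]]] : exists A B : set (blowup C),
    [/\ open A, open B, A x, B y & A `&` B = set0].
  by exists (A, B); split=> //; apply/mem_set.
have [bxy|bxy] := eqVneq (beta x) (beta y); last first.
  move: hN; rewrite open_hausdorff => /(_ _ _ bxy)[[A B] /= [xA yB] [oA oB /eqP AB]].
  exists (beta @^-1` A), (beta @^-1` B); split.
  - by apply: open_comp => // z _; exact: blowdown_continuous.
  - by apply: open_comp => // z _; exact: blowdown_continuous.
  - exact/set_mem.
  - exact/set_mem.
  - apply/seteqP; split=> // z [Az Bz].
    by have : (A `&` B) (beta z) by []; rewrite AB.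
have Cx : C (beta x).
  by apply: contrapT => nCx; move/eqP: xy; apply; exact: blowdown_inj.
have [c [I [cx cI]]] := lC Cx.
have cy : dom c (beta y) by rewrite -bxy.
have Cy : C (beta y) by rewrite -bxy.
have [i [s [iI ss _ ex]]] := pchart_cover cI cx.
have [j [t [jI tt _ ey]]] := pchart_cover cI cy.
have me := pchart_mchart cI iI ss; have mf := pchart_mchart cI jI tt.
have [dy|dy] := ltP 0 (s * direction c y 0 i).
  by apply: (separated_in_chart gB me) => //; exact/eqP.
have [dx|dx] := ltP 0 (t * direction c x 0 j).
  by apply: (separated_in_chart gB mf) => //; exact/eqP.
(* The two directions are separated by the comparison of [s * D_i] and [t * D_j]. *)
have key (k l : 'I_n) (u v : R) : k \in I -> l \in I -> sign u -> sign v ->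
    open [set z | dom (pchart C c I k u) z /\ v * direction c z 0 l < u * direction c z 0 k].
  move=> kI lI su sv; have mk := pchart_mchart cI kI su.
  have -> : [set z | dom (pchart C c I k u) z /\ v * direction c z 0 l < u * direction c z 0 k] =
      [set z | dom (pchart C c I k u) z /\
        [set w : 'rV[R]_n | 0 < 1 - v * lift_dir k u w 0 l] (crd (pchart C c I k u) z)].
    apply/seteqP; split=> z [dz H]; split=> //; have [_ uz] := dz.
      move: H; rewrite (pchart_dir su dz lI) /= mulrCA -subr_gt0.
      by rewrite -[X in X - _]mulr1 -mulrBr pmulr_rgt0.
    rewrite (pchart_dir su dz lI) mulrCA -subr_gt0.
    by rewrite -[X in X - _]mulr1 -mulrBr pmulr_rgt0.
  apply: open_in_chart => //; apply: open_pos.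
  have oT : open (setT : set 'rV[R]_n) by exact: openT.
  apply: (smooth_eq (f := (fun w : 'rV[R]_n => 1 + (- v) * (if l == k then u else w 0 l)))) => //.
    by move=> w _; rewrite mxE mulNr.
  apply: smoothD => //; first exact: smooth_cst.
  apply: smoothM => //; first exact: smooth_cst.
  by case: (l == k); [exact: smooth_cst|exact: smooth_coord].
exists [set z | dom (pchart C c I i s) z /\ t * direction c z 0 j < s * direction c z 0 i].
exists [set z | dom (pchart C c I j t) z /\ s * direction c z 0 i < t * direction c z 0 j].
split; [exact: key|exact: key| | |].
- by split=> //; apply: le_lt_trans dx _; case: ex.
- by split=> //; apply: le_lt_trans dy _; case: ey.
- by apply/seteqP; split=> // z [[_ /lt_trans H] [_ /H]]; rewrite ltxx.
Qed.

End Blowup.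

(** * Transport along diffeomorphisms *)


Section FiniteComponents.
Variable T : topologicalType.
Implicit Types (A B : set T).

Definition few_components A := finite_set [set K | exists2 x, A x & K = connected_component A x].

(** Finitely many connected subsets that cover A suffice, a form that passes to continuous
    images. *)
Lemma few_componentsP A : few_components A <->
  exists s : seq (set T), (forall K, K \in s -> connected K /\ K `<=` A) /\
    (forall x, A x -> exists2 K, K \in s & K x).
Proof.
split=> [/finite_seqP[s sE]|[s [s1 s2]]].
  exists s; split=> [K Ks|x Ax].
    have : [set` s] K by [].
    rewrite -sE => -[x Ax ->]; split; first exact: component_connected.
    exact: connected_component_sub.
  exists (connected_component A x); last exact: connected_component_refl.
  have : [set` s] (connected_component A x) by rewrite -sE; exists x.
  by [].
have fin : finite_set [set K | exists2 S, S \in s & exists2 x, S x & K = connected_component A x].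
  have sub (S : set T) : S \in s -> finite_set [set K | exists2 x, S x & K = connected_component A x].
    move=> Ss; have [cS SA] := s1 S Ss.
    have [[x0 Sx0]|S0] := pselect (S !=set0); last first.
      rewrite [X in finite_set X](_ : _ = set0) //; apply/seteqP; split=> // K [x Sx _].
      by apply: S0; exists x.
    apply: (@sub_finite_set _ _ [set connected_component A x0]); last exact: finite_set1.
    move=> K [x Sx ->] /=; apply: same_connected_component.
    exact: (connected_component_max Sx SA cS).
  rewrite [X in finite_set X](_ : _ = \bigcup_(S in [set` s])
    [set K | exists2 x, S x & K = connected_component A x]).
    by apply: bigcup_finite => // S.
  by apply/seteqP; split=> K [S Ss H]; exists S.
apply: sub_finite_set fin => K [x Ax ->]; have [S Ss Sx] := s2 x Ax.
by exists S => //; exists x.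
Qed.

End FiniteComponents.

Section Transport.
Variables (R : realType) (n : nat) (N N' : charted_space R n).
Hypotheses (gN : good N) (gN' : good N').
Variables (f : N -> N') (g : N' -> N).
Hypotheses (fg : cancel f g) (gf : cancel g f) (sf : smooth_map f) (sg : smooth_map g).

Let cf : continuous f. Proof. exact: smooth_map_continuous. Qed.
Let cg : continuous g. Proof. exact: smooth_map_continuous. Qed.

Definition transport_chart (c : chart R n N) : chart R n N' :=
  Chart [set q | dom c (g q)] (fun q => crd c (g q)) (bdry c).

Lemma transport_mchart c : mchart c -> mchart (transport_chart c).
Proof.
move=> mc; have [[p1 p2 p3] _] := mc; split.
  split=> [p q cp cq /p1 E|p|p cp].
  - by apply: (can_inj gf); exact: E.
  - exact: p2.
  - have [r r0 rH] := p3 _ cp; exists r => // z zr zB.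
    by have [q cq qE] := rH z zr zB; exists (f q); rewrite /= fg.
move=> d ad; have md : mchart d by case: gN' => + _; apply.
split=> q.
  move=> cq dq; have [|F [U [oU Ux sF HF]]] := sf mc md cq; first by rewrite gf.
  exists F; exists U; split=> // q' cq' Uq'.
  by have := HF (g q') cq' Uq'; rewrite gf.
by move=> dq cq; exact: (sg md mc dq cq).
Qed.

Lemma transport_vanishing c I C : vanishing c I C -> vanishing (transport_chart c) I (f @` C).
Proof. by move=> vc q cq; rewrite (image_cancel _ fg gf); exact: vc. Qed.

Lemma transport_over c : over c (transport_chart c) id f.
Proof.
split=> // [x cx|w _ [q cq qE]]; first by rewrite /= fg.
by exists (g q).
Qed.

Lemma transport_closed C : closed C -> closed (f @` C).
Proof.
move=> clC; rewrite (image_cancel _ fg gf); apply: closed_comp => // q _; exact: cg.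
Qed.

Lemma transport_few C : few_components C -> few_components (f @` C).
Proof.
move=> /few_componentsP[s [s1 s2]]; apply/few_componentsP.
exists [seq f @` K | K <- s]; split=> [_ /mapP[K Ks ->]|_ [x Cx <-]].
  have [cK KC] := s1 K Ks; split; last exact: image_subset.
  by apply: connected_continuous_connected => //; apply: continuous_subspaceT.
have [K Ks Kx] := s2 x Cx; exists (f @` K); last by exists x.
exact: map_f.
Qed.

Lemma transport_adapted p c : adapted p c -> adapted (f p) (transport_chart c).
Proof.
move=> [mc cp c0 [e e0 im]]; split; [exact: transport_mchart|by rewrite /= fg|by rewrite /= fg|].
exists e => //; rewrite -im; apply/seteqP; split=> [_ [q cq <-]|_ [q cq <-]].
  by exists (g q).
by exists (f q); rewrite /= fg.
Qed.

Lemma transport_p_submanifold C : p_submanifold C -> p_submanifold (f @` C).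
Proof.
move=> [k [clC fC H]]; exists k; split.
- exact: transport_closed.
- exact: transport_few.
- move=> _ [p Cp <-]; have [c [I [ac vc cI]]] := H p Cp.
  exists (transport_chart c), I; split=> //; first exact: transport_adapted.
  exact: transport_vanishing.
Qed.

Lemma transport_closure A : closure (f @` A) = f @` closure A.
Proof. exact: homeo_closure fg gf cf cg. Qed.

Lemma image_inj (A B : set N) : f @` A `<=` f @` B <-> A `<=` B.
Proof.
split=> [H x Ax|]; last exact: image_subset.
by have [|y By /(can_inj fg) <-] := H (f x); first by exists x.
Qed.

Lemma image_setD (A B : set N) : f @` (A `\` B) = f @` A `\` f @` B.
Proof. by rewrite !(image_cancel _ fg gf). Qed.

Lemma transport_liftable C Q : liftable C Q -> liftable (f @` C) (f @` Q).
Proof.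
move=> [clQ H]; split; first exact: transport_closed.
case: H => H; [left|right]; first exact/image_inj.
by rewrite -image_setD transport_closure; apply/image_inj.
Qed.

Hypotheses (hN : hausdorff_space (pt N)) (hN' : hausdorff_space (pt N')).
Variable C : set N.
Hypotheses (clC : closed C) (lC : locally_coords C).
Let C' := f @` C.
Let clC' : closed C'. Proof. exact: transport_closed. Qed.

Lemma transport_coords c I : coords C c I -> coords C' (transport_chart c) I.
Proof. by move=> [mc vc]; split; [exact: transport_mchart|exact: transport_vanishing]. Qed.

Let lC' : locally_coords C'.
Proof.
move=> _ [p Cp <-]; have [c [I [cp cI]]] := lC Cp.
by exists (transport_chart c), I; split; [rewrite /= fg|exact: transport_coords].
Qed.

(** A chart and its transport give projective charts with the same coordinate expression of the
    blow-down, so [glue] applies. *)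
Lemma transport_blowup : exists h : blowup C -> blowup C',
  diffeomorphism h /\ forall x, blowdown C' (h x) = f (blowdown C x).
Proof.
have gB := blowup_good gN clC lC; have gB' := blowup_good gN' clC' lC'.
have nC' p : ~ C' (f p) <-> ~ C p.
  by rewrite /C' (image_cancel _ fg gf) /= fg.
have mkc c x : mchart c -> dom c (blowdown C x) -> ~ C (blowdown C x) ->
    exists c', [/\ mchart c', dom c' (blowdown C x) & forall q, dom c' q -> ~ C q].
  move=> mc cx nC.
  have nb : nbhs (blowdown C x) (~` C).
    by apply: open_nbhs_nbhs; split=> //; exact: closed_openC.
  have [c' [[mc' cx' _ _] sub _ _]] := adapted_shift gN mc cx nb.
  by exists c'; split=> // q /sub[].
have mp c I i s : coords C c I -> i \in I -> sign s -> valid c i s ->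
    matched (f \o blowdown C) (blowdown C') (pchart C c I i s)
      (pchart C' (transport_chart c) I i s).
  move=> cI iI ss vs; have cI' := transport_coords cI.
  apply: (matched_over id (c := transport_chart c) (phi := id \o blow I i s)).
  - exact: pchart_mchart.
  - exact: pchart_mchart.
  - by case: cI'.
  - by [].
  - apply: over_comp (transport_over c); exact: over_pchart.
  - exact: over_pchart.
have mcc c : mchart c -> (forall q, dom c q -> ~ C q) ->
    matched (f \o blowdown C) (blowdown C') (cchart C c) (cchart C' (transport_chart c)).
  move=> mc nCc; apply: (matched_over id (c := transport_chart c) (phi := id \o id)).
  - exact: cchart_mchart.
  - by apply: cchart_mchart => //; exact: transport_mchart.
  - exact: transport_mchart.
  - by [].
  - apply: over_comp (transport_over c); exact: over_cchart.
  - apply: over_cchart => q cq [p Cp pq]; apply: (nCc (g q)) => //.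
    by rewrite -pq fg.
apply: (@glue R n N' (~` C') _ _ (f \o blowdown C) (blowdown C')) => //.
- exact: blowup_hausdorff.
- exact: blowup_hausdorff.
- move=> x; have -> : (f \o blowdown C) @^-1` (~` C') = blowdown C @^-1` (~` C).
    by apply/seteqP; split=> y /nC'.
  exact: dense_out.
- exact: dense_out.
- move=> x x' /nC' nCx /(can_inj fg) E; exact: blowdown_inj.
- by move=> y y' ny E; exact: blowdown_inj.
- move=> x; have [Cx|nCx] := pselect (C (blowdown C x)).
    have [c [I [cx cI]]] := lC Cx.
    have [i [s [iI ss vs ex]]] := pchart_cover gN cI cx.
    by exists (pchart C c I i s), (pchart C' (transport_chart c) I i s); split=> //; exact: mp.
  have [c mc cx] := mchart_cover gN (blowdown C x).
  have [c' [mc' cx' nc']] := mkc c x mc cx nCx.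
  by exists (cchart C c'), (cchart C' (transport_chart c')); split=> //; exact: mcc.
- move=> y; have [Cy|nCy] := pselect (C' (blowdown C' y)).
    have [p Cp py] := Cy.
    have [c [I [cp cI]]] := lC Cp.
    have cy : dom (transport_chart c) (blowdown C' y) by rewrite /= -py fg.
    have [i [s [iI ss vs ex]]] := pchart_cover gN' (transport_coords cI) cy.
    by exists (pchart C c I i s), (pchart C' (transport_chart c) I i s); split=> //; exact: mp.
  have [c mc cy] := mchart_cover gN (g (blowdown C' y)).
  have nCg : ~ C (g (blowdown C' y)) by apply/nC'; rewrite gf.
  have [x xE] := blowdown_out nCg.
  have cx : dom c (blowdown C x) by rewrite xE.
  have nCx : ~ C (blowdown C x) by rewrite xE.
  have [c' [mc' cx' nc']] := mkc c x mc cx nCx.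
  exists (cchart C c'), (cchart C' (transport_chart c')); split; last exact: mcc.
  by split=> //=; rewrite -xE.
Qed.

Lemma transport_lift (h : blowup C -> blowup C') Q : diffeomorphism h ->
  (forall x, blowdown C' (h x) = f (blowdown C x)) -> lift C' (f @` Q) = h @` lift C Q.
Proof.
move=> [k [hk kh sh sk]] hb; rewrite /lift.
have gB := blowup_good gN clC lC; have gB' := blowup_good gN' clC' lC'.
have pre A : blowdown C' @^-1` (f @` A) = h @` (blowdown C @^-1` A).
  rewrite (image_cancel _ hk kh) (image_cancel _ fg gf).
  have E y : g (blowdown C' y) = blowdown C (k y) by rewrite -{1}(kh y) hb fg.
  by apply/seteqP; split=> y; rewrite /= E.
have -> : `[< f @` Q `<=` C' >] = `[< Q `<=` C >].
  by apply: asbool_equiv_eq; exact: image_inj.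
case: asboolP => _; first exact: pre.
rewrite -image_setD pre; apply: homeo_closure hk kh _ _.
  exact: smooth_map_continuous.
exact: smooth_map_continuous.
Qed.

End Transport.

Lemma p_submanifold_coords (R : realType) n (N : charted_space R n) (C : set N) :
  p_submanifold C -> closed C /\ locally_coords C.
Proof.
move=> [k [clC _ H]]; split=> // p Cp; have [c [I [[mc cp _ _] vc _]]] := H p Cp.
by exists c, I.
Qed.

Section ResolutionTransport.
Variables (R : realType) (n : nat) (M : charted_space R n).

Definition same_resolution (r1 r2 : {N : charted_space R n & N -> M}) : Prop :=
  exists h : projT1 r1 -> projT1 r2, diffeomorphism h /\
    forall x, projT2 r2 (h x) = projT2 r1 x.

Definition nice (N : charted_space R n) := good N /\ hausdorff_space (pt N).

Lemma nice_blowup (N : charted_space R n) (C : set N) : nice N -> p_submanifold C ->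
  nice (blowup C).
Proof.
move=> [gN hN] /p_submanifold_coords[clC lC]; split; first exact: blowup_good.
exact: blowup_hausdorff.
Qed.

(** A diffeomorphism that matches the lifts propagates through all further blow-ups. It carries a
    swap of the first two centres through the rest of a resolution. *)
Lemma resolution_transport (s : seq (set M)) (N N' : charted_space R n) (b : N -> M)
    (b' : N' -> M) (L : set M -> set N) (L' : set M -> set N') (f : N -> N') :
  nice N -> nice N' -> diffeomorphism f -> (forall x, b' (f x) = b x) ->
  (forall Q, Q \in s -> L' Q = f @` L Q) -> permissible_from L s ->
  permissible_from L' s /\ same_resolution (resolution_from b L s) (resolution_from b' L' s).
Proof.
elim: s N N' b b' L L' f => [|C s IH] N N' b b' L L' f nN nN' df bf LL /=.
  by move=> _; split=> //; exists f.
have [g [fg gf sf sg]] := df; have [[gN hN] [gN' hN']] := (nN, nN').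
move=> [pC lQ per]; have LC : L' C = f @` L C by apply: LL; rewrite mem_head.
have pC' : p_submanifold (L' C) by rewrite LC; exact: (transport_p_submanifold gN gN' fg gf sf sg).
have [clC lC] := p_submanifold_coords pC.
have [h [dh hb]] := transport_blowup gN gN' fg gf sf sg hN hN' clC lC.
have LL' Q : Q \in s -> L' Q = f @` L Q by move=> Qs; apply: LL; rewrite in_cons Qs orbT.
have [||||||per' iso] := IH _ _ (fun x => b (blowdown (L C) x))
   (fun x => b' (blowdown (f @` L C) x)) (fun Q => lift (L C) (L Q))
   (fun Q => lift (f @` L C) (L' Q)) h.
- exact: nice_blowup.
- by apply: nice_blowup => //; rewrite -LC.
- exact: dh.
- by move=> x; rewrite hb bf.
- move=> Q Qs; rewrite LL'//.
  exact: (transport_lift gN gN' fg gf sf sg).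
- exact: per.
split; last by rewrite LC.
split=> //; last by rewrite LC.
by move=> Q Qs; rewrite (LL' Q Qs) LC; apply: (transport_liftable gN gN' fg gf sf sg); exact: lQ.
Qed.

End ResolutionTransport.

(** * Linear subspaces in adapted coordinates *)



Section Subspaces.
Variables (R : realType) (n : nat).
Implicit Types (V W : 'M[R]_n) (I J S B : {set 'I_n}) (z u : 'rV[R]_n).

(** As a row space, the span of the e_j with j in I; so {z_I = 0} is [sel (~: I)]. *)
Definition sel I : 'M[R]_n := \matrix_(i, j) (if (i == j) && (j \in I) then 1 else 0).

Lemma mul_sel I m (M : 'M[R]_(m, n)) i j : (M *m sel I) i j = if j \in I then M i j else 0.
Proof.
rewrite mxE (bigD1 j)//= big1 ?addr0 => [|k kj]; last by rewrite mxE (negPf kj) mulr0.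
by rewrite mxE eqxx /=; case: (j \in I); rewrite ?mulr1 ?mulr0.
Qed.

Lemma sub_selP I z : (z <= sel I)%MS <-> forall j, j \notin I -> z 0 j = 0.
Proof.
split=> [/submxP[D ->] j jI|H]; first by rewrite mul_sel (negPf jI).
apply/submxP; exists z; apply/rowP => j; rewrite mul_sel.
by case: ifPn => // /H.
Qed.

Lemma rank_sel_le I : (\rank (sel I) <= #|I|)%N.
Proof.
have -> : sel I = colsub (fun k : 'I_#|I| => enum_val k) (sel I) *m
    rowsub (fun k : 'I_#|I| => enum_val k) (1%:M : 'M[R]_n).
  apply/matrixP => i j; rewrite !mxE.
  case jI: (j \in I); last first.
    rewrite andbF big1 // => k _; rewrite !mxE.
    case: (enum_val k =P j) => [E|]; last by rewrite mulr0.
    by move: (enum_valP k); rewrite E jI.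
  rewrite andbT (bigD1 (enum_rank_in jI j))//= big1 => [|k kj].
    by rewrite addr0 !mxE enum_rankK_in// eqxx jI andbT mulr1.
  rewrite !mxE; case: (enum_val k =P j) => [E|]; last by rewrite mulr0.
  by case/negP: kj; apply/eqP/enum_val_inj; rewrite enum_rankK_in.
exact: mulmx_max_rank.
Qed.

Lemma rank_sel I : \rank (sel I) = #|I|.
Proof.
apply/eqP; rewrite eqn_leq rank_sel_le /=.
have E : 1%:M = sel I + sel (~: I).
  apply/matrixP => i j; rewrite !mxE inE.
  by case: (j \in I); rewrite /= ?andbT ?andbF ?addr0 ?add0r; case: eqP.
have := mxrank_add (sel I) (sel (~: I)); rewrite -E mxrank1.
move=> H; have {H} := leq_trans H (leq_add (leqnn _) (rank_sel_le (~: I))).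
have := cardsC I; rewrite card_ord => E2.
by rewrite -[X in (X <= _)%N -> _]E2 leq_add2r.
Qed.

(** Compatibility with the boundary: V is the sum of the boundary axes it contains and of a space on
    which the boundary coordinates vanish. *)
Definition splits B V := forall j z, j \in B -> (z <= V)%MS -> (z 0 j *: ('e_j : 'rV[R]_n) <= V)%MS.

(** In other words V is cut out by equations in the coordinates of S alone. *)
Definition supported S V := forall j, j \notin S -> (('e_j : 'rV[R]_n) <= V)%MS.

Lemma supported_sub S V z : supported S V -> (forall j, j \in S -> z 0 j = 0) -> (z <= V)%MS.
Proof.
move=> sV zS; rewrite (row_sum_delta z); apply: summx_sub => j _.
have [jS|jS] := boolP (j \in S); first by rewrite zS// scale0r sub0mx.
exact/scalemx_sub/sV.
Qed.

Lemma supported_part S V J z : supported S V -> S \subset J -> (z <= V)%MS -> (part J z <= V)%MS.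
Proof.
move=> sV /fintype.subsetP SJ zV; have -> : part J z = z - (z - part J z) by rewrite subKr.
apply: addmx_sub => //; rewrite (eqmx_opp _); apply: (supported_sub sV) => j jS.
by rewrite !mxE SJ// subrr.
Qed.

(** Exchange argument: a maximal set I of coordinate axes independent of V spans a complement. *)
Lemma complement_coords V : exists I, (sel I :&: V = 0)%MS /\ (1%:M <= sel I + V)%MS.
Proof.
pose P I := (sel I :&: V)%MS == 0 :> 'M[R]_n.
have P0 : P finset.set0.
  rewrite /P -submx0; apply: submx_trans (capmxSl _ _) _; rewrite submx0.
  by apply/eqP/matrixP => i j; rewrite !mxE inE andbF.
have [I IP Imax] := arg_maxnP (fun I : {set 'I_n} => #|I|) P0.
exists I; split; first exact/eqP.
apply/row_subP => k; rewrite row1.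
have [kI|kI] := boolP (k \in I).
  apply: submx_trans (addsmxSl _ _); apply/sub_selP => j jI.
  by rewrite mxE eqxx /=; case: eqP => // E; move: jI; rewrite E kI.
have NP : ~~ P (k |: I).
  apply/negP => /Imax /=; rewrite cardsU1 kI /=; lia.
apply: contraT => H; case/negP: NP; apply/rowV0P => z; rewrite sub_capmx => /andP[zs zV].
have {}zs := (sub_selP _ _).1 zs.
have [zk|zk] := eqVneq (z 0 k) 0.
  have/eqP IP0 := IP; apply/eqP; rewrite -submx0 -IP0 sub_capmx zV andbT; apply/sub_selP => j jI.
  have [->//|jk] := eqVneq j k; by apply: zs; rewrite !inE negb_or jk.
case/negP: H; have -> : delta_mx 0 k = (z 0 k)^-1 *: (- part I z + z).
  apply/rowP => j; rewrite !mxE eqxx /=; case: (eqVneq j k) => [->|jk].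
    by rewrite (negPf kI) oppr0 add0r mulVf.
  case: ifPn => jI; first by rewrite addNr mulr0.
  have zj : z 0 j = 0 by apply: zs; rewrite !inE negb_or jk.
  by rewrite zj oppr0 add0r mulr0.
apply: scalemx_sub; apply: addmx_sub_adds => //; rewrite (eqmx_opp _).
by apply/sub_selP => j jI; rewrite mxE (negPf jI).
Qed.

End Subspaces.

Section Flat.
Variables (R : realType) (n : nat) (N : charted_space R n).
Hypothesis gN : good N.
Implicit Types (p q : N) (c d : chart R n N) (X Y : set N).
Implicit Types (V W : 'M[R]_n) (I J S : {set 'I_n}) (z u : 'rV[R]_n).

Definition flat c V X := forall q, dom c q -> (X q <-> (crd c q <= V)%MS).

Lemma vanishing_flat c I X : vanishing c I X <-> flat c (sel R (~: I)) X.
Proof.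
have H z : (forall i, i \in I -> z 0 i = 0) <-> (z <= sel R (~: I))%MS.
  split=> [zI|zS i iI]; first by apply/sub_selP => j; rewrite inE negbK; exact: zI.
  by move/sub_selP: zS => -> //; rewrite inE negbK.
by split=> H' q cq; split=> [/(H' q cq) /H|/H /(H' q cq)].
Qed.

Lemma adapted_face p c : adapted p c -> face c p = bdry c.
Proof.
by move=> [_ _ c0 _]; apply/finset.setP => i; rewrite inE c0 mxE eqxx andbT.
Qed.

Lemma adapted_point p c A z : adapted p c -> nbhs p A -> corner (bdry c) z ->
  exists2 t : R, 0 < t & exists q, [/\ dom c q, A q & crd c q = t *: z].
Proof.
move=> [mc cp c0 [e e0 cE]] nA zB.
have [r r0 rA] := (nbhs_chart gN A mc cp).1 nA.
have z1 : 0 < 1 + `|z| by rewrite ltr_pwDl.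
pose t := Num.min e r / 2 / (1 + `|z|).
have m0 : 0 < Num.min e r by rewrite lt_min e0 r0.
have t0 : 0 < t by rewrite !divr_gt0.
have tz i : `|(t *: z) 0 i| < Num.min e r.
  rewrite mxE normrM (gtr0_norm t0) /t mulrAC ltr_pdivrMr//.
  have : `|z 0 i| <= `|z| by exact: coord_le_norm.
  have := normr_ge0 z; move: m0; set m := Num.min e r; nra.
have : [set z | corner (bdry c) z /\ forall i, `|z 0 i| < e] (t *: z).
  split=> [i iB|i]; first by rewrite mxE mulr_ge0 ?zB// ltW.
  by apply: lt_le_trans (tz i) _; rewrite ge_min lexx.
rewrite -cE => -[q cq Eq]; exists t => //; exists q; split => //.
apply: rA => //; rewrite c0 Eq; apply/ball_rowP => // i.
by rewrite [X in X - _]mxE sub0r normrN; apply: lt_le_trans (tz i) _; rewrite ge_min lexx orbT.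
Qed.

(** Only corner vectors are coordinates of points, but when V splits, each of its vectors is a
    difference of two corner vectors in V. *)
Lemma flat_sub p c V W X Y : adapted p c -> splits (bdry c) V -> flat c V X -> flat c W Y ->
  nbhs p [set q | X q -> Y q] -> (V <= W)%MS.
Proof.
move=> ac sV fV fW nXY.
have key z : (z <= V)%MS -> corner (bdry c) z -> (z <= W)%MS.
  move=> zV zB; have [t t0 [q [cq XY E]]] := adapted_point ac nXY zB.
  have : (crd c q <= W)%MS.
    by apply/fW => //; apply: XY; apply/fV => //; rewrite E scalemx_sub.
  by rewrite E => /(scalemx_sub t^-1); rewrite scalerA mulVf ?gt_eqF// scale1r.
apply/row_subP => k; set z := row k V; have zV : (z <= V)%MS by exact: row_sub.
(* Both a and z + a lie in the corner, and a lies in V because V splits. *)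
pose a : 'rV[R]_n := \sum_(j in bdry c) `|z 0 j| *: 'e_j.
have aE j : a 0 j = if j \in bdry c then `|z 0 j| else 0.
  rewrite /a summxE; case: ifPn => jB.
    rewrite (bigD1 j)//= big1 ?addr0 => [|i /andP[_ ij]]; first by rewrite !mxE !eqxx mulr1.
    by rewrite !mxE eqxx /= eq_sym (negPf ij) mulr0.
  rewrite big1 // => i iB; rewrite !mxE eqxx /=; case: eqP => [E|]; last by rewrite mulr0.
  by move: jB; rewrite E iB.
have aV : (a <= V)%MS.
  apply: summx_sub => j jB; have := sV j z jB zV; case: (ger0P (z 0 j)) => // _.
  by rewrite scaleNr (eqmx_opp _).
have -> : z = (z + a) - a by rewrite addrK.
apply: addmx_sub; last rewrite (eqmx_opp _); apply: key => //.
- exact: addmx_sub.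
- by move=> j jB; rewrite mxE aE jB -lerBlDl sub0r -normrN ler_norm.
- by move=> j jB; rewrite aE jB.
Qed.

(** On the coordinates in I it is the projection along V onto their span; the others are kept. So V
    becomes the common zero set of the coordinates in I. *)
Definition straightening I V : 'M[R]_n := proj_mx (sel R I) V + sel R (~: I).

Section Straighten.
Variables (I B : {set 'I_n}) (V : 'M[R]_n).
Hypotheses (IV : (sel R I :&: V = 0)%MS) (fV : (1%:M <= sel R I + V)%MS) (sV : splits B V).
Local Notation T := (straightening I V).

Let a z := z *m proj_mx (sel R I) V.

Lemma proj_off z j : j \notin I -> a z 0 j = 0.
Proof. by have /sub_selP := proj_mx_sub (sel R I) V z; apply. Qed.

Lemma straightenE z i : (z *m T) 0 i = if i \in I then a z 0 i else z 0 i.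
Proof.
rewrite mulmxDr [LHS]mxE mul_sel inE -/(a z); have [iI|iI] := boolP (i \in I); first by rewrite addr0.
by rewrite proj_off ?add0r.
Qed.

Lemma straighten_compl z : (z - a z <= V)%MS.
Proof. by apply: proj_mx_compl_sub; apply: submx_trans fV; exact: submx1. Qed.

Lemma straighten0 z : a z = 0 <-> (z <= V)%MS.
Proof.
split=> [E|zV]; last exact: proj_mx_0.
by rewrite -[z]subr0 -E straighten_compl.
Qed.

Lemma straighten_vanish z : (z <= V)%MS <-> forall i, i \in I -> (z *m T) 0 i = 0.
Proof.
split=> [/straighten0 E i iI|H]; first by rewrite straightenE iI E mxE.
apply/straighten0/rowP => j; rewrite [RHS]mxE.
have [jI|jI] := boolP (j \in I); last exact: proj_off.
by rewrite -(H j jI) straightenE jI.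
Qed.

Lemma straighten_unit : T \in unitmx.
Proof.
rewrite -row_free_unit -kermx_eq0; apply/rowV0P => z /sub_kermxP E.
have zV : (z <= V)%MS by apply/straighten_vanish => i _; rewrite E mxE.
apply/eqP; rewrite -submx0 -IV sub_capmx zV andbT; apply/sub_selP => j jI.
by have := straightenE z j; rewrite (negPf jI) E mxE.
Qed.

Lemma straighten_bdry_off j : j \in B -> j \notin I -> (('e_j : 'rV[R]_n) <= V)%MS.
Proof.
move=> jB jI; pose e : 'rV[R]_n := 'e_j; have := sV jB (straighten_compl e).
by rewrite [X in X *: _]mxE [X in _ + X]mxE proj_off// subr0 mxE !eqxx scale1r.
Qed.

Lemma straighten_bdry_in j z : j \in B -> j \in I -> (z <= V)%MS -> z 0 j = 0.
Proof.
move=> jB jI /(sV jB) H; apply/eqP; case: eqP => // /eqP z0.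
have : ((z 0 j *: 'e_j : 'rV[R]_n) <= sel R I :&: V)%MS.
  rewrite sub_capmx H andbT; apply/sub_selP => k kI; rewrite !mxE eqxx /=.
  by case: eqP => [E|]; [move: kI; rewrite E jI|rewrite mulr0].
rewrite IV submx0 => /eqP/rowP/(_ j); rewrite !mxE !eqxx mulr1 => E.
by rewrite E eqxx in z0.
Qed.

(** If j is in I, the axis e_j is not in V, so V has zero j-coordinate and the projection does not
    alter it. Hence an adapted chart stays adapted. *)
Lemma straighten_bdry z j : j \in B -> (z *m T) 0 j = z 0 j.
Proof.
move=> jB; rewrite straightenE; case: ifPn => // jI.
have := straighten_bdry_in jB jI (straighten_compl z).
by rewrite mxE [X in _ + X]mxE => /eqP; rewrite subr_eq0 => /eqP.
Qed.

Lemma straighten_sub S : supported S V -> I \subset S.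
Proof.
move=> sS; apply/fintype.subsetP => i iI; apply: contraT => /sS H.
have : (('e_i : 'rV[R]_n) <= sel R I :&: V)%MS.
  rewrite sub_capmx H andbT; apply/sub_selP => k kI; rewrite !mxE eqxx /=.
  by case: eqP => // E; move: kI; rewrite E iI.
by rewrite IV submx0 => /eqP/rowP/(_ i); rewrite !mxE !eqxx => /eqP; rewrite oner_eq0.
Qed.

Lemma straighten_rank : (#|I| + \rank V = n)%N.
Proof.
have := mxrank_sum_cap (sel R I) V; rewrite IV mxrank0 addn0 rank_sel => <-.
by apply/eqP; rewrite eqn_leq rank_leq_col /= -{1}(mxrank1 R n) mxrankS.
Qed.

Lemma straighten_fix j : (('e_j : 'rV[R]_n) <= V)%MS -> j \notin I -> 'e_j *m T = 'e_j :> 'rV[R]_n.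
Proof.
move=> jV jI; apply/rowP => k; rewrite straightenE; case: ifPn => // kI.
rewrite (straighten0 _).2// !mxE eqxx /=.
by case: eqP => // E; move: jI; rewrite -E kI.
Qed.

Lemma straighten_fixI j : j \in I -> 'e_j *m T = 'e_j :> 'rV[R]_n.
Proof.
move=> jI; apply/rowP => k; rewrite straightenE; case: ifPn => // kI.
congr (_ _ _ _); apply: proj_mx_id => //.
apply/sub_selP => i iI; rewrite !mxE eqxx /=.
by case: eqP => // E; move: iI; rewrite E jI.
Qed.

Lemma straighten_splits W : splits B W -> splits B (W *m T).
Proof.
move=> sW j z jB /submxP[D E]; pose y := D *m W.
have zE : z = y *m T by rewrite E mulmxA.
have yW : (y <= W)%MS by exact: submxMl.
have -> : z 0 j *: 'e_j = (y 0 j *: 'e_j) *m T :> 'rV[R]_n.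
  rewrite zE straighten_bdry// -scalemxAl; congr (_ *: (_ : 'rV[R]_n)).
  have [jI|jI] := boolP (j \in I); first by rewrite straighten_fixI.
  by rewrite straighten_fix// straighten_bdry_off.
exact/submxMr/sW.
Qed.

Lemma straighten_supported W : (V <= W)%MS -> supported I (W *m T).
Proof.
move=> VW j jI; have -> : 'e_j = ('e_j *m invmx T) *m T :> 'rV[R]_n.
  by rewrite mulmxKV// straighten_unit.
apply/submxMr; apply: submx_trans VW; apply/straighten_vanish => i iI.
rewrite mulmxKV ?straighten_unit// mxE eqxx /=.
by case: eqP => // E; move: jI; rewrite -E iI.
Qed.

(** This keeps the coordinate form {z_K = 0} of another submanifold. If S avoids K, so does I, and
    these coordinates are untouched. If S is inside K, vectors on either side lie in V, which meets
    the span of I only in 0. *)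
Lemma straighten_keep S (K : {set 'I_n}) z : supported S V -> S \subset K \/ (forall i, i \in S -> i \notin K) ->
  (forall i, i \in K -> z 0 i = 0) <-> (forall i, i \in K -> (z *m T) 0 i = 0).
Proof.
move=> sS; have IS := straighten_sub sS; case=> [SK|SK]; last first.
  have IK i : i \in K -> i \notin I.
    by move=> iK; apply: contraL iK => /(fintype.subsetP IS); exact: SK.
  by split=> H i iK; have := H i iK; rewrite straightenE (negPf (IK i iK)).
have IK := fintype.subset_trans IS SK; split=> H i iK.
  rewrite straightenE H//; case: ifP => // _.
  rewrite (straighten0 _).2 ?mxE//; apply: (supported_sub sS) => j /(fintype.subsetP SK).
  exact: H.
have zV : (z <= V)%MS.
  by apply/straighten_vanish => j /(fintype.subsetP IK); exact: H.
have zI j : j \in K -> j \notin I -> z 0 j = 0.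
  by move=> jK jI; rewrite -(H j jK) straightenE (negPf jI).
have [iI|] := boolP (i \in I); last exact: zI.
have : (part I z <= sel R I :&: V)%MS.
  rewrite sub_capmx; apply/andP; split.
    by apply/sub_selP => j jI; rewrite mxE (negPf jI).
  have -> : part I z = z - (z - part I z) by rewrite subKr.
  apply: addmx_sub => //; rewrite (eqmx_opp _); apply: (supported_sub sS) => j jS.
  rewrite !mxE; case: ifPn => jI; first by rewrite subrr.
  by rewrite zI ?subr0// (fintype.subsetP SK).
by rewrite IV submx0 => /eqP/rowP/(_ i); rewrite !mxE iI.
Qed.

End Straighten.

(** X becomes a coordinate submanifold while the other flat sets stay flat. The last clauses serve
    the crossing arguments: I uses only equations of V, a second coordinate submanifold survives,
    and sets containing X get equations in I alone. *)
Lemma straighten p c V X A : adapted p c -> flat c V X -> splits (bdry c) V -> nbhs p A ->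
  exists (I : {set 'I_n}) c', [/\ adapted p c', dom c' `<=` dom c `&` A /\ bdry c' = bdry c,
    vanishing c' I X, (#|I| + \rank V = n)%N & [/\
    forall S, supported S V -> I \subset S,
    forall S (K : {set 'I_n}) Z, supported S V -> S \subset K \/ (forall i, i \in S -> i \notin K) ->
      vanishing c K Z -> vanishing c' K Z &
    forall Y W, flat c W Y -> splits (bdry c) W ->
      exists W', [/\ flat c' W' Y, splits (bdry c') W', \rank W' = \rank W &
        ((V <= W)%MS -> supported I W')]]].
Proof.
move=> ac fX sV nA; have [mc cp c0 _] := ac.
have [I [IV fI]] := complement_coords V; pose T := straightening I V.
have uT : T \in unitmx := straighten_unit IV fI.
have [|c' [ac' dc' bc' cE]] := @adapted_chart _ _ _ gN c p T A mc cp uT _ nA.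
  by rewrite (adapted_face ac) => i z iB; exact: (straighten_bdry IV fI sV).
rewrite (adapted_face ac) in bc'.
have {}cE q : dom c' q -> crd c' q = crd c q *m T by move=> /cE ->; rewrite c0 subr0.
have dc q : dom c' q -> dom c q by move=> /dc'[].
exists I, c'; split=> //.
- move=> q cq; rewrite fX ?cE//; last exact: dc.
  exact: straighten_vanish.
- exact: straighten_rank.
split.
- by move=> S; exact: straighten_sub.
- move=> S K Z sS SK vZ q cq; rewrite vZ ?cE//; last exact: dc.
  exact: (straighten_keep IV fI _ sS SK).
move=> Y W fY sW; exists (W *m T); split.
- move=> q cq; rewrite fY ?cE//; last exact: dc.
  split=> H; first exact: submxMr.
  by have := submxMr (invmx T) H; rewrite !mulmxK.
- by rewrite bc'; exact: straighten_splits.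
- by rewrite mxrankMfree// row_free_unit.
- exact: straighten_supported.
Qed.

(** The derivative of a transition map is invertible and sends {u_I = 0} into {u_J = 0}. Comparing
    ranks gives one inequality, exchanging the charts the other. *)
Lemma vanishing_card c I d J X p : mchart c -> mchart d -> dom c p -> dom d p -> X p ->
  vanishing c I X -> vanishing d J X -> #|I| = #|J|.
Proof.
suff H c' I' d' J' : mchart c' -> mchart d' -> dom c' p -> dom d' p -> X p ->
    vanishing c' I' X -> vanishing d' J' X -> (#|J'| <= #|I'|)%N.
  by move=> mc md cp dp Xp vc vd; apply/eqP; rewrite eqn_leq !(H c I d J, H d J c I).
move=> mc md cp dp Xp vc vd.
have [F rF] := mchart_compat gN mc md cp dp.
have [G rG] := mchart_compat gN md mc dp cp.
have dF := represents_differentiable rF; have dG := represents_differentiable rG.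
have [_ E] := represents_value cp rF.
have DE u : ('D_u F (crd c' p)) *m jacobian G (crd d' p) = u.
  rewrite E -deriveEjacobian -?E// E -derive_comp_rows -?E//.
  rewrite (represents_derive_unique _ mc cp (represents_comp cp rF rG) (represents_id _ _)).
  exact: derive_id.
have JG : jacobian F (crd c' p) *m jacobian G (crd d' p) = 1%:M.
  apply/row_matrixP => i; rewrite row1 row_mul -[RHS]DE deriveEjacobian//.
  by rewrite rowE.
have fF : row_free (jacobian F (crd c' p)) by apply/row_freeP; exists (jacobian G (crd d' p)).
have := mxrankS (_ : sel R (~: I') *m jacobian F (crd c' p) <= sel R (~: J'))%MS.
rewrite mxrankMfree// !rank_sel => H.
suff : (#|~: I'| <= #|~: J'|)%N.
  by rewrite -(leq_add2l #|I'|) cardsC card_ord -{1}(card_ord n) -(cardsC J') leq_add2r.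
apply: H; apply/row_subP => i; rewrite row_mul -deriveEjacobian//; apply/sub_selP => j.
rewrite inE negbK => jJ; apply: (transition_derive0 mc cp Xp vc vd rF _ jJ) => k kI.
by rewrite mxE mxE inE kI andbF.
Qed.

Lemma star_connected c p (A : set N) : mchart c -> A `<=` dom c -> A p ->
  (forall q, A q -> forall t : R, 0 <= t <= 1 ->
     exists2 q', A q' & crd c q' = crd c p + t *: (crd c q - crd c p)) -> connected A.
Proof.
move=> mc Ac Ap HA.
pose L q : set N := [set q' | A q' /\ exists2 t : R, 0 <= t <= 1 &
  crd c q' = crd c p + t *: (crd c q - crd c p)].
have -> : A = \bigcup_(q in A) L q.
  apply/seteqP; split=> [q Aq|q' [q Aq []//]]; exists q => //; split=> //.
  by exists 1; rewrite ?ler01 ?lexx// scale1r addrC subrK.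
apply: bigcup_connected => [|q Aq].
  by exists p => q Aq; split=> //; exists 0; rewrite ?ler01 ?lexx// scale0r addr0.
(* Clamping to [0, 1] makes the segment the image of the whole line under a total map. *)
pose clamp (t : R) := if t <= 0 then 0 else if 1 <= t then 1 else t.
have clamp01 t : 0 <= clamp t <= 1.
  rewrite /clamp; case: (leP t 0) => t0; first by rewrite lexx ler01.
  by case: (leP 1 t) => t1; rewrite ?ler01 ?lexx ?ltW.
have clampE t : 0 <= t <= 1 -> clamp t = t.
  by rewrite /clamp => /andP[t0 t1]; case: (leP t 0) => ?; [|case: leP => ?]; lra.
have clampB t t' : `|clamp t - clamp t'| <= `|t - t'|.
  rewrite ler_norml /clamp; have := ler_norm (t - t'); have := ler_norm (t' - t).
  rewrite [`|t' - t|]distrC.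
  by case: (leP t 0) => ?; case: (leP 1 t) => ?; case: (leP t' 0) => ?; case: (leP 1 t') => ?;
    move=> ? ?; apply/andP; split; lra.
have [g gP] : {g : R -> N & forall t,
    A (g t) /\ crd c (g t) = crd c p + clamp t *: (crd c q - crd c p)}.
  apply: (@choice _ _ (fun t q' => A q' /\ crd c q' = _)) => t.
  by have [q' Aq' E] := HA q Aq _ (clamp01 t); exists q'.
have -> : L q = range g.
  apply/seteqP; split=> [q' [Aq' [t t01 E]]|q' [t _ <-]].
    exists t => //; have [Ag Eg] := gP t; rewrite clampE// in Eg.
    by apply: (mchart_inj mc); [exact: Ac|exact: Ac|rewrite E Eg].
  by have [Ag Eg] := gP t; split=> //; exists (clamp t).
apply: connected_continuous_connected; first exact/connected_intervalP.
apply: continuous_subspaceT => t; have [Ag Eg] := gP t.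
move=> O /(nbhs_chart gN _ mc (Ac _ Ag)).1[e e0 eO].
set v := crd c q - crd c p in Eg *.
have v1 : 0 < 1 + `|v| by rewrite ltr_pwDl.
apply/nbhs_ballP; exists (e / (1 + `|v|)) => [/=|t' tt']; first exact: divr_gt0.
have [Ag' Eg'] := gP t'; apply: eO; first exact: Ac.
have sub (a b : 'rV[R]_n) (t1 t2 : R) k :
    (a + t1 *: b) 0 k - (a + t2 *: b) 0 k = (t1 - t2) * b 0 k by rewrite !mxE; ring.
apply/ball_rowP => // i; rewrite Eg Eg' sub normrM -/v.
have : `|t - t'| * (1 + `|v|) < e by rewrite -ltr_pdivlMr.
apply: le_lt_trans; apply: ler_pM; rewrite ?normr_ge0 ?clampB//.
by have := @coord_le_norm R 1 n v 0 i; lra.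
Qed.

End Flat.

(** * Lifts in projective coordinates *)



Lemma closure_near (T : topologicalType) (A B : set T) p :
  closure A p -> nbhs p B -> closure (A `&` B) p.
Proof.
by move=> clA nB O nO; have [q [Aq [Oq Bq]]] := clA _ (filterI nO nB); exists q.
Qed.

Section LiftCharts.
Variables (R : realType) (n : nat) (N : charted_space R n).
Hypothesis gN : good N.
Variable C : set N.
Hypotheses (clC : closed C) (lC : locally_coords C).
Implicit Types (p q : N) (c d : chart R n N) (I J : {set 'I_n}) (x y : blowup C) (A Q : set N).
Implicit Types (V W : 'M[R]_n) (z w u : 'rV[R]_n) (i j : 'I_n) (s : R).

Local Notation beta := (blowdown C).
Let gB : good (blowup C) := blowup_good gN clC lC.

Lemma closed_complement p : ~ C p -> nbhs p (~` C).
Proof. by move=> nC; apply: open_nbhs_nbhs; split=> //; exact: closed_openC. Qed.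

Lemma closure_blowdown A x : closure (beta @^-1` A) x -> closure A (beta x).
Proof.
move=> H O nO; have [y [Ay Oy]] := H _ (blowdown_continuous gN clC lC nO).
by exists (beta y).
Qed.

Lemma closure_out A x : ~ C (beta x) -> closure A (beta x) -> closure (beta @^-1` A) x.
Proof.
move=> nC clA; have [c mc cx] := mchart_cover gN (beta x).
have ex : dom (cchart C c) x by [].
have me := cchart_mchart gN clC mc.
apply/(closure_chart gB _ me ex) => e e0.
have /(closure_chart gN _ mc cx)/(_ e e0)[q [cq eq [Aq nCq]]] :=
  closure_near clA (closed_complement nC).
have [y yq] := blowdown_out nCq; exists y; split; rewrite /= ?yq//.
Qed.

Lemma lift_in Q : Q `<=` C -> lift C Q = beta @^-1` Q.
Proof. by move=> QC; rewrite /lift; case: asboolP. Qed.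

Lemma lift_dense Q : Q `<=` closure (Q `\` C) -> lift C Q = closure (beta @^-1` (Q `\` C)).
Proof.
move=> dQ; rewrite /lift; case: asboolP => // QC.
have QC0 : Q `\` C = set0 by apply/seteqP; split=> // q [/QC].
have Q0 : Q = set0 by apply/seteqP; split=> // q /dQ; rewrite QC0 closure0.
by rewrite QC0 Q0 preimage_set0 closure0.
Qed.

Lemma lift_out Q x : closed Q -> ~ C (beta x) -> lift C Q x <-> Q (beta x).
Proof.
move=> clQ nC; rewrite /lift; case: asboolP => // _.
split=> [/closure_blowdown H|Qx]; last exact: subset_closure.
by apply: clQ; apply: closureS H => q [].
Qed.

Lemma closed_lift Q : closed Q -> closed (lift C Q).
Proof.
move=> clQ; rewrite /lift; case: asboolP => _; last exact: closed_closure.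
by apply: preimage_closed => // x _; apply: (blowdown_continuous gN clC lC).
Qed.

Lemma lift_sub Q x : closed Q -> lift C Q x -> Q (beta x).
Proof.
move=> clQ; rewrite /lift; case: asboolP => // _ /closure_blowdown H.
by apply: clQ; apply: closureS H => q [].
Qed.

Section Chart.
Variables (c : chart R n N) (I : {set 'I_n}) (i : 'I_n) (s : R).
Hypotheses (cI : coords C c I) (iI : i \in I) (ss : sign s).
Local Notation e := (pchart C c I i s).
Let me : mchart e := pchart_mchart gN clC cI iI ss.

Lemma pchart_raise x (r : R) : dom e x -> 0 < r -> exists y, [/\ dom e y, ~ C (beta y),
  ball (crd e x) r (crd e y) & forall j, j != i -> crd e y 0 j = crd e x 0 j].
Proof.
move=> ex r0; have [_ pc2 pc3] := proj1 me; have [r' r'0 rH] := pc3 x ex.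
have wi : 0 <= crd e x 0 i by apply: pc2 => //; rewrite in_setU1 eqxx.
pose t := Num.min r r' / 2.
have m0 : 0 < Num.min r r' by rewrite lt_min r0.
have t0 : 0 < t by rewrite divr_gt0.
have tm : t < Num.min r r' by rewrite /t ltr_pdivrMr// ltr_pMr// ltr1n.
pose w : 'rV[R]_n := \row_j if j == i then crd e x 0 j + t else crd e x 0 j.
have wE j : w 0 j = if j == i then crd e x 0 j + t else crd e x 0 j.
  by rewrite mxE.
have wb : ball (crd e x) (Num.min r r') w.
  apply/ball_rowP => // j; rewrite wE; case: eqP => _; last by rewrite subrr normr0.
  by rewrite opprD addrA subrr add0r normrN gtr0_norm.
have wb' : ball (crd e x) r' w by apply: le_ball wb; rewrite ge_min lexx orbT.
have [|y ey yE] := rH w wb'.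
  move=> j jB; rewrite wE; have := pc2 x ex j jB; case: eqP => // _.
  by move/addr_ge0; apply; exact: ltW.
exists y; split=> //.
- move=> Cy; have := (pchart_center cI iI ss ey).1 Cy; rewrite yE wE eqxx; lra.
- by rewrite yE; apply: le_ball wb; rewrite ge_min lexx.
- by move=> j ji; rewrite yE wE (negPf ji).
Qed.

Lemma lift_dir_eq w u : (forall j, j != i -> w 0 j = u 0 j) -> lift_dir i s w = lift_dir i s u.
Proof. by move=> H; apply/rowP => j; rewrite !mxE; case: eqP => // /eqP /H. Qed.

Lemma lift_dirD w u : lift_dir i s w = lift_dir i s u + part (~: [set i]) (w - u).
Proof.
apply/rowP => j; rewrite !mxE !inE; case: eqP => /= _; first by rewrite addr0.
by rewrite addrC subrK.
Qed.

Lemma open_lift_dir V : open [set w | ~ (lift_dir i s w <= V)%MS].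
Proof.
pose f w := (w - 0) *m (sel R (~: [set i]) *m cokermx V) + (s *: 'e_i : 'rV[R]_n) *m cokermx V.
have fE w : f w = lift_dir i s w *m cokermx V.
  rewrite /f subr0 mulmxA -mulmxDl; congr (_ *m _); apply/rowP => j.
  rewrite mxE mul_sel !mxE !inE eqxx /=; case: eqP => _; rewrite ?add0r ?mulr1//.
  by rewrite mulr0 addr0.
have -> : [set w | ~ (lift_dir i s w <= V)%MS] = setT `&` f @^-1` (~` [set 0]).
  by apply/seteqP; split=> w /=; rewrite fE submxE; [move=> H; split=> // /eqP|move=> [_ H] /eqP].
apply: open_preimage_on; first exact: openT.
  by apply: closed_openC; apply: accessible_closed_set1; exact: hausdorff_accessible (@norm_hausdorff _ _).
move=> w _; apply: (@smooth_continuous _ _ _ setT) => //; first exact: openT.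
by apply: smooth_affine; exact: openT.
Qed.

(** The equation on the ray does not involve w_i, so a point of the front face that satisfies it is
    approached by raising w_i. Conversely the equation is a closed condition. *)
Lemma closure_pchart Q V x : dom e x ->
  (forall y, dom e y -> ~ C (beta y) -> Q (beta y) <-> (lift_dir i s (crd e y) <= V)%MS) ->
  closure (beta @^-1` (Q `\` C)) x <-> (lift_dir i s (crd e x) <= V)%MS.
Proof.
move=> ex HQ; split=> [H|xV].
  apply: contrapT => nV; have := open_in_chart gB me (@open_lift_dir V).
  rewrite openE => /(_ x (conj ex nV)) /H[y [[Qy nCy] [ey]]]; apply.
  by apply/(HQ y ey nCy).
apply/(closure_chart gB _ me ex) => r r0; have [y [ey nCy yr yE]] := pchart_raise ex r0.
exists y; split=> //; split=> //; apply/(HQ y ey nCy).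
by rewrite (lift_dir_eq yE).
Qed.

(** Over the centre the projective coordinates are those of a product: the ray is kept and only the
    base point moves. *)
Lemma closure_center S x : S `<=` C -> dom e x -> closure S (beta x) -> closure (beta @^-1` S) x.
Proof.
move=> SC ex clS; have [cx _] := ex; have [mc vc] := cI.
have Cx : C (beta x) by apply: clC; exact: closureS clS.
have [_ pc2 pc3] := proj1 me; have [r' r'0 rH] := pc3 x ex.
apply/(closure_chart gB _ me ex) => r r0.
have m0 : 0 < Num.min r r' by rewrite lt_min r0.
have /(closure_chart gN _ mc cx)/(_ _ m0)[q [cq qr Sq]] := clS.
have Cq := SC q Sq.
pose w : 'rV[R]_n := \row_j (if j \in I then crd e x 0 j else crd c q 0 j).
have x0 := (pchart_center cI iI ss ex).1 Cx.
have blowI u j : u 0 i = 0 -> blow I i s u 0 j = if j \in I then 0 else u 0 j.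
  move=> u0; case: ifPn => jI; first by rewrite blowE// u0 mul0r.
  by rewrite mxE (negPf jI); case: eqP jI => // ->; rewrite iI.
have wb : ball (crd e x) (Num.min r r') w.
  apply/ball_rowP => // j; rewrite [w 0 j]mxE; case: ifPn => jI; first by rewrite subrr normr0.
  have -> : crd e x 0 j = crd c (beta x) 0 j.
    by rewrite (pchart_blow cI iI ss ex) blowI// (negPf jI).
  by move/ball_rowP: qr; exact.
have [||y ey yE] := rH w.
- by apply: le_ball wb; rewrite ge_min lexx orbT.
- move=> j jB; rewrite mxE; case: ifPn => jI; first exact: pc2.
  move: jB; rewrite in_setU1 => /predU1P[ji|jB]; first by move: jI; rewrite ji iI.
  exact: (mchart_corner mc cq).
have yq : beta y = q.
  have [cy _] := ey; apply: (mchart_inj mc) => //.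
  rewrite (pchart_blow cI iI ss ey) yE; apply/rowP => j.
  have w0 : w 0 i = 0 by rewrite mxE iI.
  rewrite blowI//; case: ifPn => jI; last by rewrite mxE (negPf jI).
  by have /(_ Cq j jI) -> := (vc q cq).1.
exists y; split=> //; last by rewrite /= yq.
by rewrite yE; apply: le_ball wb; rewrite ge_min lexx.
Qed.

End Chart.

Lemma closure_preimage S x : S `<=` C -> closure S (beta x) -> closure (beta @^-1` S) x.
Proof.
move=> SC clS; have Cx : C (beta x) by apply: clC; exact: closureS clS.
have [c [I [cx cI]]] := lC Cx.
by have [i [s [iI ss vs ex]]] := pchart_cover gN cI cx; apply: (closure_center cI iI ss).
Qed.

End LiftCharts.

(** In a projective chart a lift is an affine condition, since [lift_dir] has the constant s in slot
    i. Recentred at a point x of the lift it reads: w with slot i erased lies in V. These w form the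
    image of V under a shear, whence the rank. *)
Lemma flat_shift (R : realType) n (X : Type) (e : chart R n X) (V : 'M[R]_n) (B : {set 'I_n})
    i s x e' (Q : set X) : sign s -> dom e x -> Q x ->
  (forall y, dom e y -> Q y <-> (lift_dir i s (crd e y) <= V)%MS) ->
  splits B V -> bdry e' \subset i |: B ->
  (forall y, dom e' y -> dom e y /\ crd e' y = crd e y - crd e x) ->
  exists V', [/\ (forall y, dom e' y -> (Q y <-> (crd e' y <= V')%MS)), splits (bdry e') V',
    \rank V' = \rank V & forall S, supported S V -> supported (S :\ i) V'].
Proof.
move=> ss ex Qx HQ sV eB ee'.
pose u := lift_dir i s (crd e x); have uV : (u <= V)%MS by exact/HQ.
have ui : u 0 i = s by rewrite mxE eqxx.
have s0 : s != 0 by case: ss => ->; rewrite ?oner_eq0// oppr_eq0 oner_eq0.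
(* The shear 1 + D sends u to s e_i, and D squares to 0 because v has no i-component. *)
pose v : 'rV[R]_n := 'e_i - s^-1 *: u.
have vi : v 0 i = 0 by rewrite !mxE !eqxx mulVf ?subrr.
pose D : 'M[R]_n := (delta_mx i 0 : 'cV[R]_n) *m v.
have DE (z : 'rV[R]_n) : z *m D = z 0 i *: v.
  rewrite mulmxA -colE; apply/rowP => j; rewrite mxE big_ord1 !mxE; congr (_ * _).
have DD : D *m D = 0.
  by rewrite {1}/D -mulmxA DE vi scale0r mulmx0.
have TT : (1%:M + D) *m (1%:M - D) = 1%:M.
  by rewrite mulmxDl mulmxBr mulmxBr !mul1mx mulmx1 DD subr0 subrK.
pose V' := V *m (1%:M + D).
have V'P (w : 'rV[R]_n) : (w <= V')%MS <-> (part (~: [set i]) w <= V)%MS.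
  have wE : w *m (1%:M - D) = part (~: [set i]) w + (w 0 i / s) *: u.
    rewrite mulmxBr mulmx1 DE; apply/rowP => j; rewrite !mxE !inE eqxx /=.
    by case: (j =P i) => [->|_] /=; field.
  split=> [/(submxMr (1%:M - D))|H].
    rewrite -mulmxA TT mulmx1 wE => H.
    rewrite -[part _ _](addrK ((w 0 i / s) *: u)); apply: addmx_sub => //.
    by rewrite (eqmx_opp _) scalemx_sub.
  have -> : w = w *m (1%:M - D) *m (1%:M + D).
    have TT' := mulmx1C TT; by rewrite -mulmxA TT' mulmx1.
  by apply: submxMr; rewrite wE addmx_sub// scalemx_sub.
exists V'; split.
- move=> y ey; have [dy yE] := ee' y ey; rewrite (HQ y dy) yE V'P.
  rewrite (lift_dirD i s (crd e y) (crd e x)) -/u.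
  split=> [H|H]; last exact: addmx_sub.
  by rewrite -[part _ _](addKr u) addmx_sub// (eqmx_opp _).
- move=> j z /(fintype.subsetP eB) jB /V'P zV; apply/V'P.
  have E : part (~: [set i]) (z 0 j *: 'e_j) = (part (~: [set i]) z) 0 j *: 'e_j :> 'rV[R]_n.
    apply/rowP => k; rewrite !mxE !inE eqxx /=.
    by case: (k =P j) => [->|_]; case: eqP => _; rewrite /= ?mulr0 ?mulr1 ?mul0r.
  rewrite E; move: jB; rewrite in_setU1 => /predU1P[->|jB]; last exact: sV.
  by rewrite mxE !inE eqxx scale0r sub0mx.
- by rewrite mxrankMfree// row_free_unit; case: (mulmx1_unit TT).
move=> S sS j jS; apply/V'P.
have [->|ji] := eqVneq j i.
  rewrite [X in (X <= _)%MS](_ : _ = 0) ?sub0mx//; apply/rowP => k.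
  by rewrite !mxE !inE eqxx /=; case: eqP.
rewrite [X in (X <= _)%MS](_ : _ = 'e_j).
  by apply: sS; move: jS; rewrite !inE ji.
apply/rowP => k; rewrite !mxE !inE eqxx /=; case: (k =P i) => //= ki.
by rewrite ki; case: eqP => // ij; rewrite ij eqxx in ji.
Qed.

(** * Connected components of lifts *)



(** The list plays the part of an optional representative, so that [choice] applies without knowing
    which sets are empty. *)
Lemma pick_list (T : choiceType) (S : set T) :
  exists l : seq T, forall y, S y -> exists2 a, a \in l & S a.
Proof.
have [[a Sa]|S0] := pselect (exists a, S a); last by exists [::] => y Sy; case: S0; exists y.
by exists [:: a] => y _; exists a => //; rewrite inE.
Qed.

Section TouchSets.
Variable T : topologicalType.
Implicit Types (A D P : set T).

(** P is locally constant on D, hence relatively open and closed. *)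
Lemma connected_spread D P : connected D -> (exists2 q, D q & P q) ->
  (forall q, D q -> exists2 O, nbhs q O & forall q', D q' -> O q' -> (P q' <-> P q)) ->
  D `<=` P.
Proof.
move=> cD [q Dq Pq] loc; suff <- : D `&` P = D by move=> x [].
apply: cD; first by exists q.
- exists (~` D `|` P)^°; first exact: open_interior.
  apply/seteqP; split=> x [Dx Px]; split=> //.
    have [U nU H] := loc x Dx; apply: filterS nU => y Uy.
    by have [Dy|nDy] := pselect (D y); [right; apply/H|left].
  by have [] := interior_subset Px.
- exists (~` (~` D `|` ~` P)^°); first by apply: open_closedC; exact: open_interior.
  apply/seteqP; split=> x [Dx Px]; split=> //.
    by move=> /interior_subset[].
  apply: contrapT => nP; apply: Px; have [U nU H] := loc x Dx.
  apply: filterS nU => y Uy; have [Dy|nDy] := pselect (D y); last by left.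
  by right; move=> Py; apply: nP; apply/(H y Dy Uy).
Qed.

Lemma few_points A (s : seq T) :
  (forall x, A x -> exists2 a, a \in s & connected_component A x a) -> few_components A.
Proof.
move=> H; apply: (@sub_finite_set _ _ ((fun a => connected_component A a) @` [set` s])).
  move=> K [x Ax ->]; have [a sa xa] := H x Ax; exists a => //.
  by rewrite -(same_connected_component xa).
exact: finite_image.
Qed.

Lemma component_extend A x y (P : set T) : connected_component A x y -> connected P ->
  P `<=` A -> P y -> P `<=` connected_component A x.
Proof.
move=> xy cP PA Py z Pz; apply: connected_component_trans xy _.
exact: (connected_component_max Py PA cP Pz).
Qed.

End TouchSets.

Section FewLift.
Variables (R : realType) (n : nat) (N : charted_space R n).
Hypothesis gN : good N.
Variable C : set N.
Hypotheses (clC : closed C) (lC : locally_coords C).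
Implicit Types (p q : N) (c d : chart R n N) (I J : {set 'I_n}) (x y : blowup C) (A Q : set N).
Implicit Types (V W : 'M[R]_n) (z w u : 'rV[R]_n) (i j : 'I_n) (s : R).
Local Notation beta := (blowdown C).
Let gB : good (blowup C) := blowup_good gN clC lC.

Lemma connected_preimage_out P : connected P -> P `<=` ~` C -> connected (beta @^-1` P).
Proof.
move=> cP PC; apply/connectedP => E [E0 EP [E1 E2]].
pose F b : set N := beta @` E b.
have FP : P = F false `|` F true.
  apply/seteqP; split=> [p Pp|p [] [x Ex <-]].
  - have [x xp] := blowdown_out (PC p Pp).
    have : (beta @^-1` P) x by rewrite /= xp.
    by rewrite EP => -[] Ex; [left|right]; exists x.
  - by have : (beta @^-1` P) x by rewrite EP; left.
  - by have : (beta @^-1` P) x by rewrite EP; right.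
have sep b x : E b x -> closure (F (~~ b)) (beta x) -> closure (E (~~ b)) x.
  move=> Ex cl; have Px : P (beta x) by have : (beta @^-1` P) x by rewrite EP; case: b Ex {cl}; [right|left].
  have := closure_out gN clC lC (PC _ Px) cl; apply: closureS => y [y' Ey' yy'].
  have : (beta @^-1` P) y' by rewrite EP; case: b Ex Ey' {cl}; [left|right].
  by move=> /PC nC; rewrite (blowdown_inj (y := y) nC yy') in Ey'.
move/connectedP: cP => /(_ F); apply; split=> //.
  by move=> b; have [x Ex] := E0 b; exists (beta x), x.
split; apply/seteqP; split=> // p [].
- move=> cl [x Ex xp]; subst p; have := sep true x Ex cl => cl'.
  by have : (closure (E false) `&` E true) x by []; rewrite E1.
- move=> [x Ex xp] cl; subst p; have := sep false x Ex cl => cl'.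
  by have : (E false `&` closure (E true)) x by []; rewrite E2.
Qed.

(* The intersection of G with the front face is, over D and near p, a finite
   union of sets which are convex in projective coordinates and project onto D. *)
Definition conical (D : set N) (G : set (blowup C)) p :=
  exists c I V (b : Prop), [/\ adapted p c, coords C c I,
    forall z, (z <= V)%MS -> (part I z <= V)%MS,
    forall q, dom c q -> D q -> C q -> (crd c q <= V)%MS &
    forall i s x, i \in I -> sign s -> valid c i s -> dom (pchart C c I i s) x ->
      G x <-> (b -> crd (pchart C c I i s) x 0 i = 0) /\
              (lift_dir i s (crd (pchart C c I i s) x) <= V)%MS].

Section Slices.
Variables (p : N) (c : chart R n N) (I : {set 'I_n}) (V : 'M[R]_n) (b : Prop) (D : set N)
  (G : set (blowup C)).
Hypotheses (ac : adapted p c) (cI : coords C c I).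
Hypothesis Vpart : forall z, (z <= V)%MS -> (part I z <= V)%MS.
Hypothesis VD : forall q, dom c q -> D q -> C q -> (crd c q <= V)%MS.
Variables (i : 'I_n) (s : R).
Hypotheses (iI : i \in I) (ss : sign s) (vs : valid c i s).
Local Notation e := (pchart C c I i s).
Hypothesis GE : forall x, dom e x ->
  G x <-> (b -> crd e x 0 i = 0) /\ (lift_dir i s (crd e x) <= V)%MS.

Let me : mchart e := pchart_mchart gN clC cI iI ss.

Definition slice : set (blowup C) := [set x | [/\ dom e x, G x & crd e x 0 i = 0]].

(** As c is adapted, its image is a full cube in the corner. So the image of the projective chart is
    given by bounds on the blown-down coordinates, which the deformations below can check. *)
Let cube : exists r : R, (0 < r /\ forall q j, dom c q -> `|crd c q 0 j| < r) /\
  forall w, corner (i |: bdry c) w ->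
    (forall j, `|blow I i s w 0 j| < r) -> exists2 x, dom e x & crd e x = w.
Proof.
have [mc cp _ [r r0 rE]] := ac; exists r; split=> [|w wB wr].
  split=> // q j cq.
  have : (crd c @` dom c) (crd c q) by exists q.
  by rewrite rE => -[].
apply: (pchart_image gN cI iI ss vs wB).
have [_ _ H] := over_pchart gN cI iI ss vs.
have : [set z | corner (bdry c) z /\ forall i, `|z 0 i| < r] (blow I i s w).
  by split=> //; exact: H.
by rewrite -rE => -[q cq qE]; exists q.
Qed.

Let segment (w u : 'rV[R]_n) (t : R) : 'rV[R]_n := w + t *: (u - w).

Let segmentE w u t j : segment w u t 0 j = (1 - t) * w 0 j + t * u 0 j.
Proof. by rewrite !mxE; ring. Qed.

Let segment_lift w u t : (lift_dir i s w <= V)%MS -> (lift_dir i s u <= V)%MS ->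
  (lift_dir i s (segment w u t) <= V)%MS.
Proof.
move=> wV uV; have -> : lift_dir i s (segment w u t) =
    (1 - t) *: lift_dir i s w + t *: lift_dir i s u.
  apply/rowP => j; rewrite !mxE; case: eqP => _; ring.
by rewrite addmx_sub// scalemx_sub.
Qed.

Let segment_corner w u t B : 0 <= t <= 1 -> corner B w -> corner B u -> corner B (segment w u t).
Proof.
move=> /andP[t0 t1] wB uB j jB; rewrite segmentE.
by apply: addr_ge0; apply: mulr_ge0 => //; rewrite ?subr_ge0// ?wB ?uB.
Qed.

Let convex_lt (a a' r t : R) : 0 <= t <= 1 -> `|a| < r -> `|a'| < r ->
  `|(1 - t) * a + t * a'| < r.
Proof.
move=> /andP[t0 t1]; rewrite !ltr_norml => /andP[? ?] /andP[? ?]; apply/andP.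
have [->|t'] := eqVneq t 0; first by split; lra.
have {}t0 : 0 < t by rewrite lt_neqAle eq_sym t'.
split; nra.
Qed.

(** Where w_i = 0 the blow-down kills the coordinates in I, so the cube bounds only the others and
    all the conditions are convex. *)
Lemma slice_connected : connected slice.
Proof.
have [->|/set0P[x0 Sx0]] := eqVneq slice set0; first exact: connected0.
have [r [[r0 bound] rE]] := cube.
apply: (star_connected gB me (p := x0)) => // [x []//|x [ex Gx x0i] t t01].
have [ex0 Gx0 x00] := Sx0; have [_ pc2 _] := proj1 me.
have w0 : segment (crd e x0) (crd e x) t 0 i = 0 by rewrite segmentE x0i x00 !mulr0 addr0.
have [||y ey yE] := rE (segment (crd e x0) (crd e x) t).
- by apply: segment_corner => //; exact: pc2.
- move=> j; have [jI|jI] := boolP (j \in I); first by rewrite blowE// w0 mul0r normr0.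
  have ji : j != i by apply: contraNneq jI => ->.
  have out u : blow I i s u 0 j = u 0 j by rewrite mxE (negPf ji) (negPf jI).
  rewrite out segmentE; apply: convex_lt => //.
    by rewrite -(out (crd e x0)) -(pchart_blow cI iI ss ex0); have [cx _] := ex0; exact: bound.
  by rewrite -(out (crd e x)) -(pchart_blow cI iI ss ex); have [cx _] := ex; exact: bound.
exists y => //; split=> //; last by rewrite yE.
apply/(GE ey); rewrite yE; split=> //; apply: segment_lift.
- by have [] := (GE ex0).1 Gx0.
- by have [] := (GE ex).1 Gx.
Qed.

(** Lowering w_i to 0 keeps the ray, hence the equation; the path stays in G and ends in the
    slice. *)
Lemma slice_reach x : dom e x -> G x ->
  exists A : set (blowup C), [/\ connected A, A `<=` G, A x & exists2 y, slice y & A y].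
Proof.
move=> ex Gx; have [r [[r0 bound] rE]] := cube; have [_ pc2 _] := proj1 me.
pose w := crd e x; pose w0 := \row_j (if j == i then 0 else w 0 j) : 'rV[R]_n.
have [xb xV] := (GE ex).1 Gx.
have wt t : 0 <= t <= 1 -> exists y, [/\ dom e y, G y & crd e y = segment w0 w t].
  move=> /andP[t0 t1].
  have E : segment w0 w t = \row_j (if j == i then t * w 0 j else w 0 j).
    apply/rowP => j; rewrite segmentE !mxE; case: eqP => _; ring.
  have wti : segment w0 w t 0 i = t * w 0 i by rewrite E mxE eqxx.
  have [||y ey yE] := rE (segment w0 w t).
  - rewrite E => j jB; rewrite mxE; have := pc2 x ex j jB; case: eqP => // _ ?.
    exact: mulr_ge0.
  - move=> j; have [cx _] := ex; have := bound _ j cx; rewrite (pchart_blow cI iI ss ex) -/w.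
    have [jI|jI] := boolP (j \in I).
      rewrite !blowE// wti E (@lift_dir_eq _ _ i s _ w).
        by move=> H; rewrite -mulrA normrM (ger0_norm t0); apply: le_lt_trans H; rewrite ler_piMl.
      by move=> k ki; rewrite mxE (negPf ki).
    have ji : j != i by apply: contraNneq jI => ->.
    by rewrite E !mxE (negPf ji) (negPf jI).
  exists y; split=> //; apply/(GE ey); rewrite yE; split=> [/xb E0|].
    by rewrite E mxE eqxx -/w E0 mulr0.
  rewrite (@lift_dir_eq _ _ i s _ w) => // k ki.
  by rewrite E mxE (negPf ki).
have t0 : 0 <= (0 : R) <= 1 by rewrite lexx ler01.
have [y0 [ey0 Gy0 yE0]] := wt 0 t0.
have {}yE0 : crd e y0 = w0 by rewrite yE0 /segment scale0r addr0.
exists [set y | [/\ dom e y, G y & exists2 t : R, 0 <= t <= 1 & crd e y = segment w0 w t]].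
split.
- apply: (star_connected gB me (p := y0)) => [y []//||y [ey Gy [t t01 yE]] t' t'01].
    by split=> //; exists 0 => //; rewrite yE0 /segment scale0r addr0.
  have tt : 0 <= t' * t <= 1.
    by move: t01 t'01 => /andP[? ?] /andP[? ?]; rewrite mulr_ge0// mulr_ile1.
  have [y' [ey' Gy' yE']] := wt _ tt; exists y'; first by split=> //; exists (t' * t).
  by rewrite yE' yE yE0 /segment addrAC subrr add0r scalerA.
- by move=> y [].
- by split=> //; exists 1; rewrite ?lexx ?ler01// /segment scale1r addrC subrK.
exists y0; first by split=> //; rewrite yE0 mxE eqxx.
by split=> //; exists 0 => //; rewrite yE0 /segment scale0r addr0.
Qed.

(** The ray is kept and its base point replaced by q; [Vpart] and [VD] ensure that V allows this. *)
Lemma slice_onto y q : slice y -> dom c q -> D q -> C q -> exists2 y', slice y' & beta y' = q.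
Proof.
move=> [ey Gy yi] cq Dq Cq; have [r [[r0 bound] rE]] := cube; have [_ pc2 _] := proj1 me.
have [mc vc] := cI; have [yb yV] := (GE ey).1 Gy.
pose w := \row_j (if j \in I then crd e y 0 j else crd c q 0 j) : 'rV[R]_n.
have wi : w 0 i = 0 by rewrite mxE iI.
have wq : blow I i s w = crd c q.
  apply/rowP => j; have [jI|jI] := boolP (j \in I).
    by rewrite blowE// wi mul0r (vc q cq).1.
  have ji : j != i by apply: contraNneq jI => ->.
  by rewrite !mxE (negPf ji) (negPf jI).
have [||y' ey' yE'] := rE w.
- move=> j jB; rewrite mxE; case: ifPn => jI; first exact: pc2.
  move: jB; rewrite in_setU1 => /predU1P[ji|jB]; first by move: jI; rewrite ji iI.
  exact: (mchart_corner mc cq).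
- by move=> j; rewrite wq; exact: bound.
exists y'.
  split=> //; last by rewrite yE'.
  apply/(GE ey'); rewrite yE'; split=> //.
  have -> : lift_dir i s w = part I (lift_dir i s (crd e y)) + crd c q.
    apply/rowP => j; rewrite !mxE; have [jI|jI] := boolP (j \in I).
      by rewrite (vc q cq).1// addr0.
    by rewrite add0r; case: eqP jI => // ->; rewrite iI.
  by apply: addmx_sub; [exact: Vpart|exact: VD].
have [cy' _] := ey'; apply: (mchart_inj mc) => //.
by rewrite (pchart_blow cI iI ss ey') yE' wq.
Qed.

End Slices.

(** Consider the image in D of a component of G. If the component touches the front face, the image
    contains a whole piece of D [&] C, and the component meets one of finitely many slices near a
    chosen point of it. Otherwise the image contains a whole piece of D, and the component contains
    the one preimage of a chosen point. Either way one of finitely many points lies in it. *)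
Theorem few_lift (D : set N) (G : set (blowup C)) :
  few_components D -> few_components (D `&` C) ->
  (forall x, G x -> D (beta x)) ->
  (forall x, ~ C (beta x) -> D (beta x) -> G x) ->
  (forall p, D p -> ~ C p -> exists U P,
     [/\ nbhs p U, connected P, P `<=` D `\` C & D `&` U `<=` P]) ->
  (forall p, D p -> C p -> conical D G p) ->
  few_components G.
Proof.
move=> /few_componentsP[sD [sD1 sD2]] /few_componentsP[sC [sC1 sC2]] GD DG loc con.
have tube p : exists Ur : set N * seq (blowup C), D p -> C p -> nbhs p Ur.1 /\
    forall x, G x -> Ur.1 (beta x) -> (exists2 a, a \in Ur.2 & connected_component G x a) /\
      forall q, D q -> C q -> Ur.1 q -> exists2 y, connected_component G x y & beta y = q.
  have [[Dp Cp]|nDC] := pselect (D p /\ C p); last by exists (set0, [::]) => Dp Cp; case: nDC.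
  have [c [I [V [b [ac cI Vp VD GE]]]]] := con p Dp Cp; have [mc cp _ _] := ac.
  pose sg (k : bool) : R := if k then 1 else -1.
  pose S (k : 'I_n * bool) := slice c I G k.1 (sg k.2).
  have /choice[l lP] := fun k => pick_list (S k).
  exists (dom c, flatten [seq l k | k <- enum {: 'I_n * bool}]) => _ _ /=; split.
    by apply: open_nbhs_nbhs; split=> //; exact: open_dom.
  move=> x Gx cx; have [i [s [iI ss vs ex]]] := pchart_cover gN cI cx.
  have [k sE] : exists k, s = sg k by case: ss => ->; [exists true|exists false].
  have GEi y := GE i s y iI ss vs.
  have [A [cA AG Ax [y Sy Ay]]] := slice_reach ac cI iI ss vs GEi ex Gx.
  have xy : connected_component G x y by apply: (connected_component_max Ax).
  have cS := slice_connected ac cI iI ss vs GEi.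
  have SG : slice c I G i s `<=` G by move=> ? [].
  have Sx := component_extend xy cS SG Sy.
  split.
    have Sk : S (i, k) y by rewrite /S /= -sE.
    have [a la Sa] := lP _ _ Sk; exists a; last by apply: Sx; rewrite sE.
    by apply/flattenP; exists (l (i, k)) => //; apply: map_f; rewrite mem_enum.
  move=> q Dq Cq cq; have [y' Sy' <-] := slice_onto ac cI Vp VD iI ss vs GEi Sy cq Dq Cq.
  by exists y' => //; exact: Sx.
have [Ur UrP] := choice tube.
have /choice[rep repP] := @pick_list N.
have /choice[up upP] := fun q : N => pick_list [set y : blowup C | beta y = q].
pose l1 := flatten [seq flatten [seq (Ur q).2 | q <- rep K] | K <- sC].
pose l2 := flatten [seq flatten [seq up q | q <- rep K] | K <- sD].
apply: (@few_points _ _ (l1 ++ l2)) => x Gx.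
pose P : set N := [set q | exists2 y, connected_component G x y & beta y = q].
have inG y : connected_component G x y -> G y by apply: connected_component_sub.
have [[y xy Cy]|notouch] := pselect (exists2 y, connected_component G x y & C (beta y)).
  have Dy := GD y (inG y xy).
  have [K sK Ky] := sC2 (beta y) (conj Dy Cy); have [cK KD] := sC1 K sK.
  have KP : K `<=` P.
    apply: connected_spread => //; first by exists (beta y) => //; exists y.
    move=> q Kq; have [Dq Cq] := KD q Kq; have [nU H] := UrP q Dq Cq.
    exists (Ur q).1 => // q' Kq' Uq'; have [Dq' Cq'] := KD q' Kq'.
    split=> -[z xz zq].
      have Uz : (Ur q).1 (beta z) by rewrite zq.
      have [_ /(_ q Dq Cq (nbhs_singleton nU))[u zu <-]] := H z (inG z xz) Uz.
      by exists u => //; apply: connected_component_trans zu.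
    have Uz : (Ur q).1 (beta z) by rewrite zq; exact: nbhs_singleton.
    have [_ /(_ q' Dq' Cq' Uq')[u zu <-]] := H z (inG z xz) Uz.
    by exists u => //; apply: connected_component_trans zu.
  have [a ra Ka] := repP K _ Ky; have [Da Ca] := KD a Ka; have [nU H] := UrP a Da Ca.
  have [z xz za] := KP a Ka; have Uz : (Ur a).1 (beta z) by rewrite za; exact: nbhs_singleton.
  have [[b lb zb] _] := H z (inG z xz) Uz.
  exists b; last exact: connected_component_trans zb.
  rewrite mem_cat; apply/orP; left; apply/flattenP.
  exists (flatten [seq (Ur q).2 | q <- rep K]); first exact: map_f.
  by apply/flattenP; exists (Ur a).2 => //; exact: map_f.
have [K sK Kx] := sD2 _ (GD x Gx); have [cK KD] := sD1 K sK.
have nC (z : blowup C) : connected_component G x z -> ~ C (beta z) by move=> xz Cz; apply: notouch; exists z.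
have KP : K `<=` P.
  apply: connected_spread => //.
    by exists (beta x) => //; exists x => //; exact: connected_component_refl.
  move=> q Kq; have Dq := KD q Kq; have [Cq|nCq] := pselect (C q).
    have [nU H] := UrP q Dq Cq; exists (Ur q).1 => // q' Kq' Uq'.
    split=> -[z xz zq]; exfalso; last by apply: (nC z xz); rewrite zq.
    have Uz : (Ur q).1 (beta z) by rewrite zq.
    have [_ /(_ q Dq Cq (nbhs_singleton nU))[u zu uq]] := H z (inG z xz) Uz.
    by apply: (nC u); [apply: connected_component_trans zu|rewrite uq].
  have [U [F [nU cF FD UF]]] := loc q Dq nCq; exists U => // q' Kq' Uq'.
  have FC : F `<=` ~` C by move=> ? /FD[].
  have cF' := connected_preimage_out cF FC.
  have F'G : beta @^-1` F `<=` G by move=> z Fz; have [Dz Cz] := FD _ Fz; exact: DG.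
  have Fq : F q by apply: UF; split=> //; exact: nbhs_singleton.
  have Fq' : F q' by apply: UF; split=> //; exact: KD.
  have spread a b : F a -> F b -> P a -> P b.
    move=> Fa Fb [z xz za]; have [u ub] := blowdown_out (FC b Fb); exists u => //.
    by apply: (component_extend xz cF' F'G); rewrite /= ?za ?ub.
  by split; exact: spread.
have [a ra Ka] := repP K _ Kx; have [z xz za] := KP a Ka.
have [b lb ba] := upP a z za; have zb : z = b.
  by apply: blowdown_inj; [exact: nC|rewrite za ba].
exists b; last by rewrite -zb.
rewrite mem_cat; apply/orP; right; apply/flattenP.
exists (flatten [seq up q | q <- rep K]); first exact: map_f.
by apply/flattenP; exists (up a) => //; exact: map_f.
Qed.

End FewLift.

(** * Families closed under intersection *)



Lemma closure_least (T : topologicalType) (A B : set T) : closed B -> A `<=` B -> closure A `<=` B.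
Proof. by move=> clB AB x /(closureS AB); exact: clB. Qed.

Section LiftOrder.
Variables (R : realType) (n : nat) (N : charted_space R n).
Hypothesis gN : good N.
Variable C : set N.
Hypotheses (clC : closed C) (lC : locally_coords C).

(** Off C density pulls back through the blow-down, and the lift of Q is the closure of its part off
    C. *)
Lemma lift_dense_out (Q X : set N) : closed Q -> closed X -> Q `<=` closure (Q `\` C) ->
  Q `<=` closure (Q `\` X) -> lift C Q `<=` closure (lift C Q `\` lift C X).
Proof.
move=> clQ clX QC QX; rewrite {1}(lift_dense QC).
apply: closure_least; first exact: closed_closure.
move=> y [Qy nCy]; have := closure_near (QX _ Qy) (closed_complement clC nCy).
move=> /(closure_out gN clC lC nCy); apply: closureS => z [[Qz nXz] nCz].
by split; [exact/lift_out|move=> /(lift_out gN clC lC clX nCz)].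
Qed.

Lemma lift_sub_inv (Q X : set N) : closed X -> Q `<=` closure (Q `\` C) ->
  lift C Q `<=` lift C X -> Q `<=` X.
Proof.
move=> clX QC QX; suff H : closure (Q `\` C) `<=` X by move=> p /QC /H.
apply: closure_least => // p [Qp nCp]; have [x xp] := blowdown_out nCp.
rewrite -xp; apply/(lift_out gN clC lC clX); rewrite ?xp//; apply: QX.
by rewrite (lift_dense QC); apply: subset_closure; rewrite /= xp.
Qed.

End LiftOrder.

Section FlatPieces.
Variables (R : realType) (n : nat) (N : charted_space R n).
Hypothesis gN : good N.
Implicit Types (p q : N) (c : chart R n N) (X Y : set N) (V W : 'M[R]_n).

Definition flatly c k X := exists V, [/\ flat c V X, splits (bdry c) V & \rank V = k].

Lemma flat_connected p c V X : adapted p c -> flat c V X -> connected (X `&` dom c).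
Proof.
move=> [mc cp c0 [r r0 rE]] fX.
have bound q : dom c q -> corner (bdry c) (crd c q) /\ forall i, `|crd c q 0 i| < r.
  move=> cq; have : (crd c @` dom c) (crd c q) by exists q.
  by rewrite rE.
have Xp : X p by apply/fX => //; rewrite c0 sub0mx.
apply: (star_connected gN mc (p := p)) => [q []//|//|q [Xq cq] t /andP[t0 t1]].
have [qB qr] := bound q cq.
have : [set z | corner (bdry c) z /\ forall i, `|z 0 i| < r] (t *: crd c q).
  split=> [i iB|i]; first by rewrite mxE mulr_ge0// qB.
  by rewrite mxE normrM ger0_norm//; apply: le_lt_trans (qr i); rewrite ler_piMl.
rewrite -rE => -[q' cq' E]; exists q'; last by rewrite E c0 subr0 add0r.
by split=> //; apply/fX => //; rewrite E scalemx_sub//; apply/fX.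
Qed.

Lemma locally_connected_flat p c V X A : adapted p c -> flat c V X -> X p -> nbhs p A ->
  exists U P, [/\ nbhs p U, connected P, P `<=` X `&` A & X `&` U `<=` P].
Proof.
move=> [mc cp c0 cr] fX Xp nA.
have [c' [ac' dc' _ cE]] := adapted_shift gN mc cp nA; have [mc' cp' _ _] := ac'.
have fX' : flat c' V X by move=> q cq; rewrite cE// c0 subr0; apply: fX; have [] := dc' q cq.
exists (dom c'), (X `&` dom c'); split=> //.
- by apply: open_nbhs_nbhs; split=> //; exact: open_dom.
- exact: flat_connected ac' fX'.
- by move=> q [Xq cq]; split=> //; have [] := dc' q cq.
Qed.

Lemma flat_submanifold X k : closed X -> few_components X ->
  (forall p, X p -> exists2 c, adapted p c & flatly c k X) -> p_submanifold_dim k X.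
Proof.
move=> clX fX H; split=> // p Xp; have [c ac [V [fV sV <-]]] := H p Xp.
have [I [c' [ac' _ vI cI _]]] := straighten gN ac fV sV (@filterT _ _ _).
by exists c', I; split.
Qed.

Lemma splits_cap B V W : splits B V -> splits B W -> splits B (V :&: W)%MS.
Proof.
move=> sV sW j z jB; rewrite !sub_capmx => /andP[zV zW].
by apply/andP; split; [exact: sV|exact: sW].
Qed.

Lemma flat_cap c V W X Y : flat c V X -> flat c W Y -> flat c (V :&: W)%MS (X `&` Y).
Proof.
move=> fX fY q cq; rewrite sub_capmx; split=> [[Xq Yq]|/andP[qV qW]].
  by apply/andP; split; [apply/fX|apply/fY].
by split; [apply/fX|apply/fY].
Qed.

Lemma splits_sub (B B' : {set 'I_n}) V : B' \subset B -> splits B V -> splits B' V.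
Proof. by move=> /fintype.subsetP BB sV j z /BB; exact: sV. Qed.

(** [blow] and w_i times [lift_dir] agree on the coordinates in I, the only ones that the equations
    of V involve. *)
Lemma blow_sub I i s V (w : 'rV[R]_n) : supported I V -> i \in I -> 0 < w 0 i ->
  (blow I i s w <= V)%MS <-> (lift_dir i s w <= V)%MS.
Proof.
move=> sV iI wi.
have D : (blow I i s w - w 0 i *: lift_dir i s w <= V)%MS.
  by apply: (supported_sub sV) => j jI; rewrite mxE blowE// [X in _ + X]mxE [X in _ - X]mxE subrr.
split=> H; last first.
  by rewrite -[blow _ _ _ _](subrK (w 0 i *: lift_dir i s w)) addmx_sub// scalemx_sub.
have -> : lift_dir i s w = (w 0 i)^-1 *: (blow I i s w - (blow I i s w - w 0 i *: lift_dir i s w)).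
  by rewrite subKr scalerA mulVf ?scale1r// gt_eqF.
by apply: scalemx_sub; apply: addmx_sub => //; rewrite (eqmx_opp _).
Qed.

End FlatPieces.

Section Families.
Variables (R : realType) (n : nat) (T : eqType).
Implicit Types (s : seq T) (d : T -> nat).

(** In use the labels are the original subsets of M, so that one enumeration and one dimension
    function serve at every stage. One chart per point must make all the elements through it
    linear. *)
Definition family (N : charted_space R n) (L : T -> set N) d s : Prop :=
  [/\ forall F, F \in s -> closed (L F) /\ few_components (L F),
      forall p, exists2 c, adapted p c &
        forall F, F \in s -> L F p -> flatly c (d F) (L F) &
      forall F G, F \in s -> G \in s -> F <> G ->
        L F `<=` L G \/ L F `<=` closure (L F `\` L G)].

(** Equality of germs at p, one inclusion being global. Components of an intersection satisfy it as
    well as the intersection itself. *)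
Definition meets_in (N : charted_space R n) (L : T -> set N) E F G p : Prop :=
  [/\ L E p, L E `<=` L F `&` L G & nbhs p [set q | L F q -> L G q -> L E q]].

(* Locally the intersection of two elements is an element which does not come
   after both of them. *)
Definition closing (N : charted_space R n) (L : T -> set N) s : Prop :=
  forall p F G, F \in s -> G \in s -> L F p -> L G p ->
    exists E, [/\ E \in s, (index E s <= maxn (index F s) (index G s))%N & meets_in L E F G p].

Definition ordered (N : charted_space R n) (L : T -> set N) s : Prop :=
  forall F G, F \in s -> G \in s -> (index F s < index G s)%N -> L G `<=` L F -> L G = set0.

Lemma family_submanifold (N : charted_space R n) (L : T -> set N) d s F : good N ->
  family L d s -> F \in s -> p_submanifold_dim (d F) (L F).
Proof.
move=> gN [cl ch _] Fs; have [clF fF] := cl F Fs; apply: flat_submanifold => // p Fp.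
by have [c ac H] := ch p; exists c => //; exact: H.
Qed.

Lemma family_sub (N : charted_space R n) (L : T -> set N) d s s' : {subset s' <= s} ->
  family L d s -> family L d s'.
Proof.
move=> ss [cl ch ml]; split=> [F /ss|p|F G /ss Fs /ss Gs]; [exact: cl| |exact: ml].
by have [c ac H] := ch p; exists c => // F /ss; exact: H.
Qed.

Section BlowupStep.
Variables (N : charted_space R n) (L : T -> set N) (d : T -> nat) (s : seq T) (C0 : T).
Hypotheses (gN : good N) (fam : family L d s) (C0s : C0 \in s).
Local Notation C := (L C0).
Hypothesis head : forall F, F \in s -> C `<=` L F \/ C `&` L F = set0.
Hypothesis least : forall F, F \in s -> F <> C0 -> L F `<=` C -> L F = set0.
Local Notation beta := (blowdown C).
Local Notation L' F := (lift C (L F)).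
Implicit Types (F G E : T) (x y : blowup C) (p q : N).

Let clC : closed C. Proof. by have [cl _ _] := fam; have [] := cl C0 C0s. Qed.

Let lC : locally_coords C.
Proof.
have := family_submanifold gN fam C0s => H; have : p_submanifold C by exists (d C0).
by case/p_submanifold_coords.
Qed.

Let gB : good (blowup C) := blowup_good gN clC lC.

Lemma closed_member F : F \in s -> closed (L F).
Proof. by move=> Fs; have [cl _ _] := fam; have [] := cl F Fs. Qed.

Lemma member_dense F : F \in s -> F <> C0 -> L F `<=` closure (L F `\` C).
Proof.
move=> Fs FC; have [_ _ ml] := fam; have [FC'|//] := ml F C0 Fs C0s FC.
by rewrite (least Fs FC FC') => x.
Qed.

Lemma liftE F : F \in s -> F <> C0 -> L' F = closure (beta @^-1` (L F `\` C)).
Proof. by move=> Fs FC; apply: lift_dense; exact: member_dense. Qed.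

Lemma lift_mono F G : F \in s -> F <> C0 -> G \in s -> G <> C0 -> L F `<=` L G -> L' F `<=` L' G.
Proof.
move=> Fs FC Gs GC FG; rewrite !liftE//; apply: closureS => x [Fx nC].
by split=> //; exact: FG.
Qed.

(** Every element through p contains the centre. Once the centre is {z_I = 0}, they are cut out by
    equations in the coordinates of I, which projective coordinates respect. *)
Lemma head_chart p : C p -> exists c (I : {set 'I_n}), [/\ adapted p c, coords C c I,
  (#|I| + d C0 = n)%N & forall F, F \in s -> L F p ->
    exists V, [/\ flat c V (L F), splits (bdry c) V, \rank V = d F & supported I V]].
Proof.
move=> Cp; have [_ ch _] := fam; have [c ac H] := ch p.
have [V [fV sV rV]] := H C0 C0s Cp.
have [I [c' [ac' [_ bc'] vI cI [_ _ HW]]]] := straighten gN ac fV sV (@filterT _ _ _).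
exists c', I; split=> //; [by split=> //; case: ac'|by rewrite -rV|].
move=> F Fs Fp; have [W [fW sW rW]] := H F Fs Fp.
have [W' [fW' sW' rW' SW']] := HW (L F) W fW sW.
exists W'; split=> //; first by rewrite rW'.
apply: SW'; apply: (flat_sub gN ac sV fV fW).
have [CF|C0F] := head Fs; first by apply: filterE => q; exact: CF.
by have : (C `&` L F) p by []; rewrite C0F.
Qed.

Section Chart.
Variables (c : chart R n N) (I : {set 'I_n}) (i : 'I_n) (sg : R) (F : T) (V : 'M[R]_n).
Hypotheses (cI : coords C c I) (iI : i \in I) (ss : sign sg) (Fs : F \in s) (FC : F <> C0).
Hypotheses (fV : flat c V (L F)) (SV : supported I V).

Lemma lift_pchart x : dom (pchart C c I i sg) x ->
  L' F x <-> (lift_dir i sg (crd (pchart C c I i sg) x) <= V)%MS.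
Proof.
move=> ex; rewrite liftE//; apply: closure_pchart => // y ey nCy.
have [cy _] := ey; rewrite (fV cy) (pchart_blow cI iI ss ey).
by apply: blow_sub => //; exact: pchart_pos.
Qed.

End Chart.

(** Off the centre the old chart is restricted; over it [flat_shift] recentres a projective chart,
    with no change of rank and so of dimension. *)
Lemma lift_flat x : exists2 c, adapted x c &
  forall F, F \in s -> F <> C0 -> L' F x -> flatly c (d F) (L' F).
Proof.
have [Cx|nCx] := pselect (C (beta x)); last first.
  have [_ ch _] := fam; have [c [mc cx c0 _] H] := ch (beta x).
  have ex : dom (cchart C c) x by [].
  have me := cchart_mchart gN clC mc.
  have [e [ae de be eE]] := adapted_shift gB me ex (@filterT _ _ _).
  exists e => // F Fs FC /(lift_sub gN clC lC (closed_member Fs)) Fx.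
  have [V [fV sV rV]] := H F Fs Fx; exists V; split=> //.
    move=> y ey; have [[cy nCy] _] := de y ey; rewrite lift_out//; last exact: closed_member.
    by rewrite eE//= c0 subr0; exact: fV.
  by apply: splits_sub sV; rewrite be; apply/fintype.subsetP => j; rewrite inE => /andP[].
have [c [I [[mc cx c0 _] cI _ H]]] := head_chart Cx.
have [i [sg [iI ss vs ex]]] := pchart_cover gN cI cx.
have me := pchart_mchart gN clC cI iI ss.
have [e [ae de be eE]] := adapted_shift gB me ex (@filterT _ _ _).
exists e => // F Fs FC Fx; have Fx' := lift_sub gN clC lC (closed_member Fs) Fx.
have [V [fV sV rV SV]] := H F Fs Fx'.
have [||V' [fV' sV' rV' _]] := flat_shift ss ex Fx
  (fun y => lift_pchart cI iI ss Fs FC fV SV (x := y)) sV _ (e' := e).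
- by rewrite be; apply/fintype.subsetP => j; rewrite inE => /andP[].
- by move=> y ey; have [? _] := de y ey; split=> //; exact: eE.
by exists V'; split=> //; rewrite rV'.
Qed.

Lemma lift_few F : F \in s -> F <> C0 -> few_components (L' F).
Proof.
move=> Fs FC; have [cl ch _] := fam; have [clF fF] := cl F Fs; have [_ fC] := cl C0 C0s.
apply: (few_lift gN clC lC (D := L F)) => //.
- have [CF|CF] := head Fs; first by rewrite setIidr.
  by rewrite setIC CF; apply: (@few_points _ _ [::]).
- by move=> x; exact: lift_sub.
- by move=> x nC Fx; apply/lift_out.
- move=> p Fp nCp; have [c ac H] := ch p; have [V [fV _ _]] := H F Fs Fp.
  exact: (locally_connected_flat gN ac fV Fp (closed_complement clC nCp)).
move=> p Fp Cp; have [c [I [ac cI _ H]]] := head_chart Cp.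
have [V [fV sV rV SV]] := H F Fs Fp.
exists c, I, V, False; split=> //.
- by move=> z; apply: supported_part SV _.
- by move=> q cq Fq _; apply/fV.
move=> i sg x iI ss vs ex; rewrite (lift_pchart cI iI ss Fs FC fV SV ex).
by split=> [|[]].
Qed.

(** Over the centre the equality of germs becomes an inclusion of linear spaces, by [flat_sub], and
    the same inclusion then holds for rays. Sets that meet only along the centre are separated by
    the blow-up, so E is another element. *)
Lemma lift_meets E F G x : E \in s -> F \in s -> G \in s -> F <> C0 -> G <> C0 ->
  L' F x -> L' G x -> meets_in L E F G (beta x) ->
  E <> C0 /\ meets_in (fun Q => L' Q) E F G x.
Proof.
move=> Es Fs Gs FC GC Fx Gx [Ep EFG nE].
have Fx' := lift_sub gN clC lC (closed_member Fs) Fx.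
have Gx' := lift_sub gN clC lC (closed_member Gs) Gx.
have EF : L E `<=` L F by move=> q /EFG[].
have EG : L E `<=` L G by move=> q /EFG[].
have [Cx|nCx] := pselect (C (beta x)); last first.
  have EC : E <> C0 by move=> E0; apply: nCx; move: Ep; rewrite E0.
  split=> //; split; first by apply/lift_out => //; exact: closed_member.
    by move=> y Ey; split; [exact: (lift_mono Es EC Fs FC EF)|exact: (lift_mono Es EC Gs GC EG)].
  have nI : nbhs (beta x) ([set q | L F q -> L G q -> L E q] `&` ~` C).
    by apply: filterI => //; exact: closed_complement.
  have nx : nbhs x (beta @^-1` ([set q | L F q -> L G q -> L E q] `&` ~` C)).
    exact: (blowdown_continuous gN clC lC nI).
  apply: filterS nx => y [H nCy] Fy Gy; apply/lift_out => //; first exact: closed_member.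
  apply: H; first exact: (lift_sub gN clC lC (closed_member Fs) Fy).
  exact: (lift_sub gN clC lC (closed_member Gs) Gy).
have [c [I [ac cI _ H]]] := head_chart Cx; have [mc cx c0 _] := ac.
have [i [sg [iI ss vs ex]]] := pchart_cover gN cI cx.
have me := pchart_mchart gN clC cI iI ss.
have [V [fV sV _ SV]] := H F Fs Fx'; have [W [fW sW _ SW]] := H G Gs Gx'.
have key U : flat c U (L E) -> (V :&: W <= U)%MS.
  move=> fU; apply: (flat_sub gN ac (splits_cap sV sW) (flat_cap fV fW) fU).
  by apply: filterS nE => q H' [Fq Gq]; exact: H'.
have xVW y : dom (pchart C c I i sg) y -> L' F y -> L' G y ->
    (lift_dir i sg (crd (pchart C c I i sg) y) <= V :&: W)%MS.
  move=> ey Fy Gy; rewrite sub_capmx; apply/andP; split.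
    exact/(lift_pchart cI iI ss Fs FC fV SV ey).
  exact/(lift_pchart cI iI ss Gs GC fW SW ey).
have EC : E <> C0.
  (* If E were the centre, the ray at x would have zero entries in I, against the entry [sg] in slot
     i. *)
  move=> E0; have [_ /vanishing_flat vC] := cI; rewrite E0 in key.
  have /sub_selP := submx_trans (xVW x ex Fx Gx) (key _ vC).
  move=> /(_ i); rewrite inE negbK => /(_ iI); rewrite mxE eqxx => s0.
  by case: ss => s1; move: s0; rewrite s1 => /eqP; rewrite ?oppr_eq0 oner_eq0.
have [U [fU sU _ SU]] := H E Es Ep.
have Ey y : dom (pchart C c I i sg) y -> L' F y -> L' G y -> L' E y.
  move=> ey Fy Gy; apply/(lift_pchart cI iI ss Es EC fU SU ey).
  exact: submx_trans (xVW y ey Fy Gy) (key U fU).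
split=> //; split; first exact: Ey.
  by move=> y Ey'; split; [exact: (lift_mono Es EC Fs FC EF)|exact: (lift_mono Es EC Gs GC EG)].
apply: filterS (_ : nbhs x (dom (pchart C c I i sg))) => [y ey|]; first exact: Ey.
by apply: open_nbhs_nbhs; split=> //; exact: open_dom.
Qed.

Lemma family_blowup s' : (forall F, F \in s' -> F \in s /\ F <> C0) ->
  family (fun F => L' F) d s'.
Proof.
move=> ss; split=> [F /ss[Fs FC]|x|F G /ss[Fs FC] /ss[Gs GC] FG].
- split; last exact: lift_few.
  by apply: closed_lift => //; exact: closed_member.
- by have [c ac H] := lift_flat x; exists c => // F /ss[Fs FC]; exact: H.
have [_ _ ml] := fam; have [FG'|FG'] := ml F G Fs Gs FG; [left|right].
  exact: lift_mono.
apply: lift_dense_out => //; [exact: closed_member|exact: closed_member|exact: member_dense].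
Qed.

End BlowupStep.

Definition meeting (N : charted_space R n) (L : T -> set N) s : Prop :=
  forall p F G, F \in s -> G \in s -> L F p -> L G p -> exists2 E, E \in s & meets_in L E F G p.

Lemma meeting_blowup (N : charted_space R n) (L : T -> set N) d s C0 s' : good N ->
  family L d s -> C0 \in s ->
  (forall F, F \in s -> L C0 `<=` L F \/ L C0 `&` L F = set0) ->
  (forall F, F \in s -> F <> C0 -> L F `<=` L C0 -> L F = set0) ->
  (forall F, F \in s' <-> F \in s /\ F <> C0) ->
  meeting L s -> meeting (fun F => lift (L C0) (L F)) s'.
Proof.
move=> gN fam C0s hd least ss mt x F G /ss[Fs FC] /ss[Gs GC] Fx Gx.
have lC : locally_coords (L C0).
  have := family_submanifold gN fam C0s => H; have : p_submanifold (L C0) by exists (d C0).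
  by case/p_submanifold_coords.
have clC F' : F' \in s -> closed (L F') by move=> F's; have [cl _ _] := fam; have [] := cl F' F's.
have Fx' := lift_sub gN (clC C0 C0s) lC (clC F Fs) Fx.
have Gx' := lift_sub gN (clC C0 C0s) lC (clC G Gs) Gx.
have [E Es mE] := mt _ F G Fs Gs Fx' Gx'.
have [EC mE'] := lift_meets gN fam C0s hd least Es Fs Gs FC GC Fx Gx mE.
by exists E => //; exact/ss.
Qed.

(** The element that is locally the intersection of C0 and F lies in C0, and in an ordered
    enumeration with head C0 only C0 and the empty set do. *)
Lemma ordered_head (N : charted_space R n) (L : T -> set N) C0 s : uniq (C0 :: s) ->
  ordered L (C0 :: s) -> meeting L (C0 :: s) ->
  (forall F, F \in C0 :: s -> L C0 `<=` L F \/ L C0 `&` L F = set0) /\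
  (forall F, F \in C0 :: s -> F <> C0 -> L F `<=` L C0 -> L F = set0).
Proof.
move=> /= /andP[C0s us] ord mt; have C0m : C0 \in C0 :: s by rewrite inE eqxx.
have least F : F \in C0 :: s -> F <> C0 -> L F `<=` L C0 -> L F = set0.
  move=> Fs FC; apply: ord => //=; rewrite eqxx; case: eqP => // E.
  by case: FC.
split=> // F Fs; have [[p [Cp Fp]]|H] := pselect (exists p, L C0 p /\ L F p); last first.
  by right; apply/seteqP; split=> // p [Cp Fp]; case: H; exists p.
have [E Es [Ep EFG _]] := mt p C0 F C0m Fs Cp Fp.
have [<-|EC] := eqVneq E C0; first by left => q /EFG[].
have E0 : L E = set0 by apply: least => //; [exact/eqP|move=> q /EFG[]].
by rewrite E0 in Ep.
Qed.

Lemma closing_meeting (N : charted_space R n) (L : T -> set N) s : closing L s -> meeting L s.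
Proof. by move=> H p F G Fs Gs Fp Gp; have [E [Es _ mE]] := H p F G Fs Gs Fp Gp; exists E. Qed.

End Families.

(** * A centre crossing a family *)



Lemma closure_pchart_across (R : realType) n (N : charted_space R n) (C X : set N) c
    (I K : {set 'I_n}) i (sg : R) (x : blowup X) : good N -> closed X -> locally_coords X ->
  coords X c I -> i \in I -> sign sg -> vanishing c K C -> (forall i, i \in I -> i \notin K) ->
  dom (pchart X c I i sg) x ->
  closure (blowdown X @^-1` (C `\` X)) x <->
    forall j, j \in K -> crd (pchart X c I i sg) x 0 j = 0.
Proof.
move=> gN clX lX cI iI ss vK IK ex.
have dirE (w : 'rV[R]_n) : (lift_dir i sg w <= sel R (~: K))%MS <-> forall j, j \in K -> w 0 j = 0.
  split=> [/sub_selP H j jK|H].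
    have := H j; rewrite inE negbK => /(_ jK); rewrite mxE; case: eqP => // ji.
    by have := IK i iI; rewrite -ji jK.
  apply/sub_selP => j; rewrite inE negbK => jK; rewrite mxE; case: eqP => [ji|_]; last exact: H.
  by have := IK i iI; rewrite -ji jK.
rewrite -dirE; apply: closure_pchart => // y ey nXy; have [cy _] := ey.
rewrite dirE (vK _ cy) (pchart_blow cI iI ss ey).
have out j : j \in K -> blow I i sg (crd (pchart X c I i sg) y) 0 j = crd (pchart X c I i sg) y 0 j.
  move=> jK; have jI : j \notin I by apply/negP => /IK; rewrite jK.
  by rewrite mxE (negPf jI); case: eqP jI => // ->; rewrite iI.
by split=> H j jK; [rewrite -out//; exact: H|rewrite out//; exact: H].
Qed.

(** When C lies in the centre its lift is the full preimage: the equations in I collapse to the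
    single equation w_i = 0 of the front face. *)
Lemma lift_pchart_in (R : realType) n (N : charted_space R n) (C X : set N) c
    (I K : {set 'I_n}) i (sg : R) (x : blowup X) :
  coords X c I -> i \in I -> sign sg -> vanishing c K C -> dom (pchart X c I i sg) x ->
  C `<=` X -> I \subset K ->
  lift X C x <-> crd (pchart X c I i sg) x 0 i = 0 /\
    forall j, j \in K :\: I -> crd (pchart X c I i sg) x 0 j = 0.
Proof.
move=> cI iI ss vK ex CX IK'; set e := pchart X c I i sg in ex *; rewrite lift_in//; have [cx _] := ex.
have bE := pchart_blow cI iI ss ex.
have out j : j \in K :\: I -> blow I i sg (crd e x) 0 j = crd e x 0 j.
  rewrite inE => /andP[jI _]; rewrite mxE (negPf jI).
  by case: eqP jI => // ->; rewrite iI.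
have s0 : sg != 0 by case: ss => ->; rewrite ?oner_eq0// oppr_eq0 oner_eq0.
rewrite [X in X <-> _](_ : _ = C (blowdown X x))// (vK _ cx) bE; split=> [H|[H1 H2] j jK].
  split; last by move=> j jK; rewrite -out//; apply: H; move: jK; rewrite inE => /andP[].
  have := H i (fintype.subsetP IK' i iI); rewrite mxE eqxx => /eqP.
  by rewrite mulf_eq0 (negPf s0) => /eqP.
have [jI|jI] := boolP (j \in I); first by rewrite blowE// H1 mul0r.
by rewrite out ?H2// inE jI.
Qed.

Section Crossing.
Variables (R : realType) (n : nat) (T : eqType).
Implicit Types (s : seq T) (d : T -> nat).

(* S collects the coordinates used by the equations of the elements; C contains, or is
   transversal to, all the elements through p simultaneously. *)
Definition crosses (N : charted_space R n) (L : T -> set N) d (C : set N) (k : nat) s : Prop :=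
  [/\ closed C /\ few_components C,
      forall F, F \in s -> [/\ few_components (C `&` L F),
        C `<=` L F \/ C `<=` closure (C `\` L F) & L F `<=` closure (L F `\` C)] &
      forall p, C p -> exists c (K S : {set 'I_n}),
        [/\ adapted p c, vanishing c K C /\ #|K| = k,
            S \subset K \/ (forall i, i \in S -> i \notin K) &
            forall F, F \in s -> L F p -> exists V,
              [/\ flat c V (L F), splits (bdry c) V, \rank V = d F & supported S V]]].

Lemma crosses_submanifold (N : charted_space R n) (L : T -> set N) d C k s :
  crosses L d C k s -> p_submanifold C.
Proof.
move=> [[clC fC] _ H]; exists (n - k)%N; split=> // p Cp.
have [c [K [S [ac [vK cK] _ _]]]] := H p Cp; exists c, K; split=> //.
by rewrite cK subnKC// -cK -[X in (_ <= X)%N](card_ord n) max_card.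
Qed.

Lemma vanishing_corner_sub (N : charted_space R n) p c (I K : {set 'I_n}) (C X : set N) :
  good N -> adapted p c -> vanishing c K C -> vanishing c I X ->
  nbhs p [set q | C q -> X q] -> I \subset K.
Proof.
move=> gN ac /vanishing_flat vK /vanishing_flat vI nCX.
have sK : splits (bdry c) (sel R (~: K)).
  move=> j z jB /sub_selP zK; apply/sub_selP => k kK; rewrite mxE.
  by case: (j =P k) => [->|jk]; rewrite ?(zK k kK) ?mul0r// mxE; case: eqP; rewrite ?andbF ?mulr0// => _; case: eqP => [kj|]; rewrite ?mulr0//; case: jk.
have H := flat_sub gN ac sK vK vI nCX.
apply/fintype.subsetP => i iI; apply: contraT => iK.
have : (('e_i : 'rV[R]_n) <= sel R (~: I))%MS.
  apply: submx_trans H; apply/sub_selP => j; rewrite inE negbK => jK; rewrite mxE.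
  by case: eqP => //= ij; case: eqP => // ji; move: iK; rewrite -ji jK.
move=> /sub_selP/(_ i); rewrite inE negbK => /(_ iI); rewrite mxE !eqxx => /eqP.
by rewrite oner_eq0.
Qed.

Section CrossStep.
Variables (N : charted_space R n) (L : T -> set N) (d : T -> nat) (s : seq T) (X0 : T).
Hypotheses (gN : good N) (fam : family L d s) (X0s : X0 \in s).
Local Notation X := (L X0).
Hypothesis head : forall F, F \in s -> X `<=` L F \/ X `&` L F = set0.
Hypothesis least : forall F, F \in s -> F <> X0 -> L F `<=` X -> L F = set0.
Variables (C : set N) (k : nat).
Hypothesis cross : crosses L d C k s.
Local Notation beta := (blowdown X).
Local Notation L' F := (lift X (L F)).

Let clX : closed X. Proof. by have [cl _ _] := fam; have [] := cl X0 X0s. Qed.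
Let clC : closed C. Proof. by have [[]] := cross. Qed.

Let lX : locally_coords X.
Proof.
have := family_submanifold gN fam X0s => H; have : p_submanifold X by exists (d X0).
by case/p_submanifold_coords.
Qed.

Let gB : good (blowup X) := blowup_good gN clX lX.

(** Straightening X keeps C in coordinate form thanks to the alternative on S. That alternative is
    local, while containment of C in X is global; here the two are matched. *)
Lemma cross_chart p : C p -> X p -> exists c (I K : {set 'I_n}),
  [/\ adapted p c, coords X c I /\ (#|I| + d X0 = n)%N, vanishing c K C /\ #|K| = k,
    C `<=` X /\ I \subset K \/ C `<=` closure (C `\` X) /\ (forall i, i \in I -> i \notin K) &
    forall F, F \in s -> L F p -> exists V,
      [/\ flat c V (L F), splits (bdry c) V, \rank V = d F & supported I V]].
Proof.
move=> Cp Xp; have [_ CX H] := cross; have [c [K [S [ac [vK cK] SK HF]]]] := H p Cp.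
have [V [fV sV rV SV]] := HF X0 X0s Xp.
have [I [c' [ac' [_ bc'] vI cI [IS keep HW]]]] := straighten gN ac fV sV (@filterT _ _ _).
have vK' := keep S K C SV SK vK; have [mc' cp' _ _] := ac'.
exists c', I, K; split=> //.
- by split; [split|rewrite -rV].
- have [_ dich _] := CX X0 X0s.
  have [IK|IK] : I \subset K \/ (forall i, i \in I -> i \notin K).
    case: SK => SK; [left|right]; first exact: fintype.subset_trans (IS S SV) SK.
    by move=> i /(fintype.subsetP (IS S SV)); exact: SK.
  (* With I inside K, C lies in X near p, against the density of its part off X. *)
  + case: dich => dich; [by left|exfalso].
    have nd : nbhs p (dom c') by apply: open_nbhs_nbhs; split=> //; exact: open_dom.
    have [q [[Cq nXq] cq]] := dich p Cp _ nd.
    by apply: nXq; apply/vI => // i /(fintype.subsetP IK); exact: (vK' q cq).1.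
  + case: dich => dich; [left|by right]; split=> //.
    apply: (vanishing_corner_sub gN ac' vK' vI); apply: filterE => q; exact: dich.
move=> F Fs Fp; have [W [fW sW rW SW]] := HF F Fs Fp.
have [W' [fW' sW' rW' SW']] := HW (L F) W fW sW.
exists W'; split=> //; first by rewrite rW'.
apply: SW'; apply: (flat_sub gN ac sV fV fW).
have [XF|XF] := head Fs; first by apply: filterE => q; exact: XF.
by have : (X `&` L F) p by []; rewrite XF.
Qed.

Let nested : Prop := C `<=` X.

Section Chart.
Variables (c : chart R n N) (I K : {set 'I_n}) (i : 'I_n) (sg : R).
Hypotheses (cI : coords X c I) (iI : i \in I) (ss : sign sg) (vK : vanishing c K C).
Hypothesis IK : C `<=` X /\ I \subset K \/
  C `<=` closure (C `\` X) /\ (forall i, i \in I -> i \notin K).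
Hypothesis CX0 : exists2 p, dom c p & C p /\ X p.
Local Notation e := (pchart X c I i sg).

Lemma lift_pchart_across (x : blowup X) : dom e x -> C `<=` closure (C `\` X) ->
  (forall i, i \in I -> i \notin K) ->
  lift X C x <-> forall j, j \in K -> crd e x 0 j = 0.
Proof. by move=> ex CX IK'; rewrite lift_dense//; exact: closure_pchart_across. Qed.

(** One formula for the nested and the transversal case, in the shape required by [conical]. *)
Lemma lift_pchart_cross (x : blowup X) : dom e x -> lift X C x <->
  (nested -> crd e x 0 i = 0) /\ (lift_dir i sg (crd e x) <= sel R (~: (K :\: I)))%MS.
Proof.
move=> ex.
have dirE : (lift_dir i sg (crd e x) <= sel R (~: (K :\: I)))%MS <->
    forall j, j \in K :\: I -> crd e x 0 j = 0.
  have ne j : j \in K :\: I -> j == i = false.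
    by rewrite inE => /andP[jI _]; apply/eqP => ji; move: jI; rewrite ji iI.
  split=> [/sub_selP H j jK|H].
    by have := H j; rewrite inE negbK => /(_ jK); rewrite mxE ne.
  by apply/sub_selP => j; rewrite inE negbK => jK; rewrite mxE ne//; exact: H.
rewrite dirE; case: IK => -[CX IK'].
  by rewrite (lift_pchart_in cI iI ss vK ex CX IK'); split=> -[H1 H2]; split=> //; exact: H1.
rewrite lift_pchart_across//.
have KI : K :\: I = K.
  apply/finset.setP => j; rewrite inE; case: (boolP (j \in K)) => jK; last by rewrite andbF.
  by rewrite andbT; apply/negP => /IK'; rewrite jK.
rewrite KI; split=> [H|[_ //]]; split=> // nst; exfalso.
have [p cp [Cp Xp]] := CX0; have := CX p Cp.
have E : C `\` X = set0 by apply/seteqP; split=> // q [Cq]; case; exact: nst.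
by rewrite E closure0.
Qed.

End Chart.

(** Here nesting turns into transversality. If C lies in X, its lift has equations in i and K minus
    I, whereas the lifts of the other elements have theirs in I minus i. No coordinate is shared any
    more, and #|I| of the k equations are replaced by one. *)
Lemma lift_cross_chart x : lift X C x -> X (beta x) ->
  exists e (K S : {set 'I_n}), [/\ adapted x e,
    vanishing e K (lift X C) /\ #|K| = (if `[< nested >] then (k - (n - d X0)).+1 else k),
    forall i, i \in S -> i \notin K &
    forall F, F \in s -> F <> X0 -> L' F x -> exists V,
      [/\ flat e V (L' F), splits (bdry e) V, \rank V = d F & supported S V]].
Proof.
move=> Cx Xx; have Cx' := lift_sub gN clX lX clC Cx.
have [c [I [K [ac [cI I_dim] [vK cK] IK HF]]]] := cross_chart Cx' Xx.
have [mc cx c0 _] := ac.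
have [i [sg [iI ss vs ex]]] := pchart_cover gN cI cx.
have me := pchart_mchart gN clX cI iI ss.
have [e [ae de be eE]] := adapted_shift gB me ex (@filterT _ _ _).
have CX0 : exists2 p, dom c p & C p /\ X p by exists (beta x).
pose K1 := if `[< nested >] then i |: (K :\: I) else K.
have K1P y : dom (pchart X c I i sg) y ->
    lift X C y <-> forall j, j \in K1 -> crd (pchart X c I i sg) y 0 j = 0.
  move=> ey; rewrite /K1; case: asboolP => nst.
    have IK' : I \subset K.
      case: IK => -[] // CX _; exfalso; have E : C `\` X = set0.
        by apply/seteqP; split=> // q [Cq]; case; exact: nst.
      by have := CX _ Cx'; rewrite E closure0.
    rewrite (lift_pchart_in cI iI ss vK ey nst IK').
    split=> [[H1 H2] j|H]; first by rewrite in_setU1 => /predU1P[->|]; [|exact: H2].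
    by split=> [|j jK]; apply: H; rewrite in_setU1 ?eqxx// jK orbT.
  by case: IK => -[CX IK]; [case: nst|exact: (lift_pchart_across cI iI ss vK ey CX IK)].
exists e, K1, (I :\ i); split=> //.
- split.
    move=> y ey; have [dy _] := de y ey; rewrite (K1P y dy).
    have x0 := (K1P x ex).1 Cx.
    split=> H j jK; first by rewrite eE// [LHS]mxE H// add0r [LHS]mxE x0// oppr0.
    by have := H j jK; rewrite eE// [LHS]mxE [X in _ + X]mxE x0// subr0.
  rewrite /K1; case: asboolP => nst //.
  have IK' : I \subset K by case: IK => -[] // CX IK; apply: (vanishing_corner_sub gN ac vK cI.2); apply: filterE => q; exact: nst.
  rewrite cardsU1 inE iI /= cardsD (finset.setIidPr IK') cK.
  have -> : (n - d X0 = #|I|)%N by rewrite -[in LHS]I_dim addnK.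
  by [].
- move=> j; rewrite !inE => /andP[ji jI]; rewrite /K1; case: asboolP => nst.
    by rewrite !inE negb_or ji jI.
  case: IK => -[CX IK]; last exact: IK.
  by case: nst.
move=> F Fs FX Fx; have Fx' := lift_sub gN clX lX (closed_member fam Fs) Fx.
have [V [fV sV rV SV]] := HF F Fs Fx'.
have [||V' [fV' sV' rV' SV']] := flat_shift ss ex Fx
  (fun y => lift_pchart gN fam X0s least cI iI ss Fs FX fV SV (x := y)) sV _ (e' := e).
- by rewrite be; apply/fintype.subsetP => j; rewrite inE => /andP[].
- by move=> y ey; have [? _] := de y ey; split=> //; exact: eE.
by exists V'; split=> //; [rewrite rV'|exact: SV'].
Qed.

(** Shared by the lift of C and its intersections with other lifts: they differ only in D and the
    additional equations W. *)
Lemma lift_cross_few (D : set N) (G : set (blowup X)) : closed D -> few_components D ->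
  D `<=` C -> few_components (D `&` X) -> (forall x, G x -> D (beta x)) ->
  (forall x, ~ X (beta x) -> D (beta x) -> G x) ->
  (forall p, D p -> ~ X p -> exists c V, [/\ adapted p c & flat c V D]) ->
  (forall p c (I K : {set 'I_n}), D p -> X p -> adapted p c -> coords X c I -> vanishing c K C ->
    C `<=` X /\ I \subset K \/ C `<=` closure (C `\` X) /\ (forall i, i \in I -> i \notin K) ->
    (forall F, F \in s -> L F p -> exists V,
      [/\ flat c V (L F), splits (bdry c) V, \rank V = d F & supported I V]) ->
    exists W, [/\ supported I W, forall q, dom c q -> D q -> (crd c q <= W)%MS &
      forall i sg x, i \in I -> sign sg -> dom (pchart X c I i sg) x ->
        G x <-> lift X C x /\ (lift_dir i sg (crd (pchart X c I i sg) x) <= W)%MS]) ->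
  few_components G.
Proof.
move=> clD fD DC fDX GD DG loc con; apply: (few_lift gN clX lX fD fDX GD DG) => p Dp.
  move=> nXp; have [c [V [ac fV]]] := loc p Dp nXp.
  exact: (locally_connected_flat gN ac fV Dp (closed_complement clX nXp)).
move=> Xp; have [c [I [K [ac [cI _] [vK _] IK HF]]]] := cross_chart (DC p Dp) Xp.
have [mc cp _ _] := ac.
have [W [SW DW GE]] := con p c I K Dp Xp ac cI vK IK HF.
have CX0 : exists2 p, dom c p & C p /\ X p by exists p => //; split=> //; exact: DC.
exists c, I, (sel R (~: (K :\: I)) :&: W)%MS, nested; split=> //.
- move=> z; rewrite !sub_capmx => /andP[zK zW]; apply/andP; split.
    apply/sub_selP => j; rewrite inE negbK => jK; rewrite mxE.
    by move: jK; rewrite inE => /andP[/negPf ->].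
  exact: supported_part SW _ zW.
- move=> q cq Dq _; rewrite sub_capmx; apply/andP; split; last exact: DW.
  apply/sub_selP => j; rewrite inE negbK inE => /andP[_ jK].
  by apply: (vK q cq).1 => //; exact: DC.
move=> i sg x iI ss vs ex; rewrite (GE i sg x)// (lift_pchart_cross cI iI ss vK IK CX0 ex).
by rewrite sub_capmx; split=> [[[? ->] ->]|[? /andP[? ?]]].
Qed.

Let closed_L F : F \in s -> closed (L F) := fun Fs => closed_member fam Fs.

Lemma cross_flat p : C p -> exists c (V : 'M[R]_n), [/\ adapted p c, flat c V C &
  forall F, F \in s -> L F p -> exists W : 'M[R]_n, flat c W (L F)].
Proof.
move=> Cp; have [_ _ H] := cross; have [c [K [S [ac [/vanishing_flat vK _] _ HF]]]] := H p Cp.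
exists c, (sel R (~: K)); split=> // F Fs Fp.
by have [V [fV _ _ _]] := HF F Fs Fp; exists V.
Qed.

Lemma lift_out_C x : ~ X (beta x) -> C (beta x) -> lift X C x.
Proof. by move=> nX Cx; apply/lift_out. Qed.

Lemma lift_center_few : few_components (lift X C).
Proof.
have [[_ fC] CX _] := cross; have [fCX _ _] := CX X0 X0s.
apply: (lift_cross_few (D := C)) => //.
- by move=> x; exact: lift_sub.
- exact: lift_out_C.
- by move=> p Cp _; have [c [V [ac fV _]]] := cross_flat Cp; exists c, V.
move=> p c I K Cp Xp ac cI vK IK HF; exists 1%:M; split.
- by move=> j _; exact: submx1.
- by move=> q _ _; exact: submx1.
by move=> i sg x _ _ _; split=> [|[]]; rewrite ?submx1.
Qed.

Lemma lift_meet_few F : F \in s -> F <> X0 -> few_components (lift X C `&` L' F).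
Proof.
move=> Fs FX; have [[_ fC] CX _] := cross; have [fCX _ _] := CX X0 X0s.
have [fCF _ _] := CX F Fs.
apply: (lift_cross_few (D := C `&` L F)) => //.
- by apply: closedI => //; exact: closed_L.
- have [XF|XF] := head Fs.
    rewrite (_ : _ `&` X = C `&` X)//; apply/seteqP; split=> p [].
      by move=> [].
    by move=> Cp Xp; split=> //; split=> //; exact: XF.
  rewrite -setIA [L F `&` X]setIC XF setI0; exact: (@few_points _ _ [::]).
- move=> x [Cx Fx]; split; first exact: (lift_sub gN clX lX clC Cx).
  exact: (lift_sub gN clX lX (closed_L Fs) Fx).
- move=> x nX [Cx Fx]; split; first exact: lift_out_C.
  by apply/lift_out => //; exact: closed_L.
- move=> p [Cp Fp] _; have [c [V [ac fV H]]] := cross_flat Cp.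
  by have [W fW] := H F Fs Fp; exists c, (V :&: W)%MS; split=> //; exact: flat_cap.
move=> p c I K [Cp Fp] Xp ac cI vK IK HF; have [V [fV sV rV SV]] := HF F Fs Fp.
exists V; split=> // [q cq [_ Fq]|i sg x iI ss ex]; first exact/fV.
rewrite -(lift_pchart gN fam X0s least cI iI ss Fs FX fV SV ex).
by split=> -[].
Qed.

Lemma flat_full c (V : 'M[R]_n) (Y : set N) : flat c V Y -> \rank V = n -> dom c `<=` Y.
Proof.
move=> fV rV q cq; apply/fV => //; apply: submx_trans (submx1 _) _.
by rewrite sub1mx /row_full rV.
Qed.

(** The alternative is global, so in the nested case it is decided by dimension. An F of dimension n
    that contains X is a neighbourhood of X, and its lift contains all of the front face. Otherwise
    F has an equation independent of those of the lift of C. *)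
Lemma lift_dichotomy F : F \in s -> F <> X0 ->
  lift X C `<=` L' F \/ lift X C `<=` closure (lift X C `\` L' F).
Proof.
move=> Fs FX; have [_ CX _] := cross; have [_ CX0 _] := CX X0 X0s; have [_ CF _] := CX F Fs.
have FXd := member_dense fam X0s least Fs FX.
have [nst|nnst] := pselect nested; last first.
  have {}CX0 : C `<=` closure (C `\` X) by case: CX0.
  case: CF => CF; [left|right]; last by apply: lift_dense_out => //; exact: closed_L.
  rewrite (lift_dense CX0) (lift_dense FXd); apply: closureS => x [Cx nX].
  by split=> //; exact: CF.
have inX x : lift X C x -> X (beta x).
  by move=> Cx; apply: nst; exact: (lift_sub gN clX lX clC Cx).
have [XF|XF] := head Fs; last first.
  right => x Cx; apply: subset_closure; split=> // Fx.
  have : (X `&` L F) (beta x) by split; [exact: inX|exact: (lift_sub gN clX lX (closed_L Fs) Fx)].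
  by rewrite XF.
have dFn x : lift X C x -> (d F <= n)%N.
  move=> /inX Xx; have [_ ch _] := fam; have [c ac H] := ch (beta x).
  by have [V [_ _ <-]] := H F Fs (XF _ Xx); exact: rank_leq_col.
have [dF|dF] := eqVneq (d F) n.
  left=> x Cx; rewrite (lift_dense FXd) => U nU.
  have Xx := inX x Cx; have [_ ch _] := fam; have [c ac H] := ch (beta x).
  have [V [fV _ rV]] := H F Fs (XF _ Xx); have [mc cx _ _] := ac.
  have nc : nbhs x (beta @^-1` dom c).
    apply: (blowdown_continuous gN clX lX); apply: open_nbhs_nbhs; split=> //; exact: open_dom.
  have [y [nXy [Uy cy]]] := dense_out gN clX lX (filterI nU nc).
  exists y; split=> //; split=> //; apply: (flat_full fV) => //; by rewrite rV.
right=> x Cx; have [Fx|nFx] := pselect (L' F x); last exact: subset_closure.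
have [e [K [S [ae [vK _] SK HF]]]] := lift_cross_chart Cx (inX x Cx).
have [V [fV sV rV SV]] := HF F Fs FX Fx.
(* If V contained these axes too it would be everything. Moving along e_j leaves the lift of F but
   not the lift of C. *)
have [j jS jV] : exists2 j, j \in S & ~~ (('e_j : 'rV[R]_n) <= V)%MS.
  apply: contrapT => H; case/eqP: dF; rewrite -rV; apply/eqP.
  suff : row_full V by [].
  rewrite -sub1mx; apply/row_subP => j; rewrite row1; have [jS|jS] := boolP (j \in S); last exact: SV.
  by apply: contrapT => /negP nj; apply: H; exists j.
move=> U nU; have ej : corner (bdry e) ('e_j : 'rV[R]_n).
  by move=> i _; rewrite mxE eqxx /=; case: eqP.
have [t t0 [y [ey Uy yE]]] := adapted_point gB ae nU ej.
exists y; split=> //; split.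
  apply/(vK y ey) => i iK; rewrite yE !mxE eqxx /=; case: eqP => [ij|]; last by rewrite mulr0.
  by have := SK j jS; rewrite -ij iK.
move=> /(fV y ey); rewrite yE => /(scalemx_sub t^-1).
by rewrite scalerA mulVf ?gt_eqF// scale1r (negPf jV).
Qed.

Theorem crosses_blowup s' : (forall F, F \in s' -> F \in s /\ F <> X0) ->
  crosses (fun F => L' F) d (lift X C) (if `[< nested >] then (k - (n - d X0)).+1 else k) s'.
Proof.
move=> ss; have [_ CX H] := cross; split.
- by split; [exact: closed_lift|exact: lift_center_few].
- move=> F /ss[Fs FX]; split; [exact: lift_meet_few|exact: lift_dichotomy|].
  have [_ _ FC] := CX F Fs.
  by apply: lift_dense_out => //; [exact: closed_L|exact: (member_dense fam X0s least)].
move=> x Cx; have [Xx|nXx] := pselect (X (beta x)).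
  have [e [K [S [ae vK SK HF]]]] := lift_cross_chart Cx Xx.
  exists e, K, S; split=> //; first by right.
  by move=> F /ss[Fs FX]; exact: HF.
have Cx' := lift_sub gN clX lX clC Cx.
have [c [K [S [[mc cx c0 _] [vK cK] SK HF]]]] := H _ Cx'.
have ex : dom (cchart X c) x by [].
have me := cchart_mchart gN clX mc.
have [e [ae de be eE]] := adapted_shift gB me ex (@filterT _ _ _).
have {}eE y : dom e y -> crd e y = crd c (beta y) by move=> ey; rewrite eE//= c0 subr0.
exists e, K, S; split=> //.
- split; first by move=> y ey; have [[cy nXy] _] := de y ey; rewrite lift_out// eE//; exact: vK.
  by case: asboolP => // nst; case: nXx; exact: nst.
move=> F /ss[Fs FX] Fx; have [V [fV sV rV SV]] := HF F Fs (lift_sub gN clX lX (closed_L Fs) Fx).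
exists V; split=> //.
  by move=> y ey; have [[cy nXy] _] := de y ey; rewrite lift_out ?eE//; [exact: fV|exact: closed_L].
by apply: splits_sub sV; rewrite be; apply/fintype.subsetP => j; rewrite inE => /andP[].
Qed.

End CrossStep.
End Crossing.

(** * Commuting two blow-ups *)



Section TwoBlowups.
Variables (R : realType) (n : nat) (N : charted_space R n).
Hypothesis gN : good N.
Implicit Types (C X Q S : set N) (p q : N) (c : chart R n N) (I K : {set 'I_n}).

Definition blowdown2 C X (x : blowup (lift C X)) : N := blowdown C (blowdown (lift C X) x).

Lemma coords_near X p (A : set N) : closed X -> locally_coords X -> X p -> nbhs p A ->
  exists c I, [/\ dom c p, coords X c I & dom c `<=` A].
Proof.
move=> clX lX Xp nA; have [c [I [cp [mc vI]]]] := lX p Xp.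
have [c' [[mc' cp' _ _] dc' _ cE]] := adapted_shift gN mc cp nA.
exists c', I; split=> //; last by move=> q /dc'[].
split=> // q cq; have [dq _] := dc' q cq; rewrite (vI q dq).
have p0 := (vI p cp).1 Xp.
split=> H i iI; first by rewrite cE// !mxE H// p0// subr0.
by have := H i iI; rewrite cE// !mxE p0// subr0.
Qed.

(** In positive codimension every point of the centre carries a normal ray; codimension 0 is the
    exception that [swap_mode] allows for. *)
Lemma blowdown_onto C c K p : coords C c K -> K != finset.set0 -> dom c p -> C p ->
  exists x : blowup C, blowdown C x = p.
Proof.
move=> cK /set0Pn[k kK] cp Cp; have [mc vK] := cK; have z0 := (vK p cp).1 Cp.
have bE : blow K k 1 (crd c p) = crd c p.
  apply/rowP => j; have [jK|jK] := boolP (j \in K).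
    by rewrite blowE// (z0 k kK) mul0r z0.
  by rewrite mxE (negPf jK); case: eqP jK => // ->; rewrite kK.
have [||x ex xE] := @pchart_image _ _ _ gN C c K k 1 cK kK (or_introl erefl) (crd c p) (or_introl erefl).
- move=> j; rewrite in_setU1 => /predU1P[->|jB]; first by rewrite (z0 k kK).
  exact: (mchart_corner mc cp).
- by exists p.
exists x; have [cx _] := ex; apply: (mchart_inj mc) => //.
by rewrite (pchart_blow cK kK (or_introl erefl) ex) xE bE.
Qed.

Lemma preimage_closure C S : closed C -> locally_coords C -> S `<=` C ->
  blowdown C @^-1` closure S = closure (blowdown C @^-1` S).
Proof.
move=> clC lC SC; apply/seteqP; split=> x; first exact: closure_preimage.
exact: closure_blowdown.
Qed.

Lemma across_coords C X c I K k t : closed C -> locally_coords C ->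
  lift C X = blowdown C @^-1` X -> coords X c I -> coords C c K ->
  (forall j, j \in I -> j \notin K) -> k \in K -> sign t ->
  coords (lift C X) (pchart C c K k t) I.
Proof.
move=> clC lC X1E [mc vI] cK IK kK st; split; first exact: pchart_mchart.
move=> q eq; have [cq _] := eq; rewrite X1E [X in X <-> _](_ : _ = X (blowdown C q))// (vI _ cq).
have out j : j \in I -> crd c (blowdown C q) 0 j = crd (pchart C c K k t) q 0 j.
  move=> jI; rewrite (pchart_blow cK kK st eq) mxE (negPf (IK j jI)).
  by case: eqP jI => // -> /IK; rewrite kK.
by split=> H j jI; [rewrite -out//|rewrite out//]; exact: H.
Qed.

Section Order.
Variables C X : set N.
Hypotheses (pC : p_submanifold C) (clX : closed X) (pX1 : p_submanifold (lift C X)).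
Local Notation X1 := (lift C X).
Let clC : closed C := (p_submanifold_coords pC).1.
Let lC : locally_coords C := (p_submanifold_coords pC).2.
Let clX1 : closed X1 := (p_submanifold_coords pX1).1.
Let lX1 : locally_coords X1 := (p_submanifold_coords pX1).2.
Let gC : good (blowup C) := blowup_good gN clC lC.

Lemma blowdown2_dense (x : blowup X1) : closure (@blowdown2 C X @^-1` (~` C `&` ~` X)) x.
Proof.
have : closure (blowdown X1 @^-1` (~` X1)) x by exact: dense_out.
apply: closure_least; first exact: closed_closure.
move=> {}x nX1; apply: (closure_out gC clX1 lX1 nX1 (A := blowdown C @^-1` (~` C `&` ~` X))).
have dC : closure (blowdown C @^-1` (~` C)) (blowdown X1 x) by exact: dense_out.
have := closure_near dC (closed_complement clX1 nX1).
apply: closureS => y [nCy nX1y]; split=> // Xy; apply: nX1y; exact/lift_out.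
Qed.

Lemma blowdown2_inj (x x' : blowup X1) : (~` C `&` ~` X) (blowdown2 x) ->
  blowdown2 x = blowdown2 x' -> x = x'.
Proof.
move=> [nC nX] xx'; apply: blowdown_inj.
  by move=> X1x; apply: nX; exact: (lift_sub gN clC lC clX X1x).
exact: blowdown_inj.
Qed.

(** The right-hand side removes both centres before taking one closure, so it serves equally for the
    other order of blowing up. *)
Lemma lift2_dense Q : closed Q -> Q `<=` closure ((Q `\` C) `\` X) ->
  lift C Q `<=` closure (lift C Q `\` X1) ->
  lift X1 (lift C Q) = closure (@blowdown2 C X @^-1` ((Q `\` C) `\` X)).
Proof.
move=> clQ dQ dQ'; rewrite (lift_dense dQ').
have QC : Q `<=` closure (Q `\` C).
  by move=> q /dQ; apply: closureS => ? [].
apply/seteqP; split; apply: closure_least; try exact: closed_closure.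
  move=> y [Q'y nX1]; apply: (closure_out gC clX1 lX1 nX1 (A := blowdown C @^-1` ((Q `\` C) `\` X))).
  rewrite (lift_dense QC) in Q'y.
  have := closure_near Q'y (closed_complement clX1 nX1).
  apply: closureS => z [[Qz nCz] nX1z]; split=> // Xz; apply: nX1z; exact/lift_out.
move=> y [[Qy nCy] nXy]; apply: subset_closure; split; first exact/lift_out.
by move=> X1y; apply: nXy; exact: (lift_sub gN clC lC clX X1y).
Qed.

Lemma lift_dense2 Q : closed Q -> Q `<=` closure (Q `\` C) ->
  lift C Q `<=` closure (lift C Q `\` X1) -> Q `<=` closure ((Q `\` C) `\` X).
Proof.
move=> clQ QC dQ' q /QC; apply: closure_least; first exact: closed_closure.
move=> {}q [Qq nCq]; have [x xq] := blowdown_out nCq.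
have Q'x : lift C Q x by apply/lift_out; rewrite ?xq.
have nC : ~ C (blowdown C x) by rewrite xq.
have nCx : nbhs x (blowdown C @^-1` (~` C)).
  by apply: (blowdown_continuous gN clC lC); exact: closed_complement.
rewrite -xq; apply: (@closure_blowdown _ _ _ gN _ clC lC).
have := closure_near (dQ' x Q'x) nCx; apply: closureS => y [[Q'y nX1y] nCy].
split; first by split=> //; apply: (lift_sub gN clC lC clQ Q'y).
by move=> Xy; apply: nX1y; exact/lift_out.
Qed.

End Order.

Section Pairs.
Variables C X : set N.
Hypotheses (pC : p_submanifold C) (pX : p_submanifold X).
Hypotheses (pX1 : p_submanifold (lift C X)) (pC1 : p_submanifold (lift X C)).
Local Notation X1 := (lift C X).
Local Notation C1 := (lift X C).
Let clC : closed C := (p_submanifold_coords pC).1.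
Let lC : locally_coords C := (p_submanifold_coords pC).2.
Let clX : closed X := (p_submanifold_coords pX).1.
Let lX : locally_coords X := (p_submanifold_coords pX).2.
Let clX1 : closed X1 := (p_submanifold_coords pX1).1.
Let lX1 : locally_coords X1 := (p_submanifold_coords pX1).2.
Let clC1 : closed C1 := (p_submanifold_coords pC1).1.
Let lC1 : locally_coords C1 := (p_submanifold_coords pC1).2.
Let gC : good (blowup C) := blowup_good gN clC lC.
Let gX : good (blowup X) := blowup_good gN clX lX.

Definition matching (e1 : chart R n (blowup X1)) (e2 : chart R n (blowup C1)) :=
  matched (@blowdown2 C X) (@blowdown2 X C) e1 e2.

Lemma both_off_pair c : mchart c -> (forall q, dom c q -> ~ C q /\ ~ X q) ->
  matching (cchart X1 (cchart C c)) (cchart C1 (cchart X c)).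
Proof.
move=> mc off; apply: (matched_over id (c := c) (phi := id \o id)) => //.
- by apply: cchart_mchart => //; exact: cchart_mchart.
- by apply: cchart_mchart => //; exact: cchart_mchart.
- apply: over_comp; last by apply: over_cchart => q /off[].
  apply: over_cchart => q [cq _] X1q; have [_] := off _ cq; apply.
  exact: (lift_sub gN clC lC clX X1q).
- apply: over_comp; last by apply: over_cchart => q /off[].
  apply: over_cchart => q [cq _] C1q; have [+ _] := off _ cq; apply.
  exact: (lift_sub gN clX lX clC C1q).
Qed.

Lemma off_pair c I i s : (forall q, dom c q -> ~ C q) -> coords X c I -> i \in I -> sign s ->
  valid c i s -> coords X1 (cchart C c) I /\
  matching (pchart X1 (cchart C c) I i s) (cchart C1 (pchart X c I i s)).
Proof.
move=> off cI iI ss vs; have [mc vI] := cI.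
have cI' : coords X1 (cchart C c) I.
  split; first exact: cchart_mchart.
  by move=> q [cq nCq]; rewrite lift_out//; exact: vI.
split=> //; apply: (matched_over id (c := c) (phi := blow I i s)) => //.
- exact: pchart_mchart.
- by apply: cchart_mchart => //; exact: pchart_mchart.
- by apply: (over_comp (phi' := blow I i s) (phi := id)); [exact: over_pchart|exact: over_cchart].
apply: (over_comp (phi' := id) (phi := blow I i s)); last exact: over_pchart.
apply: over_cchart => q [cq _] C1q; apply: (off _ cq).
exact: (lift_sub gN clX lX clC C1q).
Qed.

Lemma off_cover : (forall x : blowup X1, ~ C (blowdown2 x) ->
    exists e1 e2, dom e1 x /\ matching e1 e2) /\
  (forall y : blowup C1, ~ C (blowdown2 y) -> exists e1 e2, dom e2 y /\ matching e1 e2).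
Proof.
have charts p : ~ C p -> ~ X p -> exists c, [/\ mchart c, dom c p & forall q, dom c q -> ~ C q /\ ~ X q].
  move=> nC nX; have [c mc cp] := mchart_cover gN p.
  have nA : nbhs p (~` C `&` ~` X) by apply: filterI; exact: closed_complement.
  have [c' [[mc' cp' _ _] dc' _ _]] := adapted_shift gN mc cp nA.
  by exists c'; split=> // q /dc'[_].
split=> x nC; have [Xx|nX] := pselect (X (blowdown2 x)).
- have [c [I [cp cI off]]] := coords_near clX lX Xx (closed_complement clC nC).
  have cx : dom (cchart C c) (blowdown X1 x) by [].
  have cI' : coords X1 (cchart C c) I.
    split; first by apply: cchart_mchart => //; case: cI.
    by move=> q [cq nCq]; rewrite lift_out//; case: cI => _; apply.
  have [i [s [iI ss vs ex]]] := pchart_cover gC cI' cx.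
  exists (pchart X1 (cchart C c) I i s), (cchart C1 (pchart X c I i s)); split=> //.
  by have [] := off_pair off cI iI ss vs.
- have [c [mc cp off]] := charts _ nC nX.
  exists (cchart X1 (cchart C c)), (cchart C1 (cchart X c)); split; last exact: both_off_pair.
  by split=> // X1x; apply: nX; exact: (lift_sub gN clC lC clX X1x).
- have [c [I [cp cI off]]] := coords_near clX lX Xx (closed_complement clC nC).
  have [i [s [iI ss vs ex]]] := pchart_cover gN cI cp.
  exists (pchart X1 (cchart C c) I i s), (cchart C1 (pchart X c I i s)); split; last first.
    by have [] := off_pair off cI iI ss vs.
  by split=> // C1x; apply: nC; exact: (lift_sub gN clX lX clC C1x).
- have [c [mc cp off]] := charts _ nC nX.
  exists (cchart X1 (cchart C c)), (cchart C1 (cchart X c)); split; last exact: both_off_pair.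
  by split=> // C1x; apply: nC; exact: (lift_sub gN clX lX clC C1x).
Qed.

(** The two blow-down formulas act on disjoint sets of coordinates, so they commute. *)
Lemma transversal_pair c I K i s k t : coords X c I -> coords C c K ->
  (forall j, j \in I -> j \notin K) -> coords X1 (pchart C c K k t) I ->
  coords C1 (pchart X c I i s) K -> i \in I -> k \in K -> sign s -> sign t ->
  valid c i s -> valid c k t ->
  matching (pchart X1 (pchart C c K k t) I i s) (pchart C1 (pchart X c I i s) K k t).
Proof.
move=> cI cK IK cI' cK' iI kK ss st vs vt.
have ik : i != k by apply: contraTneq iI => ->; apply/negP => /IK; rewrite kK.
have vs' : valid (pchart C c K k t) i s.
  by case: vs => [|iB]; [left|right; rewrite in_setU1 negb_or ik].
have vt' : valid (pchart X c I i s) k t.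
  by case: vt => [|kB]; [left|right; rewrite in_setU1 negb_or eq_sym ik].
apply: (matched_over id (c := c) (phi := blow K k t \o blow I i s)).
- exact: pchart_mchart.
- exact: pchart_mchart.
- by case: cI.
- by rewrite /= finset.setUCA.
- by apply: over_comp; [exact: over_pchart|exact: over_pchart].
apply: (over_ext (phi := blow I i s \o blow K k t)); last first.
  by apply: over_comp; [exact: over_pchart|exact: over_pchart].
have iK := IK i iI; have kI : k \notin I by apply/negP => /IK; rewrite kK.
move=> w; apply/rowP => j; rewrite !mxE ?eqxx (negPf ik) (negPf iK) (negPf kI) [k == i]eq_sym (negPf ik).
have [->|ji] := eqVneq j i; first by rewrite (negPf ik) (negPf iK).
have [->|jk] := eqVneq j k; first by rewrite (negPf kI).
have [jI|jI] := boolP (j \in I); last by [].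
by rewrite (negPf (IK j jI)).
Qed.

(** In both composites the coordinates in K apart from k gain the factor w_k, and those in I apart
    from i gain w_i as well. *)
Lemma nested_pair c I K i s k t : coords X c I -> coords C c K -> I \subset K ->
  coords X1 (pchart C c K k t) I -> coords C1 (pchart X c I i s) (i |: (K :\: I)) ->
  i \in I -> k \in K -> k \notin I -> sign s -> sign t -> valid c i s -> valid c k t ->
  matching (pchart X1 (pchart C c K k t) I i s)
    (pchart C1 (pchart X c I i s) (i |: (K :\: I)) k t).
Proof.
move=> cI cK IK cI' cK' iI kK kI ss st vs vt.
have ik : i != k by apply: contraNneq kI => <-.
have vs' : valid (pchart C c K k t) i s.
  by case: vs => [|iB]; [left|right; rewrite in_setU1 negb_or ik].
have vt' : valid (pchart X c I i s) k t.
  by case: vt => [|kB]; [left|right; rewrite in_setU1 negb_or eq_sym ik].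
have kK1 : k \in i |: (K :\: I) by rewrite !inE kI kK orbT.
apply: (matched_over id (c := c) (phi := blow K k t \o blow I i s)).
- exact: pchart_mchart.
- exact: pchart_mchart.
- by case: cI.
- by rewrite /= finset.setUCA.
- by apply: over_comp; [exact: over_pchart|exact: over_pchart].
apply: (over_ext (phi := blow I i s \o blow (i |: (K :\: I)) k t)); last first.
  by apply: over_comp; [exact: over_pchart|exact: over_pchart].
have iK := fintype.subsetP IK i iI.
move=> w; apply/rowP => j; rewrite !mxE !inE !eqxx (negPf ik) iK (negPf kI) [k == i]eq_sym (negPf ik) /=.
have [->|ji] := eqVneq j i; first by rewrite (negPf ik) iK mulrA.
have [->|jk] := eqVneq j k; first by rewrite (negPf kI).
have [jI|jI] := boolP (j \in I); last by rewrite /=.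
by rewrite (fintype.subsetP IK j jI) /= mulrA.
Qed.

(** Where the direction of the ray normal to C has its index in I, the lift of X is absent. The
    single blow-up of C there equals the blow-up of X followed by that of the lift of C in the front
    face direction i. *)
Lemma nested_pair_in c I K i s : coords X c I -> coords C c K -> I \subset K ->
  (forall x, dom (pchart C c K i s) x -> ~ X1 x) ->
  coords C1 (pchart X c I i s) (i |: (K :\: I)) -> i \in I -> sign s -> valid c i s ->
  matching (cchart X1 (pchart C c K i s)) (pchart C1 (pchart X c I i s) (i |: (K :\: I)) i 1).
Proof.
move=> cI cK IK off cK' iI ss vs; have iK := fintype.subsetP IK i iI.
have iK1 : i \in i |: (K :\: I) by rewrite in_setU1 eqxx.
have s1 : sign (1 : R) by left.
have v1 : valid (pchart X c I i s) i 1 by left.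
apply: (matched_over id (c := c) (phi := blow K i s \o id)).
- by apply: cchart_mchart => //; exact: pchart_mchart.
- exact: pchart_mchart.
- by case: cI.
- by rewrite /= finset.setUA finset.setUid.
- by apply: over_comp; [exact: over_cchart|exact: over_pchart].
apply: (over_ext (phi := blow I i s \o blow (i |: (K :\: I)) i 1)); last first.
  by apply: over_comp; [exact: over_pchart|exact: over_pchart].
move=> w; apply/rowP => j; rewrite !mxE !inE !eqxx /= mul1r.
have [//|ji] := eqVneq j i.
have [jI|jI] := boolP (j \in I); last by rewrite /=.
by rewrite (fintype.subsetP IK j jI).
Qed.

Lemma nested_lift c I K k t (q : blowup C) : X `<=` closure (X `\` C) -> vanishing c I X -> coords C c K ->
  I \subset K -> k \in K -> sign t -> dom (pchart C c K k t) q ->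
  X1 q <-> forall j, j \in I -> lift_dir k t (crd (pchart C c K k t) q) 0 j = 0.
Proof.
move=> XC /vanishing_flat vI cK IK kK st eq; rewrite (lift_dense XC).
have -> : (forall j, j \in I -> lift_dir k t (crd (pchart C c K k t) q) 0 j = 0) <->
    (lift_dir k t (crd (pchart C c K k t) q) <= sel R (~: I))%MS.
  split=> [H|/sub_selP H j jI]; last by apply: H; rewrite inE negbK.
  by apply/sub_selP => j; rewrite inE negbK; exact: H.
apply: closure_pchart => // y ey nCy; have [cy _] := ey.
rewrite (vI _ cy) (pchart_blow cK kK st ey); apply: blow_sub => //; last exact: pchart_pos.
move=> j jK; apply/sub_selP => l; rewrite inE negbK => lI; rewrite mxE.
case: eqP => //= _; case: eqP => // lj.
by move: jK; rewrite -lj (fintype.subsetP IK).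
Qed.

Lemma nested_coords c I K k t : X `<=` closure (X `\` C) -> vanishing c I X -> coords C c K ->
  I \subset K -> k \in K -> k \notin I -> sign t -> coords X1 (pchart C c K k t) I.
Proof.
move=> XC vI cK IK kK kI st; split; first exact: pchart_mchart.
move=> q eq; rewrite (nested_lift XC vI cK IK kK st eq).
have out j : j \in I -> lift_dir k t (crd (pchart C c K k t) q) 0 j = crd (pchart C c K k t) q 0 j.
  by move=> jI; rewrite mxE; case: eqP => // jk; move: kI; rewrite -jk jI.
by split=> H j jI; [rewrite -out//|rewrite out//]; exact: H.
Qed.

Lemma nested_center_coords c I K i s : C `<=` X -> coords X c I -> vanishing c K C ->
  I \subset K -> i \in I -> sign s -> coords C1 (pchart X c I i s) (i |: (K :\: I)).
Proof.
move=> CX cI vK IK iI ss; split; first exact: pchart_mchart.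
move=> q eq; have E := lift_pchart_in cI iI ss vK eq CX IK; rewrite E.
split=> [[H1 H2] j|H]; first by rewrite in_setU1 => /predU1P[->|]; [|exact: H2].
by split=> [|j jK]; apply: H; rewrite in_setU1 ?eqxx// jK orbT.
Qed.

Lemma valid_sub c A j k t i s : valid (pchart A c j k t) i s -> valid c i s.
Proof. by case=> [|H]; [left|right; move: H; rewrite in_setU1 negb_or => /andP[]]. Qed.

Definition crossing_charts (c : chart R n N) (I K : {set 'I_n}) : Prop :=
  [/\ C `<=` X, X `<=` closure (X `\` C) & I \subset K] \/
  [/\ X1 = blowdown C @^-1` X, C1 = blowdown X @^-1` C & forall i, i \in I -> i \notin K].

Lemma crossing_cover c I K : coords X c I -> coords C c K -> crossing_charts c I K ->
  (forall x : blowup X1, dom c (blowdown2 x) -> exists e1 e2, dom e1 x /\ matching e1 e2) /\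
  (forall y : blowup C1, dom c (blowdown2 y) -> exists e1 e2, dom e2 y /\ matching e1 e2).
Proof.
move=> cI cK; case=> [[CX XC IK]|[X1E C1E IK]]; last first.
  have KI j : j \in K -> j \notin I by move=> jK; apply/negP => /IK; rewrite jK.
  split=> x cx.
  - have [k [t [kK st vt ek]]] := pchart_cover gN cK cx.
    have cI' := across_coords clC lC X1E cI cK IK kK st.
    have [i [s [iI ss vs ex]]] := pchart_cover gC cI' ek.
    exists (pchart X1 (pchart C c K k t) I i s), (pchart C1 (pchart X c I i s) K k t).
    split=> //; apply: transversal_pair => //; last exact: valid_sub vs.
    exact: (across_coords clX lX C1E cK cI KI iI ss).
  - have [i [s [iI ss vs ei]]] := pchart_cover gN cI cx.
    have cK' := across_coords clX lX C1E cK cI KI iI ss.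
    have [k [t [kK st vt ex]]] := pchart_cover gX cK' ei.
    exists (pchart X1 (pchart C c K k t) I i s), (pchart C1 (pchart X c I i s) K k t).
    split=> //; apply: transversal_pair => //; last exact: valid_sub vt.
    exact: (across_coords clC lC X1E).
split=> x cx.
- have [k [t [kK st vt ek]]] := pchart_cover gN cK cx.
  (* For k in I the lift of X misses this chart, since the ray has the nonzero entry t at k. *)
  have [kI|kI] := boolP (k \in I).
    have off (q : blowup C) : dom (pchart C c K k t) q -> ~ X1 q.
      move=> eq /(nested_lift XC cI.2 cK IK kK st eq)/(_ k kI); rewrite mxE eqxx => t0.
      by case: st => t1; move: t0; rewrite t1 => /eqP; rewrite ?oppr_eq0 oner_eq0.
    exists (cchart X1 (pchart C c K k t)), (pchart C1 (pchart X c I k t) (k |: (K :\: I)) k 1).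
    split; first by split=> //; exact: off.
    by apply: nested_pair_in => //; apply: nested_center_coords => //; case: cK.
  have cI' := nested_coords XC cI.2 cK IK kK kI st.
  have [i [s [iI ss vs ex]]] := pchart_cover gC cI' ek.
  exists (pchart X1 (pchart C c K k t) I i s), (pchart C1 (pchart X c I i s) (i |: (K :\: I)) k t).
  split=> //; apply: nested_pair => //; last exact: valid_sub vs.
  by apply: nested_center_coords => //; case: cK.
- have [i [s [iI ss vs ei]]] := pchart_cover gN cI cx.
  have cK' := nested_center_coords CX cI cK.2 IK iI ss.
  have [k [t [kK st vt ex]]] := pchart_cover gX cK' ei.
  (* For k = i the second direction is the front face coordinate of the first, whose sign can only
     be 1. *)
  have [ki|ki] := eqVneq k i.
    subst k; have t1 : t = 1 by case: vt => //; rewrite in_setU1 eqxx.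
    subst t; exists (cchart X1 (pchart C c K i s)), (pchart C1 (pchart X c I i s) (i |: (K :\: I)) i 1).
    split=> //; apply: nested_pair_in => // q eq.
    move=> /(nested_lift XC cI.2 cK IK (fintype.subsetP IK i iI) ss eq)/(_ i iI); rewrite mxE eqxx => s0.
    by case: ss => s1; move: s0; rewrite s1 => /eqP; rewrite ?oppr_eq0 oner_eq0.
  move: kK; rewrite !inE (negPf ki) /= => /andP[kI kK].
  exists (pchart X1 (pchart C c K k t) I i s), (pchart C1 (pchart X c I i s) (i |: (K :\: I)) k t).
  split=> //; apply: nested_pair => //; last exact: valid_sub vt.
  exact: (nested_coords XC cI.2).
Qed.

End Pairs.

Section SwapIso.
Variables C X : set N.
Hypotheses (hN : hausdorff_space (pt N)) (pC : p_submanifold C) (pX : p_submanifold X).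
Hypotheses (pX1 : p_submanifold (lift C X)) (pC1 : p_submanifold (lift X C)).
Hypothesis cross : forall p, C p -> X p -> exists c I K,
  [/\ dom c p, coords X c I, coords C c K & crossing_charts C X c I K].

(** Points off one of the centres are covered by [off_cover], used in both roles; [cross] handles
    the points over both. *)
Lemma swap_iso : exists h : blowup (lift C X) -> blowup (lift X C),
  diffeomorphism h /\ forall x, blowdown2 (h x) = blowdown2 x.
Proof.
have nN : nice N by [].
have [g1 h1] := nice_blowup (nice_blowup nN pC) pX1.
have [g2 h2] := nice_blowup (nice_blowup nN pX) pC1.
have clC := (p_submanifold_coords pC).1; have clX := (p_submanifold_coords pX).1.
have [off1 off2] := off_cover pC pX pX1 pC1; have [off1' off2'] := off_cover pX pC pC1 pX1.
apply: (glue (U := ~` C `&` ~` X)) => //.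
- by move=> x; exact: blowdown2_dense.
- by move=> y; rewrite setIC; exact: blowdown2_dense.
- by move=> x x'; exact: blowdown2_inj.
- by move=> y y' [nC nX]; apply: blowdown2_inj.
- move=> x; have [Cx|nC] := pselect (C (blowdown2 x)); last exact: off1.
  have [Xx|nX] := pselect (X (blowdown2 x)); last first.
    by have [e2 [e1 [ex m]]] := off2' x nX; exists e1, e2; split=> //; exact: matched_sym.
  have [c [I [K [cp cI cK cr]]]] := cross Cx Xx.
  by have [H _] := crossing_cover pC pX pX1 pC1 cI cK cr; exact: H.
move=> y; have [Cy|nC] := pselect (C (blowdown2 y)); last exact: off2.
have [Xy|nX] := pselect (X (blowdown2 y)); last first.
  by have [e2 [e1 [ey m]]] := off1' y nX; exists e1, e2; split=> //; exact: matched_sym.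
have [c [I [K [cp cI cK cr]]]] := cross Cy Xy.
by have [_ H] := crossing_cover pC pX pX1 pC1 cI cK cr; exact: H.
Qed.

End SwapIso.
End TwoBlowups.

(** * Lifts under commuted blow-ups *)



Section SwapLifts.
Variables (R : realType) (n : nat) (N : charted_space R n).
Hypothesis gN : good N.
Variables C X : set N.
Hypotheses (pC : p_submanifold C) (pX : p_submanifold X).
Hypotheses (pX1 : p_submanifold (lift C X)) (pC1 : p_submanifold (lift X C)).
Local Notation X1 := (lift C X).
Local Notation C1 := (lift X C).
Let clC : closed C := (p_submanifold_coords pC).1.
Let lC : locally_coords C := (p_submanifold_coords pC).2.
Let clX : closed X := (p_submanifold_coords pX).1.
Let lX : locally_coords X := (p_submanifold_coords pX).2.
Let clX1 : closed X1 := (p_submanifold_coords pX1).1.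
Let lX1 : locally_coords X1 := (p_submanifold_coords pX1).2.
Let clC1 : closed C1 := (p_submanifold_coords pC1).1.
Let lC1 : locally_coords C1 := (p_submanifold_coords pC1).2.
Let gC : good (blowup C) := blowup_good gN clC lC.
Let gX : good (blowup X) := blowup_good gN clX lX.
Local Notation b1 := (@blowdown2 R n N C X).
Local Notation b2 := (@blowdown2 R n N X C).

(* The lift of X meets each fibre of the front face over C in a nowhere dense set. *)
Lemma nested_front c I K (x : blowup X1) : coords X c I -> coords C c K -> dom c (b1 x) ->
  I \subset K -> X `<=` closure (X `\` C) -> C (b1 x) ->
  closure (blowdown X1 @^-1` (blowdown C @^-1` [set b1 x] `\` X1)) x.
Proof.
move=> cI cK cx IK XC Cx; have [nX1|X1x] := pselect (~ X1 (blowdown X1 x)).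
  exact: subset_closure.
have {}X1x : X1 (blowdown X1 x) by exact: contrapT.
have [k [t [kK st vt ek]]] := pchart_cover gN cK cx.
have XE q := @nested_lift _ _ _ gN C X pC c I K k t q XC cI.2 cK IK kK st.
have [kI|kI] := boolP (k \in I).
  have := (XE _ ek).1 X1x k kI; rewrite mxE eqxx => t0.
  by case: st => t1; move: t0; rewrite t1 => /eqP; rewrite ?oppr_eq0 oner_eq0.
have cI' := nested_coords gN pC XC cI.2 cK IK kK kI st.
have [i [s [iI ss vs ex]]] := pchart_cover gC cI' ek.
have me := pchart_mchart gC clX1 cI' iI ss; have gX1 := blowup_good gC clX1 lX1.
apply/(closure_chart gX1 _ me ex) => r r0.
have [y [ey nX1y yr yE]] := pchart_raise gC clX1 cI' iI ss ex r0.
exists y; split=> //; split=> //; have [eky _] := ey; have [cy _] := eky; have [mc vK] := cK.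
have ki : k != i by apply: contraNneq kI => ->.
have blowI w j : j \notin I -> blow I i s w 0 j = w 0 j.
  by move=> jI; rewrite mxE (negPf jI); case: eqP jI => // ->; rewrite iI.
have x0 := (pchart_center cK kK st ek).1 Cx.
have y0 : crd (pchart C c K k t) (blowdown X1 y) 0 k = 0.
  rewrite (pchart_blow cI' iI ss ey) blowI// yE//.
  by rewrite -x0 (pchart_blow cI' iI ss ex) blowI.
apply: (mchart_inj mc) => //.
rewrite (pchart_blow cK kK st eky) /blowdown2 (pchart_blow cK kK st ek); apply/rowP => j.
have [jK|jK] := boolP (j \in K); first by rewrite !blowE// x0 y0 !mul0r.
have jI : j \notin I by apply: contra jK; exact: fintype.subsetP IK j.
have ji : j != i by apply: contraNneq jI => ->.
have blowK w : blow K k t w 0 j = w 0 j.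
  by rewrite mxE (negPf jK); case: eqP jK => // ->; rewrite kK.
rewrite !blowK (pchart_blow cI' iI ss ey) (pchart_blow cI' iI ss ex) !blowI//.
exact: yE.
Qed.

Hypothesis C1E : forall y : blowup X, C1 y <-> C (blowdown X y).

(** Nested or transversal. In the latter case a centre C of codimension 0 is removed by its blow-up,
    so points of C are reached only in positive codimension; the last alternative covers codimension
    0. *)
Definition swap_mode : Prop :=
  (C `<=` X /\ forall x : blowup X1, C (b1 x) ->
    closure (blowdown X1 @^-1` (blowdown C @^-1` [set b1 x] `\` X1)) x) \/
  ((forall y : blowup C, X1 y <-> X (blowdown C y)) /\
   ((forall q, C q -> exists x : blowup C, blowdown C x = q) \/ C `&` X = set0)).

Hypothesis mode : swap_mode.

(** Both lifts come from one set S below by the same operation, so a diffeomorphism over N carries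
    one to the other. *)
Definition same_lifts Q : Prop := exists S : set N,
  lift X1 (lift C Q) = b1 @^-1` S /\ lift C1 (lift X Q) = b2 @^-1` S \/
  lift X1 (lift C Q) = closure (b1 @^-1` S) /\ lift C1 (lift X Q) = closure (b2 @^-1` S).

Lemma swap_inside Q : closed Q -> Q `<=` C -> Q `<=` X ->
  lift X1 (lift C Q) = b1 @^-1` Q ->
  [/\ liftable X Q, liftable C1 (lift X Q) & same_lifts Q].
Proof.
move=> clQ QC QX F1; have Q2E : lift X Q = blowdown X @^-1` Q by exact: lift_in.
have Q2C : lift X Q `<=` C1 by rewrite Q2E => y Qy; apply/C1E; exact: QC.
split; first by split=> //; left.
  by split; [exact: closed_lift|left].
by exists Q; left; split=> //; rewrite (lift_in Q2C) Q2E.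
Qed.

(** In the nested case Q also lies in X, and both double lifts are the preimage of Q. In the
    transversal case this holds if Q lies in X; otherwise both are the closure of the preimage of Q
    off X. *)
Lemma swap_in_center Q : Q `<=` C -> closed Q -> liftable X1 (lift C Q) ->
  [/\ liftable X Q, liftable C1 (lift X Q) & same_lifts Q].
Proof.
move=> QC clQ [clQ1 dQ1]; have Q1E : lift C Q = blowdown C @^-1` Q by exact: lift_in.
have inside : lift C Q `<=` X1 -> lift X1 (lift C Q) = b1 @^-1` Q.
  by move=> Q1X; rewrite (lift_in Q1X) Q1E.
case: mode => [[CX front]|[X1E onto]].
  have QX : Q `<=` X by move=> q /QC; exact: CX.
  apply: swap_inside => //; case: dQ1 => dQ1; first exact: inside.
  rewrite (lift_dense dQ1) Q1E; apply/seteqP; split=> x.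
    move=> /(closure_blowdown gC clX1 lX1); suff : closure (lift C Q `\` X1) `<=` lift C Q.
      by rewrite Q1E; apply.
    by apply: closure_least => // ? [].
  (* Points off [X1] in the fibre over the same point of C accumulate at x, so the closure is the
     full preimage. *)
  move=> Qx; apply: closureS (front x (QC _ Qx)) => y [yx nX1y].
  by split=> //; rewrite /= yx.
have [QX|[QX dQ1']] : Q `<=` X \/ Q `<=` closure (Q `\` X) /\ lift C Q `<=` closure (lift C Q `\` X1).
  case: onto => [onto|CX0]; last first.
    have nX q : Q q -> ~ X q by move=> /QC Cq Xq; have : (C `&` X) q by []; rewrite CX0.
    right; split=> [q Qq|x Qx]; apply: subset_closure; split=> //; first exact: nX.
    by move=> /X1E; apply: nX; move: Qx; rewrite Q1E.
  case: dQ1 => dQ1; [left=> q Qq|right; split=> // q Qq]; have [x xq] := onto q (QC q Qq).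
    by rewrite -xq; apply/X1E; apply: dQ1; rewrite Q1E /= xq.
  have : lift C Q x by rewrite Q1E /= xq.
  move=> /dQ1 H; rewrite -xq; apply: (@closure_blowdown _ _ _ gN _ clC lC).
  apply: closureS H => y; rewrite Q1E => -[Qy nX]; split=> // Xy; apply: nX; exact/X1E.
- apply: swap_inside => //; apply: inside; rewrite Q1E => x Qx; apply/X1E; exact: QX.
have Q2C : lift X Q `<=` C1.
  rewrite (lift_dense QX); apply: closure_least => // y [Qy _]; apply/C1E; exact: QC.
split; first by split=> //; right.
  by split; [exact: closed_lift|left].
exists (Q `\` X); right; split.
  rewrite (lift_dense dQ1') Q1E; congr closure; apply/seteqP; split=> x [Qx nX]; split=> //.
    by move=> Xx; apply: nX; exact/X1E.
  by move=> /X1E.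
rewrite (lift_in Q2C) (lift_dense QX); apply: (preimage_closure gX clC1 lC1) => y [Qy _].
by apply/C1E; exact: QC.
Qed.

(** If the lift of Q lies in that of X, then Q lies in X and S is Q off C; otherwise S is Q off both
    centres. *)
Lemma swap_off_center Q : Q `<=` closure (Q `\` C) -> closed Q -> liftable X1 (lift C Q) ->
  [/\ liftable X Q, liftable C1 (lift X Q) & same_lifts Q].
Proof.
move=> QC clQ [clQ1 dQ1]; case: dQ1 => dQ1.
  have QX : Q `<=` X by exact: (lift_sub_inv gN clC lC clX QC dQ1).
  have Q2E : lift X Q = blowdown X @^-1` Q by exact: lift_in.
  have dQ2 : lift X Q `<=` closure (lift X Q `\` C1).
    rewrite Q2E => y /QC; have SX : Q `\` C `<=` X by move=> q [/QX].
    move=> /(closure_preimage gN clX lX SX); apply: closureS => z [Qz nCz].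
    by split=> // /C1E.
  split; first by split=> //; left.
    by split; [exact: closed_lift|right].
  exists (Q `\` C); right; split.
    rewrite (lift_in dQ1) (lift_dense QC); apply: (preimage_closure gC clX1 lX1) => z Qz.
    by apply: dQ1; rewrite (lift_dense QC); exact: subset_closure.
  rewrite (lift_dense dQ2) Q2E; congr closure; apply/seteqP; split=> y [Qy nC]; split=> //.
    by move=> Cy; apply: nC; exact/C1E.
  by move=> /C1E.
have D := lift_dense2 gN pC clX clQ QC dQ1.
have DE : (Q `\` C) `\` X = (Q `\` X) `\` C by rewrite !setDDl setUC.
have QX : Q `<=` closure (Q `\` X) by move=> q /D; apply: closureS => ? [[]].
have dQ2 := lift_dense_out gN clX lX clQ clC QX QC.
split; first by split=> //; right.
  by split; [exact: closed_lift|right].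
exists ((Q `\` C) `\` X); right; split; first exact: lift2_dense.
by rewrite [in RHS]DE; apply: lift2_dense => //; rewrite -DE.
Qed.

Lemma swap_lifts Q : liftable C Q -> liftable X1 (lift C Q) ->
  [/\ liftable X Q, liftable C1 (lift X Q) & same_lifts Q].
Proof.
by move=> [clQ [QC|QC]]; [exact: swap_in_center|exact: swap_off_center].
Qed.

Lemma same_lifts_image (h : blowup X1 -> blowup C1) Q : diffeomorphism h ->
  (forall x, b2 (h x) = b1 x) -> same_lifts Q ->
  lift C1 (lift X Q) = h @` lift X1 (lift C Q).
Proof.
move=> [g [hg gh sh sg]] hb [S HS].
have gX1 := blowup_good gC clX1 lX1; have gC1 := blowup_good gX clC1 lC1.
have pre : h @` (b1 @^-1` S) = b2 @^-1` S.
  rewrite (image_cancel _ hg gh); apply/seteqP; split=> y /=; rewrite -hb gh.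
    by [].
  by [].
case: HS => -[-> ->]; first by rewrite pre.
rewrite -pre; apply: (homeo_closure _ hg gh); exact: smooth_map_continuous.
Qed.

End SwapLifts.

Lemma lift_across (R : realType) n (N : charted_space R n) (C X : set N) : good N -> closed C ->
  closed X -> locally_coords X ->
  (forall p, C p -> X p -> exists c (I K : {set 'I_n}), [/\ dom c p, coords X c I, vanishing c K C &
    forall i, i \in I -> i \notin K]) ->
  forall y : blowup X, lift X C y <-> C (blowdown X y).
Proof.
move=> gN clC clX lX cross y; split; first exact: (lift_sub gN clX lX clC).
rewrite /lift; case: asboolP => // _ Cy.
have [Xy|nXy] := pselect (X (blowdown X y)); last exact: subset_closure.
have [c [I [K [cy cI vK IK]]]] := cross _ Cy Xy.
have [i [s [iI ss vs ex]]] := pchart_cover gN cI cy.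
apply/(closure_pchart_across gN clX lX cI iI ss vK IK ex) => j jK.
have jI : j \notin I by apply/negP => /IK; rewrite jK.
have := (vK _ cy).1 Cy j jK; rewrite (pchart_blow cI iI ss ex) mxE (negPf jI).
by case: eqP jI => // ->; rewrite iI.
Qed.

Section SwapStep.
Variables (R : realType) (n : nat) (M N : charted_space R n) (b : N -> M) (L : set M -> set N).
Variables (d : set M -> nat) (k : nat) (C0 X0 : set M) (s rest : seq (set M)).
Hypotheses (nN : nice N) (fam : family L d s) (X0s : X0 \in s).
Local Notation C := (L C0).
Local Notation X := (L X0).
Hypothesis head : forall F, F \in s -> X `<=` L F \/ X `&` L F = set0.
Hypothesis least : forall F, F \in s -> F <> X0 -> L F `<=` X -> L F = set0.
Hypothesis cross : crosses L d C k s.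

(** Permissibility passes from the given order to the swapped one: [swap_lifts] moves the
    liftability of the remaining elements across, and [resolution_transport] the remaining
    blow-ups. *)
Theorem swap_step : permissible_from L (C0 :: X0 :: rest) ->
  permissible_from L (X0 :: C0 :: rest) /\
  same_resolution (resolution_from b L (C0 :: X0 :: rest)) (resolution_from b L (X0 :: C0 :: rest)).
Proof.
move=> /= [pC lif [pX1 lif1 perm]]; have [gN hN] := nN.
have pX : p_submanifold X by exists (d X0); exact: (family_submanifold gN fam).
have pC1 : p_submanifold (lift X C).
  by apply: (crosses_submanifold (crosses_blowup gN fam X0s head least cross (s' := [::]) _)).
have [clC lC] := p_submanifold_coords pC; have [clX lX] := p_submanifold_coords pX.
have [_ CX Cch] := cross; have [_ dich XC] := CX X0 X0s.
have charts p (Cp : C p) (Xp : X p) := cross_chart gN X0s head cross Cp Xp.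
have [crs [C1E mode]] : (forall p, C p -> X p -> exists c I K,
    [/\ dom c p, coords X c I, coords C c K & crossing_charts C X c I K]) /\
    (forall y : blowup X, lift X C y <-> C (blowdown X y)) /\ swap_mode C X.
  have [nst|nnst] := pselect (C `<=` X).
    have ch p : C p -> exists c I K, [/\ dom c p, coords X c I, coords C c K & I \subset K].
      move=> Cp; have [c [I [K [[mc cp _ _] [cI _] [vK _] IK _]]]] := charts p Cp (nst p Cp).
      exists c, I, K; split=> //; case: IK => -[] // CX' _; exfalso.
      have E : C `\` X = set0 by apply/seteqP; split=> // q [Cq]; case; exact: nst.
      by have := CX' p Cp; rewrite E closure0.
    split; [|split].
    - move=> p Cp _; have [c [I [K [cp cI cK IK]]]] := ch p Cp.
      by exists c, I, K; split=> //; left.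
    - by move=> y; rewrite lift_in.
    left; split=> // x Cx; have [c [I [K [cp cI cK IK]]]] := ch _ Cx.
    exact: (nested_front gN pC pX1 cI cK cp IK XC Cx).
  have {}dich : C `<=` closure (C `\` X) by case: dich.
  have ch p : C p -> X p -> exists c I K, [/\ dom c p, coords X c I, coords C c K /\ #|K| = k &
      forall i, i \in I -> i \notin K].
    move=> Cp Xp; have [c [I [K [[mc cp _ _] [cI _] [vK cK] IK _]]]] := charts p Cp Xp.
    by exists c, I, K; split=> //; case: IK => -[].
  have C1E y : lift X C y <-> C (blowdown X y).
    apply: (lift_across gN clC clX lX) => p Cp Xp.
    by have [c [I [K [cp cI [[_ vK] _] IK]]]] := ch p Cp Xp; exists c, I, K.
  have X1E y : lift C X y <-> X (blowdown C y).
    apply: (lift_across gN clX clC lC) => p Xp Cp.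
    have [c [I [K [cp [_ vI] [cK _] IK]]]] := ch p Cp Xp; exists c, K, I; split=> // j jK.
    by apply/negP => /IK; rewrite jK.
  split; [|split=> //].
    move=> p Cp Xp; have [c [I [K [cp cI [cK _] IK]]]] := ch p Cp Xp.
    exists c, I, K; split=> //; right; split=> //; apply/seteqP; split=> y;
      [exact: (X1E y).1|exact: (X1E y).2|exact: (C1E y).1|exact: (C1E y).2].
  (* For k = 0 the set C is open, and X, being the closure of its part off C, misses it. *)
  right; split=> //; have [k0|k0] := posnP k; [right|left].
    apply/seteqP; split=> // p [Cp Xp].
    have [c [I [K [cp [mc _] [[_ vK] cK] _]]]] := ch p Cp Xp.
    have K0 : K = finset.set0 by apply/eqP; rewrite -cards_eq0 cK k0.
    have nd : nbhs p (dom c) by apply: open_nbhs_nbhs; split=> //; exact: open_dom.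
    have [q [[_ nCq] cq]] := XC p Xp _ nd.
    by apply: nCq; apply/vK => // i; rewrite K0 inE.
  move=> q Cq; have [c [K [S [[mc cq _ _] [vK cK] _ _]]]] := Cch q Cq.
  have cK' : coords C c K by [].
  by apply: (blowdown_onto gN cK') => //; rewrite -card_gt0 cK.
have [h [dh hb]] := swap_iso gN hN pC pX pX1 pC1 crs.
have lifts Q (Qr : Q \in rest) := swap_lifts gN pC pX pX1 pC1 C1E mode
  (lif Q (mem_behead (s := X0 :: rest) Qr)) (lif1 Q Qr).
have [perm' same] : permissible_from (fun Q => lift (lift X C) (lift X (L Q))) rest /\
    same_resolution
      (resolution_from (fun x => b (blowdown C (blowdown (lift C X) x))) (fun Q => lift (lift C X) (lift C (L Q))) rest)
      (resolution_from (fun x => b (blowdown X (blowdown (lift X C) x))) (fun Q => lift (lift X C) (lift X (L Q))) rest).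
  apply: (resolution_transport (f := h)) => //.
  - by apply: nice_blowup => //; exact: nice_blowup.
  - by apply: nice_blowup => //; exact: nice_blowup.
  - by move=> x; congr b; exact: hb.
  move=> Q Qr; have [_ _ sl] := lifts Q Qr.
  exact: (same_lifts_image gN pC pX pX1 pC1 dh hb sl).
split=> //; split=> //.
  move=> Q; rewrite inE => /predU1P[->|Qr]; last by have [] := lifts Q Qr.
  by split.
by split=> // Q Qr; have [] := lifts Q Qr.
Qed.

End SwapStep.

(** * Reordering the centres *)



Lemma index_filter_lt (T : eqType) (P : pred T) (s : seq T) x y : P x -> P y ->
  (index x [seq z <- s | P z] < index y [seq z <- s | P z])%N -> (index x s < index y s)%N.
Proof.
move=> Px Py; elim: s => //= a s IH; case: ifPn => Pa /=.
  case: eqP => [_|ax]; case: eqP => [_|ay] //.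
have ax : a == x = false by apply: contraNF Pa => /eqP ->.
have ay : a == y = false by apply: contraNF Pa => /eqP ->.
by rewrite ax ay => /IH.
Qed.

Section Orders.
Variables (R : realType) (n : nat) (M : charted_space R n).
Implicit Types (N : charted_space R n) (d : set M -> nat) (C F G : set M) (s t rest : seq (set M)).

Lemma resolution_nice s N (b : N -> M) (L : set M -> set N) : nice N -> permissible_from L s ->
  nice (projT1 (resolution_from b L s)).
Proof.
elim: s N b L => //= C s IH N b L nN [pC _ H]; apply: IH => //; exact: nice_blowup.
Qed.

Lemma same_resolution_refl (r : {N : charted_space R n & N -> M}) :
  good (projT1 r) -> same_resolution r r.
Proof.
move=> gr; exists id; split=> //; exists id; split=> //; move=> c e p mc me cp ep;
  exact: (mchart_compat gr mc me cp ep).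
Qed.

Lemma same_resolution_trans (r1 r2 r3 : {N : charted_space R n & N -> M}) :
  good (projT1 r2) -> same_resolution r1 r2 -> same_resolution r2 r3 -> same_resolution r1 r3.
Proof.
move=> g2 [h [dh hE]] [k [dk kE]]; exists (k \o h); split; first exact: diffeomorphism_comp.
by move=> x; rewrite /= kE hE.
Qed.

Lemma same_resolution_sym (r1 r2 : {N : charted_space R n & N -> M}) :
  same_resolution r1 r2 -> same_resolution r2 r1.
Proof.
move=> [h [[g [hg gh sh sg]] hE]]; exists g; split; first by exists h.
by move=> x; rewrite -hE gh.
Qed.

Lemma family_coords N (L : set M -> set N) d s F : good N -> family L d s -> F \in s ->
  closed (L F) /\ locally_coords (L F).
Proof.
move=> gN fam Fs; apply: p_submanifold_coords; exists (d F); exact: (family_submanifold gN fam).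
Qed.

Lemma ordered_blowup N (L : set M -> set N) d C0 s : good N -> uniq (C0 :: s) ->
  family L d (C0 :: s) -> ordered L (C0 :: s) -> meeting L (C0 :: s) ->
  ordered (fun F => lift (L C0) (L F)) s.
Proof.
move=> gN us fam ord mt F G Fs Gs FG H.
have C0m : C0 \in C0 :: s by rewrite inE eqxx.
have ne E : E \in s -> E <> C0 by move=> Es EC; move: us; rewrite /= -EC Es.
have mem E : E \in s -> E \in C0 :: s by rewrite inE orbC => ->.
have [clC lC] := family_coords gN fam C0m; have [_ least] := ordered_head us ord mt.
have dG := member_dense fam C0m least (mem G Gs) (ne G Gs).
have GF := lift_sub_inv gN clC lC (family_coords gN fam (mem F Fs)).1 dG H.
have -> : L G = set0.
  apply: (ord F G (mem F Fs) (mem G Gs)) => //=.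
  by rewrite !ifN ?ltnS// eq_sym; apply/eqP; exact: ne.
by rewrite lift_in ?preimage_set0//; exact: sub0set.
Qed.

Lemma ordered_nice N (L : set M -> set N) d C0 s : nice N -> family L d (C0 :: s) ->
  p_submanifold (L C0).
Proof.
move=> [gN _] fam; exists (d C0); apply: (family_submanifold gN fam); exact: mem_head.
Qed.

Lemma blowup_tail N (L : set M -> set N) d C0 s : nice N -> uniq (C0 :: s) ->
  family L d (C0 :: s) -> ordered L (C0 :: s) -> meeting L (C0 :: s) ->
  [/\ nice (blowup (L C0)), family (fun F => lift (L C0) (L F)) d s,
      ordered (fun F => lift (L C0) (L F)) s & meeting (fun F => lift (L C0) (L F)) s].
Proof.
move=> nN us fam ord mt; have [gN _] := nN; have [hd least] := ordered_head us ord mt.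
have C0m : C0 \in C0 :: s by rewrite inE eqxx.
have ss F : F \in s <-> F \in C0 :: s /\ F <> C0.
  move: us => /= /andP[C0s _]; rewrite inE; split=> [Fs|[/predU1P[//|//]]].
  by rewrite Fs orbT; split=> // FC; rewrite -FC Fs in C0s.
split.
- by apply: nice_blowup => //; exact: ordered_nice fam.
- by apply: (family_blowup gN fam C0m hd least) => F /ss.
- exact: ordered_blowup fam ord mt.
- exact: (meeting_blowup gN fam C0m hd least ss).
Qed.

Lemma family_liftable N (L : set M -> set N) d s F G : good N -> family L d s -> F \in s ->
  G \in s -> G <> F -> liftable (L F) (L G).
Proof.
move=> gN fam Fs Gs GF; split; first by have [] := family_coords gN fam Gs.
by have [_ _ ml] := fam; exact: ml.
Qed.

Lemma permissible_ordered s d N (L : set M -> set N) : nice N -> uniq s -> family L d s ->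
  ordered L s -> meeting L s -> permissible_from L s.
Proof.
elim: s N L => //= C0 s IH N L nN /andP[C0s us] fam ord mt.
have [|nB fB oB mB] := blowup_tail nN _ fam ord mt; first by rewrite /= C0s.
split; [exact: ordered_nice fam| |exact: IH].
move=> Q Qs; apply: (family_liftable nN.1 fam); rewrite ?inE ?eqxx ?Qs ?orbT//.
by move=> QC; rewrite -QC Qs in C0s.
Qed.

(** One swap, then induction in the blow-up of X0. The codimension k is left general because it
    changes when C0 lies in X0. *)
Lemma move_center s rest k d N (b : N -> M) (L : set M -> set N) C0 : nice N -> uniq s ->
  family L d s -> ordered L s -> meeting L s -> crosses L d (L C0) k s ->
  permissible_from L (C0 :: s ++ rest) ->
  permissible_from L (s ++ C0 :: rest) /\
  same_resolution (resolution_from b L (C0 :: s ++ rest)) (resolution_from b L (s ++ C0 :: rest)).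
Proof.
elim: s k N b L => [|X0 s IH] k N b L nN us fam ord mt cross perm.
  by split=> //; apply: same_resolution_refl; have [] := resolution_nice b nN perm.
have [gN _] := nN; have [hd least] := ordered_head us ord mt.
have X0m : X0 \in X0 :: s by rewrite inE eqxx.
have [perm1 same1] := swap_step b nN fam X0m hd least cross perm.
have [nB fB oB mB] := blowup_tail nN us fam ord mt.
have us' := us; move: us' => /= /andP[X0s us'].
have ss F : F \in s -> F \in X0 :: s /\ F <> X0.
  by move=> Fs; rewrite inE Fs orbT; split=> // FX; rewrite -FX Fs in X0s.
have cB := crosses_blowup gN fam X0m hd least cross ss.
have perm1' := perm1; case: perm1' => pX lif permX.
have [permX' sameX] := IH _ _ (fun x => b (blowdown (L X0) x)) _ nB us' fB oB mB cB permX.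
split; first split=> //.
  by move=> Q QS; apply: lif; move: QS; rewrite !(inE, mem_cat) => /orP[->|/orP[->|->]]; rewrite ?orbT.
apply: same_resolution_trans same1 sameX.
by have [] := resolution_nice b nN perm1.
Qed.

(** At the start C0 lies in every element that it meets; their equations all use coordinates of C0,
    so S = K. *)
Lemma crosses_head N (L : set M -> set N) d s t C0 : good N -> family L d s -> C0 \in s ->
  (forall F, F \in s -> L C0 `<=` L F \/ L C0 `&` L F = set0) ->
  (forall F, F \in s -> F <> C0 -> L F `<=` L C0 -> L F = set0) ->
  (forall F, F \in t -> F \in s /\ F <> C0) -> crosses L d (L C0) (n - d C0) t.
Proof.
move=> gN fam C0s hd least ts; have [cl _ _] := fam; have [clC fC] := cl C0 C0s.
split=> // [F /ts[Fs FC]|p Cp].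
  split; last exact: (member_dense fam C0s least).
    have [CF|CF] := hd F Fs; first by rewrite setIidl.
    by rewrite CF; exact: (@few_points _ _ [::]).
  have [CF|CF] := hd F Fs; [by left|right=> p Cp].
  apply: subset_closure; split=> // Fp; have : (L C0 `&` L F) p by [].
  by rewrite CF.
have [c [I [ac cI dI H]]] := head_chart gN fam C0s hd Cp.
exists c, I, I; split=> //; [by split; [case: cI|have := addnK (d C0) #|I|; rewrite dI => ->]|by left|].
by move=> F /ts[Fs _]; exact: H.
Qed.


Lemma ordered_index N (L : set M -> set N) s E F p : ordered L s -> E \in s -> F \in s ->
  L E p -> L E `<=` L F -> (index E s <= index F s)%N.
Proof.
move=> ord Es Fs Ep EF; rewrite leqNgt; apply/negP => FE.
by have E0 := ord F E Fs Es FE EF; rewrite E0 in Ep.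
Qed.

(** If E is in s1, inclusion puts it before F in s', or F is in s2 and hence behind all of s'. If E
    is in s2, the old bound survives: s2 keeps its order and stays behind the first block. *)
Lemma closing_blowup N (L : set M -> set N) d C0 s1 s2 s' : good N ->
  uniq (s1 ++ C0 :: s2) -> uniq s' -> s' =i s1 -> family L d (s1 ++ C0 :: s2) ->
  (forall F, F \in s1 ++ C0 :: s2 -> L C0 `<=` L F \/ L C0 `&` L F = set0) ->
  (forall F, F \in s1 ++ C0 :: s2 -> F <> C0 -> L F `<=` L C0 -> L F = set0) ->
  ordered L s' -> closing L (s1 ++ C0 :: s2) ->
  closing (fun F => lift (L C0) (L F)) (s' ++ s2).
Proof.
set s := s1 ++ C0 :: s2 => gN us us' s's1 fam hd least ord cl x F G Fs Gs Fx Gx.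
have C0s : C0 \in s by rewrite mem_cat inE eqxx orbT.
have mem E : E \in s' ++ s2 <-> E \in s /\ E <> C0.
  rewrite !mem_cat inE s's1; move: us; rewrite cat_uniq /= negb_or => /and3P[_ /andP[C1 _] /andP[C2 _]].
  split=> [/orP[H|H]|[/or3P[->//|/eqP//|->]]]; last by rewrite orbT.
    by rewrite H; split=> // EC; rewrite -EC H in C1.
  by rewrite H !orbT; split=> // EC; rewrite -EC H in C2.
have [Fs0 FC] := (mem F).1 Fs; have [Gs0 GC] := (mem G).1 Gs.
have [clC lC] := family_coords gN fam C0s.
have Fx' := lift_sub gN clC lC (family_coords gN fam Fs0).1 Fx.
have Gx' := lift_sub gN clC lC (family_coords gN fam Gs0).1 Gx.
have [E [Es idx mE]] := cl _ F G Fs0 Gs0 Fx' Gx'.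
have [EC mE'] := lift_meets gN fam C0s hd least Es Fs0 Gs0 FC GC Fx Gx mE.
have Es' : E \in s' ++ s2 by apply/mem.
have [Ex EFG _] := mE.
exists E; split=> //; have [Es1|Es1] := boolP (E \in s1).
  rewrite leq_max; apply/orP; left; rewrite !index_cat s's1 Es1.
  have Es'' : E \in s' by rewrite s's1.
  case: ifPn => Fs1; last by rewrite (leq_trans (index_size _ _))// leq_addr.
  exact: (ordered_index ord Es'' Fs1 Ex (fun q Eq => (EFG q Eq).1)).
have idx_le H : H \in s' ++ s2 -> (index E s <= index H s)%N ->
    (index E (s' ++ s2) <= index H (s' ++ s2))%N.
  move=> Hs; have [_ HC] := (mem H).1 Hs; rewrite !index_cat !s's1 (negPf Es1) /=.
  have nEC : C0 == E = false by apply/eqP => CE; apply: EC.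
  have nHC : C0 == H = false by apply/eqP => CH; apply: HC.
  rewrite nEC nHC; case: ifPn => [Hs1|_]; last by rewrite !leq_add2l.
  rewrite addnS => lt; have : (index H s1 < size s1)%N by rewrite index_mem.
  by move: lt; clear; lia.
by move: idx; rewrite !leq_max => /orP[/(idx_le F Fs)->|/(idx_le G Gs)->]; rewrite ?orbT.
Qed.

(** With C0 the head of t and s = s1 ++ C0 :: s2, three moves lead from t to s: the tail of t
    becomes s' ++ s2, C0 crosses s', and s' becomes s1. The first and third are instances of the
    induction on shorter lists, hence the size bound m; in the third C0 :: s2 belongs to [rest]. *)
Theorem reorder m d s t rest N (b : N -> M) (L : set M -> set N) : (size s <= m)%N -> nice N ->
  uniq s -> perm_eq t s -> family L d s -> ordered L t -> closing L s ->
  permissible_from L (t ++ rest) ->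
  permissible_from L (s ++ rest) /\
  same_resolution (resolution_from b L (t ++ rest)) (resolution_from b L (s ++ rest)).
Proof.
elim: m s t rest N b L => [|m IH] s t rest N b L sm nN us ts fam ord cl perm.
  move: sm ts perm; rewrite leqn0 size_eq0 => /eqP-> /perm_nilP-> perm; split=> //.
  by apply: same_resolution_refl; have [] := resolution_nice b nN perm.
case: t ts ord perm => [|C0 t] ts ord perm.
  move: ts; rewrite perm_sym => /perm_nilP s0; rewrite s0; split=> //.
  by apply: same_resolution_refl; have [] := resolution_nice b nN perm.
have [gN _] := nN; have ut : uniq (C0 :: t) by rewrite (perm_uniq ts).
have ts_mem := perm_mem ts.
have C0s : C0 \in s by rewrite -ts_mem mem_head.
have [s1 [s2 sE]] : exists s1 s2, s = s1 ++ C0 :: s2.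
  by case/splitPr: C0s => s1 s2; exists s1, s2.
have famt : family L d (C0 :: t) by apply: family_sub fam => F; rewrite ts_mem.
have mtt : meeting L (C0 :: t).
  move=> p F G; rewrite !ts_mem => Fs Gs Fp Gp.
  by have [E Es mE] := closing_meeting cl Fs Gs Fp Gp; exists E => //; rewrite ts_mem.
have [hd least] := ordered_head ut ord mtt.
have hds F : F \in s -> L C0 `<=` L F \/ L C0 `&` L F = set0 by rewrite -ts_mem; exact: hd.
have leasts F : F \in s -> F <> C0 -> L F `<=` L C0 -> L F = set0 by rewrite -ts_mem; exact: least.
have [nB _ oB _] := blowup_tail nN ut famt ord mtt.
move: (us); rewrite sE cat_uniq /= negb_or => /and3P[us1 /andP[C1 s12] /andP[C2 us2]].
(* The elements of s1 in the order of t: C0 can cross them only in an inclusion order. *)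
pose s' := [seq F <- C0 :: t | F \in s1].
have us' : uniq s' by exact: filter_uniq.
have s's1 : s' =i s1.
  by move=> F; rewrite mem_filter ts_mem sE mem_cat; case: (F \in s1).
have s'1 : perm_eq s' s1 by apply: uniq_perm.
have ords' : ordered L s'.
  move=> F G; rewrite !mem_filter => /andP[F1 Ft] /andP[G1 Gt] FG.
  exact: (ord F G Ft Gt (index_filter_lt F1 G1 FG)).
have ts2 : perm_eq t (s' ++ s2).
  rewrite -(perm_cons C0); apply: perm_trans ts _; rewrite sE.
  by rewrite perm_catC /= perm_cons perm_catC perm_cat2r perm_sym.
move: perm => /= [pC lif permB].
have memB F : F \in s' ++ s2 -> F \in s /\ F <> C0.
  rewrite mem_cat s's1 sE mem_cat inE => /orP[F1|F2].
    by rewrite F1; split=> // FC; rewrite -FC F1 in C1.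
  by rewrite F2 !orbT; split=> // FC; rewrite -FC F2 in C2.
have fB := family_blowup gN fam C0s hds leasts memB.
have clB : closing (fun F => lift (L C0) (L F)) (s' ++ s2).
  by rewrite sE in us fam hds leasts cl; apply: (closing_blowup gN us us' s's1 fam hds leasts ords' cl).
have szB : (size (s' ++ s2) <= m)%N.
  by rewrite size_cat (perm_size s'1); move: sm; rewrite sE size_cat /=; clear; lia.
have uB : uniq (s' ++ s2) by rewrite -(perm_uniq ts2); move: ut => /= /andP[].
have [permB1 same1] := IH _ _ rest _ (fun x => b (blowdown (L C0) x)) _ szB nB uB ts2 fB oB clB permB.
rewrite -catA in permB1 same1.
have perm1 : permissible_from L (C0 :: s' ++ s2 ++ rest).
  split=> // Q; rewrite catA mem_cat -(perm_mem ts2) => QS; apply: lif; by rewrite mem_cat.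
have fams' : family L d s'.
  by apply: family_sub fam => F; rewrite s's1 sE mem_cat => ->.
(* An element not later than both of two elements of the initial block belongs to that block. *)
have cl1 : closing L s1.
  move=> p F G F1 G1 Fp Gp; have Fs : F \in s by rewrite sE mem_cat F1.
  have Gs : G \in s by rewrite sE mem_cat G1.
  have [E [Es idx mE]] := cl p F G Fs Gs Fp Gp; move: idx; rewrite sE !index_cat F1 G1.
  case: ifPn => E1 idx; first by exists E.
  exfalso; have lt : (maxn (index F s1) (index G s1) < size s1)%N by rewrite gtn_max !index_mem F1.
  by have := leq_ltn_trans idx lt; rewrite ltnNge leq_addr.
have mt' : meeting L s'.
  move=> p F G; rewrite !s's1 => Fs Gs Fp Gp.
  by have [E Es mE] := closing_meeting cl1 Fs Gs Fp Gp; exists E => //; rewrite s's1.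
have cr : crosses L d (L C0) (n - d C0) s'.
  apply: (crosses_head gN fam C0s hds leasts) => F F'; apply: memB; by rewrite mem_cat F'.
have [perm2 same2] := move_center b nN us' fams' ords' mt' cr perm1.
have sz1 : (size s1 <= m)%N.
  by move: sm; rewrite sE size_cat /=; clear; lia.
have fam1 : family L d s1 by apply: family_sub fam => F; rewrite sE mem_cat => ->.
have [perm3 same3] := IH s1 s' (C0 :: s2 ++ rest) N b L sz1 nN us1 s'1 fam1 ords' cl1 perm2.
rewrite ?sE -catA; split=> //.
apply: same_resolution_trans (same_resolution_trans _ same1 same2) same3.
- by have [] := resolution_nice b nN perm2.
by have [] := resolution_nice b nN perm1.
Qed.

End Orders.

(** * Orders of a pic *)



Section PicOrders.
Variables (R : realType) (n : nat) (M : charted_space R n).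
Implicit Types (p q : M) (c : chart R n M) (F G E X : set M) (s t : seq (set M)) (V : 'M[R]_n).

Lemma manifold_nice : manifold_with_corners M -> nice M.
Proof. by move=> [H1 H2 H3 _ _]; split. Qed.

Lemma flat_dim p c V X k : good M -> adapted p c -> flat c V X -> splits (bdry c) V -> X p ->
  p_submanifold_dim k X -> \rank V = k.
Proof.
move=> gM ac fV sV Xp [_ _ H]; have [c' [I' [[mc' cp' _ _] vI' dI']]] := H p Xp.
have [I [e [[me ep _ _] _ vI dI _]]] := straighten gM ac fV sV (@filterT _ _ _).
apply: (@addnI #|I|); rewrite [LHS]dI (vanishing_card gM me mc' ep cp' Xp vI vI').
by rewrite [RHS]dI'.
Qed.

Variable CC : set (set M).
Hypotheses (hM : manifold_with_corners M) (hpic : pic CC) (hlift : mutually_liftable CC).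

Let nM : nice M := manifold_nice hM.
Let gM : good M := nM.1.

Lemma pic_dim : exists d : set M -> nat, forall F, CC F -> p_submanifold_dim (d F) F.
Proof.
suff /choice[d dP] : forall F, exists k, CC F -> p_submanifold_dim k F by exists d.
move=> F; have [CF|nCF] := pselect (CC F); last by exists 0%N.
by have [[_ H _] _] := hpic; have [k Hk] := H F CF; exists k.
Qed.

(** The p-clean equations define the kernel of A inside {z_J = 0}. It splits along the boundary
    because A has zero rows at the boundary indices. *)
Lemma pic_chart p : exists2 c, adapted p c & forall F, CC F -> F p ->
  exists2 V, flat c V F & splits (bdry c) V.
Proof.
have [[_ _ cl] _] := hpic.
have [Up|nUp] := pselect ((\bigcup_(F in CC) F) p); last first.
  have [c mc cp] := mchart_cover gM p.
  have [c' [ac _ _ _]] := adapted_shift gM mc cp (@filterT _ _ _).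
  by exists c' => // F CF Fp; case: nUp; exists F.
have [c ac H] := cl p Up; exists c => // F CF Fp.
have [J [m [A [JB A0 HF]]]] := H F CF Fp.
have inV (z : 'rV[R]_n) : (z <= kermx A :&: sel R (~: J))%MS <->
    (forall j, j \in J -> z 0 j = 0) /\ z *m A = 0.
  rewrite sub_capmx; split=> [/andP[/sub_kermxP zA] /sub_selP zJ|[zJ zA]].
    by split=> // j jJ; apply: zJ; rewrite inE negbK.
  apply/andP; split; first exact/sub_kermxP.
  by apply/sub_selP => j; rewrite inE negbK; exact: zJ.
exists (kermx A :&: sel R (~: J))%MS.
  by move=> q cq; rewrite (HF q cq) inV.
move=> j z jB /inV[zJ zA]; apply/inV; split=> [i iJ|].
  rewrite !mxE eqxx /=; case: eqP => [ij|]; last by rewrite mulr0.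
  by rewrite -ij zJ ?mul0r.
rewrite -scalemxAl -rowE; have -> : row j A = 0; last by rewrite scaler0.
by apply/rowP => l; rewrite !mxE A0.
Qed.

Lemma pic_family d s : (forall F, CC F -> p_submanifold_dim (d F) F) -> total_order_on CC s ->
  family (fun Q : set M => Q) d s.
Proof.
move=> dP [us sE]; have mem F : F \in s <-> CC F by rewrite sE.
split=> [F /mem CF|p|F G /mem CF /mem CG FG].
- by have [] := dP F CF.
- have [c ac H] := pic_chart p; exists c => // F /mem CF Fp.
  by have [V fV sV] := H F CF Fp; exists V; split=> //; exact: (flat_dim gM ac fV sV Fp (dP F CF)).
by have [] := hlift CF CG FG.
Qed.

(** A component agrees with the intersection near p because in a common chart F [&] G is linear,
    hence connected. *)
Lemma pic_meets F G p : CC F -> CC G -> F p -> G p ->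
  exists E, [/\ CC E, E = F `&` G \/ component (F `&` G) E &
    meets_in (fun Q : set M => Q) E F G p].
Proof.
move=> CF CG Fp Gp; have [_ /(_ F G CF CG)[FG0|CFG|H]] := hpic.
- by have : (F `&` G) p by []; rewrite FG0.
- exists (F `&` G); split=> //; first by left.
  by split=> //; apply: filterE => q.
have FGp : (F `&` G) p by [].
have cp : component (F `&` G) (connected_component (F `&` G) p) by exists p.
exists (connected_component (F `&` G) p); split; [exact: H|by right|].
split; [exact: connected_component_refl|exact: connected_component_sub|].
have [c ac Hc] := pic_chart p; have [V fV _] := Hc F CF Fp; have [W fW _] := Hc G CG Gp.
have [mc cp' _ _] := ac; have cFG := flat_connected gM ac (flat_cap fV fW).
have nd : nbhs p (dom c) by apply: open_nbhs_nbhs; split=> //; exact: open_dom.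
apply: filterS nd => q cq Fq Gq; apply: (connected_component_max (B := F `&` G `&` dom c)) => //.
Qed.

Lemma pic_closing s : total_order_on CC s ->
  (forall F G E p, precedes s F G -> CC E -> E = F `&` G \/ component (F `&` G) E ->
    meets_in (fun Q : set M => Q) E F G p -> (index E s <= index G s)%N) ->
  closing (fun Q : set M => Q) s.
Proof.
move=> [us sE] HE p F G Fs Gs Fp Gp; have mem F' : F' \in s <-> CC F' by rewrite sE.
have key F' G' : F' \in s -> G' \in s -> F' p -> G' p -> (index F' s < index G' s)%N ->
    exists E, [/\ E \in s, (index E s <= index G' s)%N & meets_in (fun Q : set M => Q) E F' G' p].
  move=> Fs' Gs' Fp' Gp' lt.
  have [E [CE EE mE]] := pic_meets ((mem _).1 Fs') ((mem _).1 Gs') Fp' Gp'.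
  by exists E; split=> //; [exact/mem|exact: (HE F' G' E p)].
case: (ltngtP (index F s) (index G s)) => [lt|gt|e].
- by have [E [Es le mE]] := key F G Fs Gs Fp Gp lt; exists E; split.
- have [E [Es le [Ep EGF nE]]] := key G F Gs Fs Gp Fp gt; exists E; split=> //.
  by split=> //; [rewrite setIC|apply: filterS nE => q H Fq Gq; exact: H].
have FG : F = G by rewrite -(nth_index F Fs) e nth_index.
subst G; exists F; split=> //.
by split; [exact: Fp|move=> q|apply: filterE => q].
Qed.

Lemma intersection_order_closing s : intersection_order CC s -> closing (fun Q : set M => Q) s.
Proof.
move=> [ts io]; apply: pic_closing => // F G E p FG CE EE [Ep EFG _].
have FG0 : F `&` G !=set0 by exists p; exact: EFG.
by have [->//|[_ _ /ltnW]] := io F G FG FG0 E CE EE.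
Qed.

(** If E came after G, its dimension would be at least that of G; lying in G, it would have the same
    germ at p. Mutual liftability then makes G dense off E at p unless G lies in E, and both are
    absurd. *)
Lemma size_order_closing s : size_order CC s -> closing (fun Q : set M => Q) s.
Proof.
move=> [ts so]; apply: pic_closing => // F G E p [Fs Gs _] CE _ [Ep EFG _].
have [us sE] := ts; have mem F' : F' \in s <-> CC F' by rewrite sE.
rewrite leqNgt; apply/negP => GE; have Es : E \in s by exact/mem.
have EG : E `<=` G by move=> q /EFG[].
have [k [l [dG dE kl]]] := so G E (And3 Gs Es GE).
have [c ac H] := pic_chart p; have [mc cp _ _] := ac.
have [V fV sV] := H E CE Ep; have [W fW sW] := H G ((mem G).1 Gs) (EG p Ep).
have rV := flat_dim gM ac fV sV Ep dE; have rW := flat_dim gM ac fW sW (EG p Ep) dG.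
have VW : (V <= W)%MS by apply: (flat_sub gM ac sV fV fW); apply: filterE => q; exact: EG.
have WV : (W <= V)%MS.
  by have := geq_leqif (mxrank_leqif_sup VW); rewrite rV rW kl => <-.
have GE' : G <> E by move=> e; move: GE; rewrite e ltnn.
have [_ [GsubE|dense]] := hlift ((mem G).1 Gs) CE GE'.
  by apply: GE'; apply/seteqP; split.
have nd : nbhs p (dom c) by apply: open_nbhs_nbhs; split=> //; exact: open_dom.
have [q [[Gq nEq] cq]] := dense p (EG p Ep) _ nd.
by apply: nEq; apply/fV => //; apply: submx_trans WV; apply/fW.
Qed.

(** Sort by the number of elements contained in F: it grows strictly along strict inclusions. *)
Lemma inclusion_order s : uniq s -> exists2 t, perm_eq t s & ordered (fun Q : set M => Q) t.
Proof.
move=> us; pose key F := count (fun H => `[< H `<=` F >]) s.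
exists (sort (fun F G => key F <= key G)%N s); first by rewrite perm_sort.
have tr : transitive (fun F G => key F <= key G)%N by move=> ? ? ?; exact: leq_trans.
have st := sort_sorted (fun F G => leq_total (key F) (key G)) s.
move=> F G Ft Gt lt GF; exfalso.
have := sorted_ltn_index tr st _ _ Ft Gt lt; rewrite leqNgt => /negP; apply.
have FG : ~ F `<=` G.
  by move=> FG; have E : F = G by [apply/seteqP; split]; move: lt; rewrite E ltnn.
rewrite /key; set a := fun H => `[< H `<=` G >].
have Fs : F \in s by move: Ft; rewrite mem_sort.
have U := count_predUI a (pred1 F) s.
have I0 : count (predI a (pred1 F)) s = 0%N.
  apply/eqP; rewrite -leqn0 leqNgt -has_count; apply/negP => /hasP[H _ /andP[/asboolP HG /eqP HF]].
  by apply: FG; rewrite -HF.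
have F1 : (0 < count (pred1 F) s)%N by rewrite -has_count has_pred1.
have S : (count (predU a (pred1 F)) s <= count (fun H => `[< H `<=` F >]) s)%N.
  apply: sub_count => H /orP[/asboolP HG|/eqP->]; apply/asboolP => //.
  exact: subset_trans HG GF.
by apply: leq_trans S; move: U; rewrite I0 addn0 => ->; rewrite -addn1 leq_add2l.
Qed.

(** Both enumerations are reached from one inclusion order r, whose permissibility is known. *)
Lemma closing_orders_equivalent s t : total_order_on CC s -> total_order_on CC t ->
  closing (fun Q : set M => Q) s -> closing (fun Q : set M => Q) t -> equivalent_orders s t.
Proof.
move=> ts tt cs ct; have [d dP] := pic_dim; have [us sE] := ts; have [ut tE] := tt.
have [r os oo] := inclusion_order us.
have st : perm_eq s t.
  have mems F : F \in s <-> CC F by rewrite sE.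
  have memt F : F \in t <-> CC F by rewrite tE.
  by apply: uniq_perm => // F; apply/idP/idP => [/mems/memt|/memt/mems].
have ot := perm_trans os st; have uo : uniq r by rewrite (perm_uniq os).
have fs := pic_family dP ts; have ft := pic_family dP tt.
have fo : family (fun Q : set M => Q) d r by apply: family_sub fs => F; rewrite (perm_mem os).
have mo : meeting (fun Q : set M => Q) r.
  move=> p F G; rewrite !(perm_mem os) => Fs Gs Fp Gp.
  by have [E Es mE] := closing_meeting cs Fs Gs Fp Gp; exists E => //; rewrite (perm_mem os).
have po : permissible_from (fun Q : set M => Q) (r ++ [::]).
  by rewrite cats0; exact: permissible_ordered fo oo mo.
have no := resolution_nice (fun x : M => x) nM po.
have [ps same_s] := reorder (fun x : M => x) (leqnn _) nM us os fs oo cs po.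
have [pt same_t] := reorder (fun x : M => x) (leqnn _) nM ut ot ft oo ct po.
rewrite !cats0 in ps same_s pt same_t no; split=> //.
have [h [dh hE]] := same_resolution_trans no.1 (same_resolution_sym same_s) same_t.
by exists h; split=> // x _; exact: hE.
Qed.

End PicOrders.

Theorem theorem1 (R : realType) (n : nat) (M : charted_space R n)
    (hM : manifold_with_corners M)
    (CC : set (set M)) (hpic : pic CC) (hlift : mutually_liftable CC)
    (s : seq (set M)) (hs : intersection_order CC s) :
  permissible s /\
  (forall t : seq (set M), size_order CC t -> equivalent_orders s t) /\
  (forall t : seq (set M), intersection_order CC t -> equivalent_orders s t).
Proof.
have cs := intersection_order_closing hM hpic hs; have [ts _] := hs.
have eqv t : total_order_on CC t -> closing (fun Q : set M => Q) t -> equivalent_orders s t.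
  by move=> tt; exact: (closing_orders_equivalent hM hpic hlift).
split; first by have [] := eqv s ts cs.
split=> t ht; have [tt _] := ht; apply: eqv => //.
  exact: (size_order_closing hM hpic hlift ht).
exact: (intersection_order_closing hM hpic ht).
Qed.
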